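(* Let $\Lambda=\hat\Lambda_{n_1}+\hat\Lambda_{n_2}+\dots+\hat\Lambda_{n_k}+h\,\hat\Lambda_0$ with integers $n_1\ge n_2\ge\dots\ge n_k\ge1$ and $h\in\mathbb Z_+$ (where $\hat\Lambda_i$ are the fundamental weights of $b_\infty$), let $c=k+h/2$ be the central charge of the irreducible highest weight $b_\infty$-module $L(b_\infty;\Lambda)$, and let $\lambda_i=\Lambda(E_{ii}-E_{-i,-i})=\#\{r: n_r\ge i\}$ for $i\ge1$. Then the $q$-character of $L(b_\infty;\Lambda)$ with respect to the principal gradation of $b_\infty$ is $$\mathrm{ch}_qL(b_\infty;\Lambda)=\frac{\prod_{1\le i<j\le k}(1-q^{n_i-n_j+j-i})}{\prod_{1\le i\le k}\varphi_{n_i+k-i}(q)}\cdot\frac{\varphi(q^2)^{\overline{2c+1}}\prod_{j>0}\varphi_{2c-2j}(q)}{\varphi(q)^{[\frac{2c+1}2]}}\cdot\prod_{i=0}^{n_1-1}\frac{\varphi_{2c+i+n_1}(q)}{\varphi_{2c+n_1+i-\lambda_{i+1}}(q)}\cdot\prod_{0\le i<j\le n_1}\frac{1-q^{2c+j+i-\lambda_{i+1}-\lambda_j}}{1-q^{2c+j+i}} .$$ The same formula holds for the $\tilde b_\infty$-module $L(\tilde b_\infty;\Lambda)$.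
   Context: $\mathfrak{gl}$ is the Lie algebra of complex matrices $(a_{ij})_{i,j\in\mathbb Z}$ with finitely many nonzero diagonals, and $\widehat{\mathfrak{gl}}=\mathfrak{gl}\oplus\mathbb C1$ its central extension by the cocycle $\mathrm{Tr}([J,A]B)$, $J=\sum_{i\le0}E_{ii}$, graded by $\deg E_{ij}=j-i$, $\deg1=0$ (principal gradation). $b_\infty$ (resp. $\tilde b_\infty$) is the subalgebra $\{A: a_{ij}=(-1)^{i+j+1}a_{-j,-i}\}\oplus\mathbb C1$ (resp. $\{A:a_{ij}=-a_{-j,-i}\}\oplus\mathbb C1$) with the induced gradation. Put $H_0=2(E_{-1,-1}-E_{1,1})+2\cdot1$ and $H_i=E_{ii}-E_{i+1,i+1}+E_{-i-1,-i-1}-E_{-i,-i}$ for $i\ge1$; the fundamental weights are given by $\hat\Lambda_i(H_j)=\delta_{ij}$ ($i,j\ge0$), a weight being determined by its values on $E_{ii}-E_{-i,-i}$ ($i\geq 1$; zero for almost all $i$ here) and its value $c=\Lambda(1)$ (central charge). $L(b_\infty;\Lambda)=\bigoplus_{j\ge0}L_j$ is the irreducible module generated by a vector $v\in L_0$ of weight $\Lambda$ killed by elements of positive degree, with elements of degree $i$ mapping $L_j$ to $L_{j-i}$; $\mathrm{ch}_q L=\sum_j\dim L_j\,q^j$. Notation: $\varphi(q)=\prod_{j\ge1}(1-q^j)$; $\varphi_i(q)=\prod_{j=1}^i(1-q^j)$ (equal to $1$ if $i\le0$); for an integer $m$, $\overline m=1$ if $m$ is even and $\overline m=0$ if $m$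 is odd; $[x]$ is the largest integer $\le x$. If $k=0$, put $n_1=0$. *)

(* Defs.v *)
From HB Require Import structures.
From mathcomp Require Import all_boot all_order all_algebra.
From mathcomp Require Import boolp classical_sets functions cardinality fsbigop.
From mathcomp Require Import reals complex.

Set Implicit Arguments.
Unset Strict Implicit.
Unset Printing Implicit Defensive.

Import Order.TTheory GRing.Theory Num.Theory.
Local Open Scope classical_set_scope.
Local Open Scope ring_scope.

(* Formal power series: a commutative ring in which the units are the series
   whose constant coefficient is a unit, so that [f / g] below is a genuine
   quotient of power series. *)

Record fps (R : Type) := Fps { fcoef : nat -> R }.

HB.instance Definition _ (R : Type) := gen_eqMixin (fps R).
HB.instance Definition _ (R : Type) := gen_choiceMixin (fps R).

Lemma fpsP (R : Type) (f g : fps R) : (forall n, fcoef f n = fcoef g n) -> f = g.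
Proof. by case: f g => [f] [g] /= fg; congr Fps; apply/funext. Qed.

Section FpsRing.
Variable R : comUnitRingType.
Implicit Types f g h : fps R.

Definition fps_zero : fps R := Fps (fun=> 0).
Definition fps_add f g := Fps (fun n => fcoef f n + fcoef g n).
Definition fps_opp f := Fps (fun n => - fcoef f n).
Definition fps_one : fps R := Fps (fun n => (n == 0%N)%:R).
Definition fps_mul f g :=
  Fps (fun n => \sum_(i < n.+1) fcoef f i * fcoef g (n - i)).

Let addA : associative fps_add.
Proof. by move=> f g h; apply: fpsP => n /=; rewrite addrA. Qed.
Let addC : commutative fps_add.
Proof. by move=> f g; apply: fpsP => n /=; rewrite addrC. Qed.
Let add0 : left_id fps_zero fps_add.
Proof. by move=> f; apply: fpsP => n /=; rewrite add0r. Qed.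
Let addN : left_inverse fps_zero fps_opp fps_add.
Proof. by move=> f; apply: fpsP => n /=; rewrite addNr. Qed.
HB.instance Definition _ := GRing.isZmodule.Build (fps R) addA addC add0 addN.

Definition fps_trunc n f : {poly R} := \poly_(i < n) fcoef f i.

Lemma fps_mul_trunc n m f g : (m < n)%N ->
  fcoef (fps_mul f g) m = (fps_trunc n f * fps_trunc n g)`_m.
Proof.
move=> mn; rewrite coefM /=; apply: eq_bigr => i _.
have im : (i <= m)%N by rewrite -ltnS.
by rewrite !coef_poly (leq_ltn_trans im mn) (leq_ltn_trans (leq_subr _ _) mn).
Qed.

Let mulC : commutative fps_mul.
Proof.
by move=> f g; apply: fpsP => n; rewrite !(fps_mul_trunc _ _ (ltnSn n)) mulrC.
Qed.

Let mulA : associative fps_mul.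
Proof.
move=> f g h; apply: fpsP => n.
transitivity ((fps_trunc n.+1 f * (fps_trunc n.+1 g * fps_trunc n.+1 h))`_n).
  rewrite coefM; apply: eq_bigr => i _.
  by rewrite coef_poly ltn_ord -fps_mul_trunc // ltnS leq_subr.
rewrite mulrA coefM; apply: eq_bigr => i _.
by rewrite [in X in _ * X]coef_poly ltnS leq_subr -fps_mul_trunc.
Qed.

Let mul1 : left_id fps_one fps_mul.
Proof.
move=> f; apply: fpsP => n /=; rewrite big_ord_recl /= mul1r subn0.
by rewrite big1 ?addr0 // => i _; rewrite mul0r.
Qed.

Let mulDl : left_distributive fps_mul fps_add.
Proof.
move=> f g h; apply: fpsP => n /=; rewrite -big_split /=.
by apply: eq_bigr => i _; rewrite mulrDl.
Qed.

Let one_neq0 : fps_one != 0.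
Proof.
by apply/eqP => /(congr1 (fun f => fcoef f 0)) /eqP; rewrite /= oner_eq0.
Qed.

HB.instance Definition _ :=
  GRing.Zmodule_isComNzRing.Build (fps R) mulA mulC mul1 mulDl one_neq0.

(* The coefficients g_0, ..., g_n of the inverse g of f, from the recursion
   g_{n+1} = - f_0^-1 (f_1 g_n + ... + f_{n+1} g_0). *)
Fixpoint fps_inv_seq f n : seq R :=
  if n is m.+1 then
    let s := fps_inv_seq f m in
    rcons s (- (fcoef f 0)^-1 * \sum_(i < m.+1) fcoef f i.+1 * s`_(m - i))
  else [:: (fcoef f 0)^-1].

Definition fps_unit : {pred fps R} := fun f => fcoef f 0 \is a GRing.unit.

Definition fps_inv f :=
  if fps_unit f then Fps (fun n => (fps_inv_seq f n)`_n) else f.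

Lemma size_fps_inv_seq f n : size (fps_inv_seq f n) = n.+1.
Proof. by elim: n => //= n IH; rewrite size_rcons IH. Qed.

Lemma nth_fps_inv_seq f n m : (m <= n)%N ->
  (fps_inv_seq f n)`_m = (fps_inv_seq f m)`_m.
Proof.
elim: n => [|n IH]; first by rewrite leqn0 => /eqP->.
rewrite leq_eqVlt => /orP[/eqP-> //|mn].
by rewrite /= nth_rcons size_fps_inv_seq mn IH.
Qed.

Let mulV : {in fps_unit, left_inverse 1 fps_inv *%R}.
Proof.
move=> f fu; rewrite mulrC; apply: fpsP => -[|n].
  by rewrite /= big_ord_recl big_ord0 addr0 /fps_inv ifT //= divrr.
rewrite /= big_ord_recl /= /fps_inv ifT //= nth_rcons size_fps_inv_seq ltnn eqxx.
rewrite mulrA mulrN divrr // mulN1r mulr0n.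
apply/eqP; rewrite addrC subr_eq0; apply/eqP; apply: eq_bigr => i _.
by rewrite /bump /= add1n subSS (@nth_fps_inv_seq _ n) ?leq_subr //.
Qed.

Let unitPl f g : g * f = 1 -> fps_unit f.
Proof.
move=> /(congr1 (fun f => fcoef f 0)); rewrite /= big_ord_recl big_ord0 addr0.
by move=> gf; apply/unitrP; exists (fcoef g 0); split=> //; rewrite mulrC.
Qed.

Let inv_out : {in [predC fps_unit], fps_inv =1 id}.
Proof. by move=> f fN; rewrite /fps_inv ifN. Qed.

HB.instance Definition _ :=
  GRing.ComNzRing_hasMulInverse.Build (fps R) mulV unitPl inv_out.

Lemma fps_unitE f : (f \is a GRing.unit) = (fcoef f 0 \is a GRing.unit).
Proof. by []. Qed.

End FpsRing.

Section QProducts.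
Variable R : comUnitRingType.

Definition qvar : fps R := Fps (fun n => (n == 1%N)%:R).

(* prod_{j >= 1} F j, for F j = 1 mod q^j. *)
Definition fps_prod_inf (F : nat -> fps R) : fps R :=
  Fps (fun n => fcoef (\prod_(1 <= j < n.+1) F j) n).

(* euler_phi m = phi(q^m), for m > 0. *)
Definition euler_phi (m : nat) : fps R :=
  fps_prod_inf (fun j => 1 - qvar ^+ (m * j)).

Definition euler_phi_fin (i : nat) : fps R := \prod_(1 <= j < i.+1) (1 - qvar ^+ j).

End QProducts.

(* Matrices indexed by the integers; [F^o] is [F] as a vector space over itself,
   so that [zmat F] and [ghat F] are vector spaces for the entrywise operations. *)

Definition zmat (F : fieldType) : lmodType F := int -> int -> F^o.

Definition ghat (F : fieldType) : lmodType F := (zmat F * F^o)%type.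

Section HatGl.
Variable F : fieldType.
Implicit Types (A B : zmat F) (x y : ghat F).

Definition is_gl A : Prop := finite_set [set d : int | exists i : int, A i (i + d) != 0].

(* For A and B in gl all the sums below have finite support. *)
Definition zmulmx A B : zmat F := fun i j => \sum_(k \in [set: int]) A i k * B k j.

Definition ztrace A : F := \sum_(i \in [set: int]) A i i.

Definition zdelta (i j : int) : zmat F := fun k l => ((k == i) && (l == j))%:R.

Definition Jmx : zmat F := fun i j => ((i == j) && (i <= 0))%:R.

Definition cocycle A B : F := ztrace (zmulmx (zmulmx Jmx A - zmulmx A Jmx) B).

Definition hatbr x y : ghat F :=
  (zmulmx x.1 y.1 - zmulmx y.1 x.1, cocycle x.1 y.1).

Definition hat_deg (d : int) x : Prop :=
  (forall i j : int, j - i != d -> x.1 i j = 0) /\ (d != 0 -> x.2 = 0).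

Definition hat_of A : ghat F := (A, 0).
Definition central : ghat F := (0, 1).

Definition b_infty : set (ghat F) :=
  [set x | is_gl x.1 /\
           forall i j : int, x.1 i j = (-1) ^ (i + j + 1) * x.1 (- j) (- i)].

Definition tb_infty : set (ghat F) :=
  [set x | is_gl x.1 /\ forall i j : int, x.1 i j = - x.1 (- j) (- i)].

(* E_{ii} - E_{-i,-i} *)
Definition hdiag (i : nat) : ghat F :=
  hat_of (zdelta i%:Z i%:Z - zdelta (- i%:Z) (- i%:Z)).

Definition coroot (i : nat) : ghat F :=
  if i == 0%N then
    2 *: hat_of (zdelta (-1) (-1) - zdelta 1 1) + 2 *: central
  else
    hat_of (zdelta i%:Z i%:Z - zdelta (i.+1)%:Z (i.+1)%:Z
            + zdelta (- (i.+1)%:Z) (- (i.+1)%:Z) - zdelta (- i%:Z) (- i%:Z)).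

(* A weight is a function that is only ever evaluated on the subspace of
   elements of degree 0 of b_infty, equivalently of tb_infty: the (diag a, z) with
   a_{-i} = - a_i. *)
Definition is_cartan x : Prop :=
  hat_deg 0 x /\ forall i : int, x.1 (- i) (- i) = - x.1 i i.

Definition is_weight (La : ghat F -> F) : Prop :=
  finite_set [set i : nat | (0 < i)%N /\ La (hdiag i) != 0] /\
  forall x, is_cartan x ->
    La x = \sum_(i \in [set i : nat | (0 < i)%N]) x.1 i%:Z i%:Z * La (hdiag i)
           + x.2 * La central.

Definition is_fundamental_weight (i : nat) (La : ghat F -> F) : Prop :=
  is_weight La /\ forall j, La (coroot j) = (i == j)%:R.

End HatGl.

Lemma fundamental_weight_exists (F : fieldType) (i : nat) : (2 : F) != 0 ->
  exists La : ghat F -> F, is_fundamental_weight i La.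
Proof.
move=> two_neq0.
pose c : F := if i == 0%N then 2^-1 else 1.
pose La (x : ghat F) : F := \sum_(m < i) x.1 m.+1%:Z m.+1%:Z + c * x.2.
have sum_delta (j : nat) : (0 < j)%N ->
    \sum_(m < i) ((m.+1%:Z == j%:Z) && (m.+1%:Z == j%:Z))%:R
    = (j <= i)%:R :> F.
  case: j => // j _; case: (ltnP j i) => ji.
    rewrite (bigD1 (Ordinal ji)) //= !eqxx big1 ?addr0 // => m mj.
    rewrite andbb !eqz_nat eqSS; case: eqP => // mE.
    by move: mj; rewrite -val_eqE /= mE eqxx.
  rewrite big1 // => m _; rewrite andbb eqz_nat eqSS.
  by case: eqP => // mE; move: (ltn_ord m); rewrite mE ltnNge ji.
have delta_neg (m j : nat) : (m.+1%:Z == - j%:Z) = false.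
  by case: j => [|j].
have La_hdiag j : (0 < j)%N -> La (hdiag F j) = (j <= i)%:R.
  move=> j0; rewrite /La /= mulr0 addr0 -(sum_delta _ j0).
  by apply: eq_bigr => m _; rewrite !fctE /zdelta delta_neg subr0.
have La_central : La (central F) = c.
  by rewrite /La /= mulr1 big1 ?add0r.
exists La; split; [split|].
- apply: (@sub_finite_set _ _ `I_i.+1); last exact: finite_II.
  move=> j /= [j0]; rewrite La_hdiag // ltnS.
  by case: (j <= i)%N; rewrite ?eqxx.
- move=> x _; rewrite La_central [LHS]/La [c * _]mulrC; congr (_ + _).
  transitivity (\sum_(m <- iota 1 i) x.1 m%:Z m%:Z * La (hdiag F m)).
    rewrite (iotaDl 1 0) big_map -[in iota 0 i](subn0 i) -/(index_iota 0 i) big_mkord.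
    apply: eq_bigr => m _; rewrite La_hdiag //.
    by rewrite add1n ltn_ord mulr1.
  rewrite fsbig_seq ?iota_uniq //; apply: fsbig_widen => m /=.
  + by rewrite mem_iota => /andP[].
  + move=> [m0]; rewrite mem_iota m0 add1n ltnS La_hdiag //= => /negP/negPf->.
    by rewrite mulr0.
- have La_lin a x y : La (a *: x + y) = a * La x + La y.
    rewrite /La mulrDr mulrCA !mulrDr addrACA mulr_sumr -big_split.
    by [].
  have La_lin' a x : La (a *: x) = a * La x.
    rewrite -[a *: x]addr0 La_lin -[RHS]addr0; congr (_ + _).
    by rewrite /La /= mulr0 addr0 big1.
  case=> [|j].
    have -> : coroot F 0 = (- 2) *: hdiag F 1 + 2 *: central F.
      by rewrite /coroot eqxx /hdiag scaleNr -scalerN; congr (2 *: _ + _);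
        congr pair; rewrite /= ?oppr0 ?opprB.
    rewrite La_lin La_lin' La_hdiag // La_central /c.
    by case: i {La sum_delta La_hdiag La_central La_lin La_lin' c} => [|i] /=;
      rewrite ?mulr0 ?mulr1 ?add0r ?divff ?addNr.
  have -> : coroot F j.+1 = (- 1) *: hdiag F j.+2 + hdiag F j.+1.
    rewrite /coroot /= /hdiag scaleN1r; congr pair; last by rewrite /= oppr0 addr0.
    by rewrite /= opprB addrA; congr (_ - _); rewrite addrC addrA addrAC.
  rewrite La_lin !La_hdiag // mulN1r.
  case: (ltngtP i j.+1) => [||] /=; rewrite ?oppr0 ?addr0 ?add0r ?addNr //.
Qed.

Section Modules.
Variables (F : fieldType) (V : lmodType F).

Definition subspace (W : set V) : Prop :=
  W 0 /\ forall (a : F) u w, W u -> W w -> W (a *: u + w).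

(* [rho] is only constrained on [g]. *)
Definition is_rep (g : set (ghat F)) (rho : ghat F -> V -> V) : Prop :=
  [/\ forall x, g x -> forall (a : F) u w,
        rho x (a *: u + w) = a *: rho x u + rho x w,
      forall x y, g x -> g y -> forall (a : F) u,
        rho (a *: x + y) u = a *: rho x u + rho y u
    & forall x y, g x -> g y -> forall u,
        rho (hatbr x y) u = rho x (rho y u) - rho y (rho x u)].

Definition submodule (g : set (ghat F)) (rho : ghat F -> V -> V) (W : set V) : Prop :=
  subspace W /\ forall x w, g x -> W w -> W (rho x w).

Definition direct_sum (L : nat -> set V) : Prop :=
  [/\ forall j, subspace (L j),
      forall u, exists n (f : nat -> V),
        (forall j, L j (f j)) /\ u = \sum_(j < n) f j
    & forall n (f : nat -> V), (forall j, L j (f j)) ->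
        \sum_(j < n) f j = 0 -> forall j, (j < n)%N -> f j = 0].

Definition graded_part (L : nat -> set V) (m : int) : set V :=
  if m is Posz j then L j else [set 0].

Record irr_highest_weight_module (g : set (ghat F)) (La : ghat F -> F)
    (rho : ghat F -> V -> V) (L : nat -> set V) (v : V) : Prop := {
  hw_rep : is_rep g rho;
  hw_grading : direct_sum L;
  hw_degree : forall (d : int) x (j : nat) u, g x -> hat_deg d x -> L j u ->
    graded_part L (j%:Z - d) (rho x u);
  hw_vector : L 0%N v /\ v != 0;
  hw_weight : forall x, g x -> hat_deg 0 x -> rho x v = La x *: v;
  hw_killed : forall (d : int) x, 0 < d -> g x -> hat_deg d x -> rho x v = 0;
  hw_generated : forall W, submodule g rho W -> W v -> W = setT;
  hw_irreducible : forall W, submodule g rho W -> W = [set 0] \/ W = setT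
}.

Definition has_dim (W : set V) (d : nat) : Prop :=
  exists e : 'I_d -> V, (forall i, W (e i)) /\
    forall u, W u -> exists! a : 'rV[F]_d, u = \sum_i a 0 i *: e i.

(* In particular all the L j are finite-dimensional. *)
Definition is_q_character (L : nat -> set V) (f : fps rat) : Prop :=
  exists d : nat -> nat,
    (forall j, has_dim (L j) (d j)) /\ f = Fps (fun j => (d j)%:R).

End Modules.

(* The sequence ns = [:: n_1; ...; n_k] is numbered from 1; n_1 = 0 if k = 0. *)
Definition nth1 (ns : seq nat) (i : nat) : nat := nth 0%N ns i.-1.

Definition conj_part (ns : seq nat) (i : nat) : nat := count (fun n => (i <= n)%N) ns.

(* Here tc = 2c = 2k + h.  For n_1 >= ... >= n_k >= 1 the natural number
   subtractions in exponents and indices are genuine, except in phi_{2c-2j}, where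
   truncation gives phi_0 = 1 for j >= c, as wanted; in particular it is enough
   to let j run up to 2c. *)
Definition character_formula (ns : seq nat) (h : nat) : fps rat :=
  let q := qvar rat in
  let phi := euler_phi_fin rat in
  let k := size ns in
  let n := nth1 ns in
  let lam := conj_part ns in
  let tc := (2 * k + h)%N in
  (\prod_(1 <= i < k.+1) \prod_(i.+1 <= j < k.+1)
      (1 - q ^+ ((n i - n j) + (j - i))))
    / (\prod_(1 <= i < k.+1) phi (n i + (k - i))%N)
  * ((euler_phi rat 2 ^+ (~~ odd tc.+1) * \prod_(1 <= j < tc.+1) phi (tc - 2 * j)%N)
     / euler_phi rat 1 ^+ (tc.+1 %/ 2))
  * \prod_(0 <= i < n 1%N)
      (phi (tc + i + n 1)%N / phi (tc + n 1 + i - lam i.+1)%N)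
  * \prod_(0 <= i < (n 1%N).+1) \prod_(i.+1 <= j < (n 1%N).+1)
      ((1 - q ^+ (tc + j + i - lam i.+1 - lam j)) / (1 - q ^+ (tc + j + i))).

(* Main.v *)
(* After conjugation by a diagonal sign matrix b_infty becomes tb_infty, and adding
   central terms to the elements E_{ij} - E_{-j,-i} trivialises the cocycle on finite
   matrices, so that these elements satisfy the relations of so(2N+1) for |i|, |j| <= N.
   An element of tb_infty supported far from the origin kills all vectors of small degree;
   hence for N large the component L_J is spanned by the action of so(2N+1) on v.

   For the finite-rank module so obtained, write m_nu for the dimension of its weight
   spaces (weights are taken relative to the highest weight Lambda) and S_a for the shift
   m |-> m(. + a).  Comparing the trace of the Casimir element on a weight space with its
   eigenvalue gives Freudenthal's recursion; multiplying it by prod_{a > 0} (1 - S_a)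
   shows that D = prod_{a > 0} (1 - S_a) m is supported where
   (nu, nu + 2 Lambda + 2 rho) = 0.  Since m is invariant under the Weyl group, D is
   antisymmetric for the dotted action, and this forces D to be the Weyl numerator.  As the
   character of the finite-rank module is only needed in the principal specialization, the
   numerator becomes a determinant of Vandermonde type, hence a product.

   Finally N tends to infinity: the products over pairs i < j and over pairs i <= j are
   telescoped separately modulo q^(J+1). *)

Require Import Defs.
From HB Require Import structures.
From mathcomp Require Import all_boot all_order perm all_algebra.
From mathcomp Require Import boolp classical_sets functions cardinality fsbigop.
From mathcomp Require Import reals complex.
From mathcomp Require Import zify ring lra.
Set Implicit Arguments.
Unset Strict Implicit.
Unset Printing Implicit Defensive.
Import Order.TTheory GRing.Theory Num.Theory.
Local Open Scope ring_scope.

(** Irreducibility enters through one fact only: a vector of positive degree killed by all elements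
    of positive degree is 0. It shows that elements supported far from the origin act by zero, and
    that a power of each lowering operator kills [v], whence the Weyl invariance of the
    multiplicities. Multiplying Freudenthal's recursion by the product operator is a Laplacian
    computation: the first order term is a derivative of the product and reproduces the traces of
    the recursion, so that they drop out; the second order term vanishes because every exponent of
    the Weyl denominator has the norm of rho. Both this and the identification of D rest on one
    principle: an alternating function is determined by its values where the shifted weight is
    strictly dominant. As E_{ij} has degree j - i, it is given the weight [dlt j - dlt i]; Lambda
    then has coordinates c - lambda_k, which is the origin of the exponents 2c + ... - lambda_i -
    lambda_j. These coordinates may be half-integers, so weights are doubled. No limit is taken: for
    each J one fixed N, at least n_1 + 2J, gives the coefficient of q^J. *)

(** * Coefficients of formal power series *)

Section FpsBasics.
Variable R : comUnitRingType.
Implicit Types f g : fps R.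

Lemma fcoefD f g n : fcoef (f + g) n = fcoef f n + fcoef g n. Proof. by []. Qed.
Lemma fcoefN f n : fcoef (- f) n = - fcoef f n. Proof. by []. Qed.
Lemma fcoefM f g n :
  fcoef (f * g) n = \sum_(i < n.+1) fcoef f i * fcoef g (n - i)%N.
Proof. by []. Qed.

Lemma fcoef_sum I (r : seq I) (P : pred I) (f : I -> fps R) n :
  fcoef (\sum_(i <- r | P i) f i) n = \sum_(i <- r | P i) fcoef (f i) n.
Proof. by elim/big_rec2: _ => // i u v _ <-. Qed.

Lemma qvarX h n : fcoef (qvar R ^+ h) n = (n == h)%:R.
Proof.
elim: h n => [|h IH] n; first by rewrite expr0.
rewrite exprS fcoefM; case: n => [|n].
  by rewrite big_ord_recl big_ord0 /= mul0r addr0.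
rewrite big_ord_recl /= mul0r add0r big_ord_recl /= mul1r subSS subn0 IH eqSS.
by rewrite big1 ?addr0 // => i _; rewrite mul0r.
Qed.

Lemma fcoef_qvarXM h f n :
  fcoef (qvar R ^+ h * f) n = if (h <= n)%N then fcoef f (n - h)%N else 0.
Proof.
rewrite fcoefM; case: leqP => hn.
  rewrite (bigD1 (Ordinal (hn : (h < n.+1)%N))) //= qvarX eqxx mul1r big1 ?addr0 //.
  by move=> i; rewrite -val_eqE qvarX /= => /negPf->; rewrite mul0r.
rewrite big1 // => i _; rewrite qvarX; case: eqP => [ih|]; last by rewrite mul0r.
by move: (ltn_ord i); rewrite ih ltnS leqNgt hn.
Qed.

End FpsBasics.

(** * Products of difference operators on functions on an abelian group *)

Section ShiftOperators.
Variables (X : zmodType) (R : comNzRingType).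
Implicit Types (s : seq X) (f g : X -> R).

(* The operator prod_{a in s} (1 - S_a), where (S_a f) nu = f (nu + a). *)
Fixpoint diffop s f : X -> R :=
  if s is a :: s' then fun nu => diffop s' f nu - diffop s' f (nu + a) else f.

Lemma eq_diffop s f g : f =1 g -> diffop s f =1 diffop s g.
Proof. by move=> fg; elim: s => //= a s IH nu; rewrite !IH. Qed.

Lemma diffop_shift s f b nu :
  diffop s (fun mu => f (mu + b)) nu = diffop s f (nu + b).
Proof. by elim: s nu => //= a s IH nu; rewrite !IH addrAC. Qed.

Lemma diffopP s (c : R) f g nu :
  diffop s (fun mu => c * f mu + g mu) nu = c * diffop s f nu + diffop s g nu.
Proof.
elim: s nu => //= a s IH nu; rewrite !IH mulrBr; ring.
Qed.

Lemma diffopB s f g nu :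
  diffop s (fun mu => f mu - g mu) nu = diffop s f nu - diffop s g nu.
Proof. by elim: s nu => //= a s IH nu; rewrite !IH; ring. Qed.

Lemma diffop_rem a s f : a \in s -> diffop s f =1 diffop (a :: rem a s) f.
Proof.
elim: s => // b s IH; rewrite inE eq_sym /=; case: eqVneq => [-> //|ba] /= ain nu.
by rewrite !(IH ain) /=; rewrite [nu + b + a]addrAC; ring.
Qed.

Lemma perm_diffop s t f : perm_eq s t -> diffop s f =1 diffop t f.
Proof.
elim: s t => [|a s IH] t; first by rewrite perm_sym => /perm_nilP->.
move=> st nu; have at_ : a \in t by rewrite -(perm_mem st) mem_head.
rewrite (diffop_rem _ at_) /= !(IH (rem a t)) //;
  by rewrite -(perm_cons a) (perm_trans st) // perm_to_rem.
Qed.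

Lemma diffop_map (r : X -> X) s f : {morph r : x y / x + y} ->
  forall b nu, diffop s (fun mu => f (r mu + b)) nu = diffop (map r s) f (r nu + b).
Proof.
move=> rD b nu; elim: s nu => //= a s IH nu; rewrite !IH rD; congr (_ - diffop _ _ _).
by rewrite addrAC.
Qed.

(** The product expanded into signed shifts, repetitions not collected, so that a weight depending
    on the shift can be inserted term by term. *)
Fixpoint diffop_terms s : seq (R * X) :=
  if s is a :: s' then
    diffop_terms s' ++ [seq (- t.1, t.2 + a) | t <- diffop_terms s']
  else [:: (1, 0)].

Lemma diffopE s f nu :
  diffop s f nu = \sum_(t <- diffop_terms s) t.1 * f (nu + t.2).
Proof.
elim: s nu => [|a s IH] nu /=; first by rewrite big_seq1 mul1r addr0.
rewrite big_cat big_map /= !IH; congr (_ + _); rewrite -sumrN.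
by apply: eq_bigr => t _; rewrite mulNr addrA addrAC.
Qed.

(* The coefficient of [S_c] in the operator is its value at [- c] on the
   indicator function of 0. *)
Lemma diffop_terms_eq0 s (g f : X -> R) :
  (forall c, g c * diffop s (fun mu => (mu == 0)%:R) (- c) = 0) ->
  \sum_(t <- diffop_terms s) t.1 * (g t.2 * f t.2) = 0.
Proof.
move=> g0; pose u := undup [seq t.2 | t <- diffop_terms s].
transitivity (\sum_(t <- diffop_terms s) \sum_(c <- u)
    (t.1 * (g c * f c)) * (t.2 == c)%:R).
  rewrite !big_seq; apply: eq_bigr => t ts.
  have tu : t.2 \in u by rewrite mem_undup map_f.
  rewrite (bigD1_seq t.2) ?undup_uniq //= eqxx mulr1 big1 ?addr0 // => c.
  by rewrite eq_sym => /negPf->; rewrite mulr0.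
rewrite exchange_big /= big1 // => c _.
transitivity (f c * (g c * diffop s (fun mu => (mu == 0)%:R) (- c))); last first.
  by rewrite g0 mulr0.
rewrite diffopE !mulr_sumr; apply: eq_bigr => t _.
by rewrite addrC subr_eq0; ring.
Qed.

(** The left-hand side is a derivative of the operator, since [H] is additive in the shift. The
    derivative of a factor 1 - S_a is - H(a, .) S_a, which by hypothesis is - (1 - S_a) applied to
    [T p]; the Leibniz rule thus restores the full product in front of every [T p]. *)
Lemma diffop_leibniz (P : eqType) (wt : P -> X) (s : seq P) (H : X -> X -> R)
    (T : P -> X -> R) nu :
  (forall mu, {morph H^~ mu : a b / a + b}) ->
  (forall p mu, p \in s -> H (wt p) (mu + wt p) = T p mu - T p (mu + wt p)) ->
  \sum_(t <- diffop_terms (map wt s)) t.1 * H t.2 (nu + t.2) =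
  - diffop (map wt s) (fun mu => \sum_(p <- s) T p mu) nu.
Proof.
move=> HD HT; have H0 mu : H 0 mu = 0.
  by have /eqP := HD mu 0 0; rewrite addr0 -subr_eq0 opprD addNKr oppr_eq0 => /eqP.
elim: s nu HT => [|p s IHs] nu HT; first by rewrite /= big_seq1 H0 big_nil mulr0 oppr0.
have IH mu := IHs mu (fun q x qs => HT q x (mem_behead (s := p :: s) qs)).
rewrite /= big_cat big_map /= IH.
under [X in _ + X]eq_bigr => t _.
  rewrite HD [t.2 + wt p]addrC addrA mulNr mulrDr; over.
rewrite sumrN big_split /= IH.
have -> : \sum_(t <- diffop_terms (map wt s)) t.1 * H (wt p) (nu + wt p + t.2) =
    diffop (map wt s) (T p) nu - diffop (map wt s) (T p) (nu + wt p).
  rewrite -diffop_shift -diffopB diffopE; apply: eq_bigr => t _.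
  by rewrite -HT ?mem_head // addrAC.
have E mu : diffop (map wt s) (fun mu => \sum_(j <- p :: s) T j mu) mu =
  diffop (map wt s) (T p) mu + diffop (map wt s) (fun mu => \sum_(j <- s) T j mu) mu.
  rewrite -[X in X + _]mul1r -diffopP; apply: eq_diffop => ?.
  by rewrite big_cons mul1r.
by rewrite !E; ring.
Qed.

(* A Laplacian [Q] whose first order part on [m] is [- 2 sum T] annihilates
   [diffop s m]: its second order part vanishes on the operator by [hg]. *)
Lemma diffop_laplacian (P : eqType) (wt : P -> X) (s : seq P) (H : X -> X -> R)
    (T : P -> X -> R) (m Q g : X -> R) nu :
  (forall mu, {morph H^~ mu : a b / a + b}) ->
  (forall p mu, p \in s -> H (wt p) (mu + wt p) = T p mu - T p (mu + wt p)) ->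
  (forall mu c, Q (mu + c) * m (mu + c) =
     Q mu * m (mu + c) + 2 * H c (mu + c) - g c * m (mu + c)) ->
  (forall c, g c * diffop (map wt s) (fun mu => (mu == 0)%:R) (- c) = 0) ->
  (forall mu, Q mu * m mu = - (2 * \sum_(p <- s) T p mu)) ->
  Q nu * diffop (map wt s) m nu = 0.
Proof.
move=> HD HT HQ hg Qm.
have := diffopE (map wt s) (fun mu => Q mu * m mu) nu.
under eq_bigr => t _ do rewrite HQ mulrBr mulrDr.
rewrite sumrB big_split /= (diffop_terms_eq0 (fun c => m (nu + c)) hg) subr0.
under eq_bigr => t _ do rewrite mulrCA.
under [X in _ = _ + X -> _]eq_bigr => t _ do rewrite mulrCA.
rewrite -!mulr_sumr -diffopE (diffop_leibniz _ HD HT) (eq_diffop _ Qm).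
have -> : diffop (map wt s) (fun mu => - (2 * \sum_(p <- s) T p mu)) nu =
   - 2 * diffop (map wt s) (fun mu => \sum_(p <- s) T p mu) nu + diffop (map wt s) (fun=> 0) nu.
  by rewrite -diffopP; apply: eq_diffop => mu; rewrite mulNr addr0.
have -> : diffop (map wt s) (fun=> 0 : R) nu = 0.
  by rewrite diffopE big1 // => t _; rewrite mulr0.
rewrite addr0 mulNr mulrN => /eqP.
by rewrite eq_sym -subr_eq0 addrK => /eqP.
Qed.

(** Only the factor of [a] changes under [r], and 1 - S_(-a) = - S_(-a) (1 - S_a). This gives the
    sign, and the extra shift turns [n] into [n + 1]: the passage from Lambda to Lambda + rho. *)
Lemma diffop_reflection (r : X -> X) s a f (n : int) nu :
  {morph r : x y / x + y} -> r a = - a -> a \in s ->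
  perm_eq (map r s) (- a :: rem a s) ->
  (forall mu, f (r mu - a *~ n) = f mu) ->
  diffop s f (r nu - a *~ (n + 1)) = - diffop s f nu.
Proof.
move=> rD ra a_s perm fr.
have -> : diffop s f nu = diffop (map r s) f (r nu - a *~ n).
  by rewrite -diffop_map //; apply: eq_diffop => mu; rewrite fr.
rewrite (perm_diffop _ perm) (diffop_rem _ a_s) /= mulrzDr mulr1z opprD addrA subrK.
by rewrite opprB.
Qed.

End ShiftOperators.

Lemma diffop_map_val (X : zmodType) (R R' : comNzRingType) (h : {rmorphism R -> R'})
    (s : seq X) (f : X -> R) nu :
  diffop s (fun mu => h (f mu)) nu = h (diffop s f nu).
Proof. by elim: s nu => //= a s IH nu; rewrite !IH rmorphB. Qed.

(** * The principal specialization of a formal character *)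

Section Specialization.
Variables (X : zmodType) (deg : X -> int).
Hypothesis degD : {morph deg : x y / x + y}.
Variable R : comUnitRingType.
Implicit Types f g : X -> R.
Local Open Scope classical_set_scope.

(** Guards against a default value: the sum in [level_sum] is 0 when its support is infinite. *)
Definition level_finite f : Prop :=
  forall j : int, finite_set [set nu | deg nu = j /\ f nu != 0].

Definition nonpos_support f : Prop := forall nu, 0 < deg nu -> f nu = 0.

Definition level_sum f (j : int) : R := \sum_(nu \in [set nu | deg nu = j]) f nu.

(** The image of the sum of the f(nu) e^nu under e^nu |-> q^(- deg nu); levels of positive degree
    are invisible, hence [nonpos_support]. *)
Definition spec f : fps R := Fps (fun j => level_sum f (- j%:Z)).

Lemma level_sumB f g j : level_finite f -> level_finite g ->
  level_sum (fun nu => f nu - g nu) j = level_sum f j - level_sum g j.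
Proof.
move=> /(_ j) ff /(_ j) fg.
set A := [set nu | deg nu = j /\ f nu != 0] `|` [set nu | deg nu = j /\ g nu != 0].
have finA : finite_set A by rewrite finite_setU.
have widen k : (forall nu, deg nu = j -> ~ A nu -> k nu = 0) ->
    level_sum k j = \sum_(nu \in A) k nu.
  move=> kA; rewrite /level_sum; apply/esym/fsbig_widen => nu.
    by move=> [] [].
  by move=> [/= nuj nA]; apply: kA.
have Af nu : deg nu = j -> ~ A nu -> f nu = 0.
  by move=> nuj nA; apply/eqP; apply: contra_notT nA => fn; left.
have Ag nu : deg nu = j -> ~ A nu -> g nu = 0.
  by move=> nuj nA; apply/eqP; apply: contra_notT nA => fn; right.
rewrite !widen // => [|nu nuj nA]; last by rewrite Af // Ag // subr0.
have gN : \sum_(nu \in A) g nu = - \sum_(nu \in A) - g nu.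
  by rewrite !fsbig_finite //= sumrN opprK.
by rewrite gN opprK !fsbig_finite //= -big_split.
Qed.

Lemma level_sum_shift f a j :
  level_sum (fun nu => f (nu + a)) j = level_sum f (j + deg a).
Proof.
apply/esym/(@reindex_fsbig _ _ _ _ _ (fun nu => nu + a) [set nu | deg nu = j]).
split=> [nu /= <-|x y _ _ /addIr //|nu /= nuj]; first by rewrite degD.
exists (nu - a); last by rewrite subrK.
by apply: (addIr (deg a)); rewrite -degD subrK.
Qed.

Lemma level_finite_shift f a : level_finite f -> level_finite (fun nu => f (nu + a)).
Proof.
move=> ff j; apply: (@sub_finite_set _ _
  ((fun nu => nu - a) @` [set nu | deg nu = j + deg a /\ f nu != 0])).
  by move=> nu /= [nuj fn]; exists (nu + a); rewrite ?addrK // degD nuj.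
exact/finite_image/ff.
Qed.

Lemma level_finiteB f g : level_finite f -> level_finite g ->
  level_finite (fun nu => f nu - g nu).
Proof.
move=> ff fg j; apply: (@sub_finite_set _ _
  ([set nu | deg nu = j /\ f nu != 0] `|` [set nu | deg nu = j /\ g nu != 0])).
  move=> nu /= [nuj fgn]; case: (eqVneq (f nu) 0) => [f0|fn]; [right|by left].
  by split=> //; apply: contraNneq fgn => ->; rewrite f0 subrr.
by rewrite finite_setU; split; [apply: ff|apply: fg].
Qed.

Lemma diffop_support s f : (forall a, a \in s -> 0 <= deg a) ->
  level_finite f -> nonpos_support f ->
  level_finite (diffop s f) /\ nonpos_support (diffop s f).
Proof.
elim: s => //= a s IH sa ff f0.
have [ff' f0'] : level_finite (diffop s f) /\ nonpos_support (diffop s f).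
  by apply: IH => // b bs; apply: sa; rewrite inE bs orbT.
split; first by apply: level_finiteB => //; apply: level_finite_shift.
move=> nu nu0; rewrite !f0' ?subrr // degD ltr_wpDr // sa ?mem_head //.
Qed.

Lemma spec_diffop s f : (forall a, a \in s -> 0 <= deg a) ->
  level_finite f -> nonpos_support f ->
  spec (diffop s f) = spec f * \prod_(a <- s) (1 - qvar R ^+ `|deg a|%N).
Proof.
move=> sa ff f0; elim: s sa => [|a s IH] sa; first by rewrite big_nil mulr1.
have sa' b : b \in s -> 0 <= deg b by move=> bs; apply: sa; rewrite inE bs orbT.
have [ff' f0'] := diffop_support sa' ff f0.
rewrite big_cons mulrCA -IH // mulrBl mul1r; apply: fpsP => j.
rewrite [LHS]level_sumB //; last exact: level_finite_shift.
rewrite fcoefD fcoefN fcoef_qvarXM; congr (_ - _).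
rewrite level_sum_shift -[deg a in LHS]gez0_abs ?sa ?mem_head //.
case: leqP => aj; first by rewrite /= -subzn // opprB addrC.
(* Here [deg a > j]: the shifted level has positive degree, where the function vanishes. *)
rewrite /level_sum fsbig1 // => nu /= nuj; apply: f0'.
by rewrite nuj addrC subr_gt0 ltz_nat.
Qed.

End Specialization.

(** * Weight lattice, roots and simple reflections of type B_N *)

Section Lattice.
Variable N : nat.
Local Notation X := {ffun 'I_N -> int}.
Implicit Types (nu mu : X) (i j : int) (p : nat).

(* The coordinates of [nu], indexed from 1 and extended to an odd function of the
   index, and the dual basis of weights. *)
Definition crd nu i : int :=
  match i with
  | Posz 0 => 0
  | Posz p.+1 => oapp nu 0 (insub p)
  | Negz p => - oapp nu 0 (insub p)
  end.

Definition dlt i : X := [ffun k : 'I_N => (i == k.+1%:Z)%:Z - (i == - k.+1%:Z)%:Z].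

(** The simple roots; the short one is [alpha 0], because [dlt 0 = 0]. *)
Definition alpha p : X := dlt p.+1%:Z - dlt p%:Z.

(** The height: the pairing with (1, ..., N) is 1 on each simple root, which is the principal
    gradation. *)
Definition deg nu : int := \sum_(k < N) k.+1%:Z * nu k.

Definition ip nu mu : int := \sum_k nu k * mu k.

Lemma crd_ord nu (k : 'I_N) : crd nu k.+1%:Z = nu k.
Proof. by rewrite /= valK. Qed.

Lemma crd_Ordinal nu p (pN : (p < N)%N) : crd nu p.+1%:Z = nu (Ordinal pN).
Proof. exact: (crd_ord nu (Ordinal pN)). Qed.

Lemma crdN nu i : crd nu (- i) = - crd nu i.
Proof. by case: i => [[|p]|p] //=; rewrite ?oppr0 ?opprK. Qed.

Lemma crd0 nu : crd nu 0 = 0. Proof. by []. Qed.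

Lemma crdD nu mu i : crd (nu + mu) i = crd nu i + crd mu i.
Proof.
have D p : oapp (nu + mu) 0 (insub p) = oapp nu 0 (insub p) + oapp mu 0 (insub p) :> int.
  by case: insubP => [k _ _|_] /=; rewrite ?ffunE ?addr0.
by case: i => [[|p]|p] //=; rewrite D // opprD.
Qed.

Lemma crdZ nu i (c : int) : crd (nu *~ c) i = crd nu i * c.
Proof.
have E mu (k : 'I_N) : (mu *~ c) k = mu k * c.
  have MN (f : X) n : (f *+ n) k = f k * n%:Z.
    by elim: n => [|n IH]; rewrite ?mulr0n ?ffunE ?mulr0 // mulrS ffunE IH intS mulrDr mulr1.
  case: c => n; first by rewrite -[mu *~ _]/(mu *+ n) MN.
  by rewrite -[mu *~ _]/(- (mu *+ n.+1)) ffunE MN NegzE mulrN.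
have D p : oapp (nu *~ c) 0 (insub p) = oapp nu 0 (insub p) * c :> int.
  by case: insubP => [k _ _|_] /=; rewrite ?E ?mul0r.
by case: i => [[|p]|p] /=; rewrite ?D ?mul0r ?mulNr.
Qed.

Lemma crd_dlt i j : (`|j| <= N)%N -> crd (dlt i) j = (i == j)%:Z - (i == - j)%:Z.
Proof.
case: j => [[|p]|p] jN; first by rewrite oppr0 subrr.
  by rewrite -/(crd _ p.+1%:Z) -[p]/(val (Ordinal jN)) crd_ord ffunE.
rewrite NegzE crdN -[p in LHS]/(val (Ordinal (jN : (p < N)%N))).
by rewrite crd_ord ffunE opprK opprB.
Qed.

Lemma dltN i : dlt (- i) = - dlt i.
Proof.
by apply/ffunP => k; rewrite !ffunE eqr_opp opprB eqr_oppLR.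
Qed.

Lemma dlt0 : dlt 0 = 0.
Proof. by apply/ffunP => k; rewrite !ffunE; lia. Qed.

Lemma degD : {morph deg : nu mu / nu + mu}.
Proof.
by move=> nu mu; rewrite -big_split; apply: eq_bigr => k _; rewrite ffunE mulrDr.
Qed.

Lemma deg0 : deg 0 = 0.
Proof. by rewrite /deg big1 // => k _; rewrite ffunE mulr0. Qed.

Lemma degN nu : deg (- nu) = - deg nu.
Proof. by apply: (addrI (deg nu)); rewrite -degD !subrr deg0. Qed.

Lemma ipC nu mu : ip nu mu = ip mu nu.
Proof. by apply: eq_bigr => k _; rewrite mulrC. Qed.

Lemma ipDl nu nu' mu : ip (nu + nu') mu = ip nu mu + ip nu' mu.
Proof. by rewrite -big_split; apply: eq_bigr => k _; rewrite ffunE mulrDl. Qed.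

Lemma ipDr nu mu mu' : ip nu (mu + mu') = ip nu mu + ip nu mu'.
Proof. by rewrite !(ipC nu) ipDl. Qed.

Lemma ip0l mu : ip 0 mu = 0.
Proof. by rewrite /ip big1 // => k _; rewrite ffunE mul0r. Qed.

Lemma ipNl nu mu : ip (- nu) mu = - ip nu mu.
Proof. by apply: (addrI (ip nu mu)); rewrite -ipDl !subrr ip0l. Qed.

Lemma ipNr nu mu : ip nu (- mu) = - ip nu mu.
Proof. by rewrite !(ipC nu) ipNl. Qed.

Lemma ipMzl nu mu (c : int) : ip (nu *~ c) mu = ip nu mu * c.
Proof.
rewrite /ip mulr_suml; apply: eq_bigr => k _.
by rewrite -!crd_ord crdZ mulrAC.
Qed.

Lemma ipMzr nu mu (c : int) : ip mu (nu *~ c) = ip mu nu * c.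
Proof. by rewrite !(ipC mu) ipMzl. Qed.

Lemma sum_dlt (f : 'I_N -> int) (g : int -> int) i : (`|i| <= N)%N ->
  (forall k, f k = g k.+1%:Z) -> (forall j, g (- j) = - g j) ->
  \sum_k f k * dlt i k = g i.
Proof.
move=> iN fg gN; under eq_bigr do rewrite fg ffunE.
have g0 : g 0 = 0.
  by have /eqP := gN 0; rewrite oppr0 -subr_eq0 opprK -mulr2n mulrn_eq0 => /eqP.
have pos p : (p < N)%N ->
    \sum_(k < N) g k.+1%:Z * ((p.+1%:Z == k.+1%:Z)%:Z - (p.+1%:Z == - k.+1%:Z)%:Z) = g p.+1%:Z.
  move=> pN; rewrite (bigD1 (Ordinal pN)) //= eqxx big1 ?addr0.
    by rewrite mulr1.
  move=> k; rewrite -val_eqE /= => kp.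
  by rewrite (_ : _ - _ = 0 :> int) ?mulr0 //; move: kp => /eqP; lia.
case: i iN => [[|p]|p] iN; last 1 first.
- rewrite NegzE gN -(pos p) // -sumrN; apply: eq_bigr => k _.
  rewrite -mulrN opprB; congr (_ * (_ - _)); lia.
- rewrite g0 big1 // => k _; rewrite (_ : _ - _ = 0 :> int) ?mulr0 //; lia.
- exact: pos.
Qed.

Lemma deg_dlt i : (`|i| <= N)%N -> deg (dlt i) = i.
Proof. by move=> iN; apply: (sum_dlt (g := id)). Qed.

Lemma ip_dlt nu i : (`|i| <= N)%N -> ip nu (dlt i) = crd nu i.
Proof.
move=> iN; apply: (sum_dlt (g := crd nu)) => // [k|j]; first by rewrite crd_ord.
exact: crdN.
Qed.

Lemma deg_alpha p : (p < N)%N -> deg (alpha p) = 1.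
Proof. by move=> pN; rewrite degD degN !deg_dlt //; lia. Qed.

Lemma ip_alpha nu p : (p < N)%N -> ip nu (alpha p) = crd nu p.+1%:Z - crd nu p%:Z.
Proof. by move=> pN; rewrite ipDr ipNr !ip_dlt //; lia. Qed.

(* The pairing with the simple coroot, and the simple reflection. *)
Definition pair_coroot p nu : int :=
  (crd nu p.+1%:Z - crd nu p%:Z) * (if p == 0%N then 2 else 1).

Definition srefl p nu : X := nu - alpha p *~ pair_coroot p nu.

(* The action of [srefl p] on the indices of [dlt]. *)
Definition sidx p i : int :=
  if p == 0%N then (if `|i|%N == 1%N then - i else i)
  else if i == p.+1%:Z then p%:Z else if i == p%:Z then p.+1%:Z
  else if i == - p.+1%:Z then - p%:Z else if i == - p%:Z then - p.+1%:Z else i.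

Lemma sreflD p : {morph srefl p : nu mu / nu + mu}.
Proof.
move=> nu mu; have -> : srefl p (nu + mu) =
    nu + mu - alpha p *~ (pair_coroot p nu + pair_coroot p mu).
  by rewrite /srefl; congr (_ - _ *~ _); rewrite /pair_coroot !crdD; ring.
by rewrite /srefl mulrzDr opprD addrACA.
Qed.

Lemma srefl0 p : srefl p 0 = 0.
Proof. by have /eqP := sreflD p 0 0; rewrite addr0 -subr_eq0 opprD addNKr oppr_eq0 => /eqP. Qed.

Lemma sreflN p nu : srefl p (- nu) = - srefl p nu.
Proof. by apply: (addrI (srefl p nu)); rewrite -sreflD !subrr srefl0. Qed.

Lemma srefl_dlt p i : (p < N)%N -> srefl p (dlt i) = dlt (sidx p i).
Proof.
move=> pN; rewrite /srefl /pair_coroot !crd_dlt ?(ltnW pN) // /sidx /alpha.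
case: p pN => [|p] pN /=.
  rewrite dlt0 subr0; case: (eqVneq `|i|%N 1%N) => [i1|]; last first.
    by move=> i1; rewrite (_ : (_ - _) * 2 = 0 :> int) ?subr0 //; lia.
  have [->|->] : i = 1 \/ i = -1 by lia.
    rewrite dltN; rewrite (_ : (_ - _) * 2 = 2 :> int) //=.
    by rewrite -[_ *~ 2]/(dlt 1 + dlt 1) opprD addrA subrr add0r.
  rewrite [dlt (- 1)]dltN (_ : (_ - _) * 2 = - 2 :> int) //=.
  by rewrite -[dlt 1 *~ _]/(- (dlt 1 + dlt 1)) !opprK addKr.
rewrite mulr1.
case: (eqVneq i p.+2%:Z) => [->|i1].
  rewrite (_ : _ - _ = 1 :> int); last by lia.
  by rewrite mulr1z opprB addrC subrK.
case: (eqVneq i p.+1%:Z) => [->|i2].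
  rewrite (_ : _ - _ = - 1 :> int); last by lia.
  by rewrite mulrN1z opprK addrC subrK.
case: (eqVneq i (- p.+2%:Z)) => [->|i3].
  rewrite (_ : _ - _ = - 1 :> int); last by lia.
  by rewrite mulrN1z opprK !dltN addrA addNr add0r.
case: (eqVneq i (- p.+1%:Z)) => [->|i4].
  rewrite (_ : _ - _ = 1 :> int); last by lia.
  by rewrite mulr1z opprB !dltN addrA addNr add0r.
by rewrite (_ : _ - _ = 0 :> int) ?subr0 //; lia.
Qed.

Lemma ip_alpha_alpha p : (p < N)%N -> ip (alpha p) (alpha p) = if p == 0%N then 1 else 2.
Proof.
move=> pN; rewrite ip_alpha // /alpha !crdD -!dltN !crd_dlt ?(ltnW pN) //.
by case: p pN => [|p] pN /=; lia.
Qed.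

Lemma ip_srefl p nu : (p < N)%N -> ip (srefl p nu) (srefl p nu) = ip nu nu.
Proof.
move=> pN; have := ip_alpha_alpha pN; have := ip_alpha nu pN.
rewrite /srefl /pair_coroot; move: (alpha p) => a <- aa.
rewrite !(ipDl, ipDr, ipNl, ipNr, ipMzl, ipMzr) aa (ipC a).
by case: ifP => _; ring.
Qed.

Lemma srefl_alpha p : (p < N)%N -> srefl p (alpha p) = - alpha p.
Proof.
move=> pN; rewrite sreflD sreflN !srefl_dlt // /alpha opprB.
rewrite /sidx; case: eqP => [->|p0] /=; first by rewrite dltN !dlt0 add0r !subr0.
rewrite eqxx (_ : p%:Z == p.+1%:Z = false) ?eqxx //; lia.
Qed.

Lemma srefl_inj p : (p < N)%N -> injective (srefl p).
Proof.
move=> pN nu mu nm; apply/eqP; rewrite -subr_eq0; apply/eqP.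
set x := nu - mu; have : srefl p x = 0 by rewrite sreflD sreflN nm subrr.
move=> /(congr1 (fun y => ip y y)); rewrite ip_srefl // ip0l => xx.
have sq k : x k * x k = 0.
  by apply: (psumr_eq0P _ xx) => // l _; rewrite -expr2 sqr_ge0.
by apply/ffunP => k; have /eqP := sq k; rewrite mulf_eq0 orbb [in RHS]ffunE => /eqP.
Qed.

Fixpoint sseq n : seq int :=
  if n is m.+1 then [:: m.+1%:Z, - m.+1%:Z & sseq m] else [:: 0].

Lemma mem_sseq n i : (i \in sseq n) = (`|i| <= n)%N.
Proof. by elim: n => [|n IH] /=; rewrite !inE ?IH; lia. Qed.

Lemma uniq_sseq n : uniq (sseq n).
Proof. by elim: n => //= n ->; rewrite !inE !mem_sseq; lia. Qed.

(* The pair [(i, j)], with |i| < j <= N, stands for the positive root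
   [dlt j - dlt i]. *)
Definition pos_pairs : seq (int * int) :=
  [seq (i, m.+1%:Z) | m <- iota 0 N, i <- sseq m].

Definition pair_root (ij : int * int) : X := dlt ij.2 - dlt ij.1.

Definition pos_roots := map pair_root pos_pairs.

Lemma mem_pos_pairs i j : ((i, j) \in pos_pairs) = (`|i|%:Z < j <= N%:Z).
Proof.
apply/allpairsPdep/idP => [[j' [i' []]]|/andP[ij jN]].
  by rewrite mem_iota mem_sseq => h1 h2 [-> ->]; lia.
exists `|j|.-1, i; rewrite mem_iota mem_sseq; split; try lia.
by congr pair; lia.
Qed.

Lemma uniq_pos_pairs : uniq pos_pairs.
Proof.
apply: allpairs_uniq_dep; first exact: iota_uniq.
  by move=> m _; apply: uniq_sseq.
by move=> [m i] [m' i'] _ _ [/= -> ->].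
Qed.

Lemma pair_root_inj : {in pos_pairs &, injective pair_root}.
Proof.
move=> [i j] [i' j']; rewrite !mem_pos_pairs /pair_root => /= h h' E.
have C k : (`|k| <= N)%N -> (j == k)%:Z - (j == - k)%:Z + ((- i == k)%:Z - (- i == - k)%:Z) =
    (j' == k)%:Z - (j' == - k)%:Z + ((- i' == k)%:Z - (- i' == - k)%:Z) :> int.
  move=> kN; have := congr1 (fun x => crd x k) E.
  by rewrite !crdD -!dltN !crd_dlt.
(* At the larger of the indices [j] and [j'], only one of the two roots has a nonzero coordinate. *)
have jj : j = j'.
  have F (a b : int) : `|a|%:Z < b -> [/\ (b == - b) = false, (- a == b) = false & (- a == - b) = false].
    by move=> ab; split; lia.
  have /andP[h1 h2] := h; have /andP[h1' h2'] := h'.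
  have := C j; have := C j'; have [-> -> ->] := F _ _ h1; have [-> -> ->] := F _ _ h1'.
  rewrite !eqxx; case: (ltgtP j j') => // jj'.
    have -> : (j == - j') = false by lia.
    have -> : (- i == j') = false by lia.
    have -> : (- i == - j') = false by lia.
    have jN : (`|j'| <= N)%N by lia.
    by move=> /(_ jN).
  have -> : (j' == - j) = false by lia.
  have -> : (- i' == j) = false by lia.
  have -> : (- i' == - j) = false by lia.
  have jN : (`|j| <= N)%N by lia.
  by move=> _ /(_ jN).
rewrite jj in h E C *; congr pair; have /andP[h1 h2] := h; have /andP[h1' h2'] := h'.
move: (C i); rewrite (_ : (`|i| <= N)%N); last by lia.
rewrite (_ : (- i == - i)) // => /(_ isT) /addrI.
case: (eqVneq i 0) => [i0 _|i0].
  move: (C i'); rewrite i0 (_ : (`|i'| <= N)%N); last by lia.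
  by move=> /(_ isT) /addrI; lia.
have -> : (- i == i) = false by lia.
by lia.
Qed.

Lemma uniq_pos_roots : uniq pos_roots.
Proof. by rewrite map_inj_in_uniq ?uniq_pos_pairs //; apply: pair_root_inj. Qed.

(** By oddness [dlt j - dlt i] is also [dlt (- i) - dlt (- j)], and one of the two pairs lies in
    [pos_pairs]. The case [j = - i] would give [2 dlt j], which is not a root. *)
Lemma mem_pos_roots i j : (`|i| <= N)%N -> (`|j| <= N)%N -> i < j -> j != - i ->
  dlt j - dlt i \in pos_roots.
Proof.
move=> iN jN ij jNi; apply/mapP.
case: (ltrP `|i| j) => ij'.
  by exists (i, j) => //; rewrite mem_pos_pairs; lia.
exists (- j, - i); first by rewrite mem_pos_pairs; lia.
by rewrite /pair_root /= !dltN opprK addrC.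
Qed.

Lemma pos_roots_pair a : a \in pos_roots ->
  exists i j, [/\ `|i|%:Z < j, j <= N%:Z & a = dlt j - dlt i].
Proof.
case/mapP => -[i j]; rewrite mem_pos_pairs => /andP[h1 h2] ->.
by exists i, j.
Qed.

Lemma alpha_pos_roots p : (p < N)%N -> alpha p \in pos_roots.
Proof. by move=> pN; apply: mem_pos_roots; lia. Qed.

Lemma deg_pos_roots a : a \in pos_roots -> 0 < deg a.
Proof.
by case/pos_roots_pair => i [j [ij jN ->]]; rewrite degD degN !deg_dlt; lia.
Qed.

(** A simple reflection permutes the positive roots other than its own: as it is injective, it is
    enough that it maps them into themselves, which is checked on indices. *)
Lemma perm_srefl_roots p : (p < N)%N ->
  perm_eq (map (srefl p) pos_roots) (- alpha p :: rem (alpha p) pos_roots).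
Proof.
move=> pN; have aR := alpha_pos_roots pN.
rewrite (perm_trans (perm_map _ (perm_to_rem aR))) //= srefl_alpha // perm_cons.
have U : uniq (rem (alpha p) pos_roots) by rewrite rem_uniq ?uniq_pos_roots.
have Um : uniq (map (srefl p) (rem (alpha p) pos_roots)).
  by rewrite map_inj_uniq //; apply: srefl_inj.
have sub : {subset map (srefl p) (rem (alpha p) pos_roots) <= rem (alpha p) pos_roots}.
  move=> _ /mapP [a + ->]; rewrite !mem_rem_uniq ?uniq_pos_roots // !inE.
  case/andP=> an /pos_roots_pair [i [j [ij jN aE]]].
  apply/andP; split.
    apply/eqP => E; have := aR.
    have : a = - alpha p.
      by apply: (srefl_inj pN); rewrite E sreflN srefl_alpha // opprK.
    move=> aE' _; have : 0 < deg a by rewrite aE degD degN !deg_dlt; lia.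
    by rewrite aE' degN deg_alpha.
  (* The excluded pair is the one of [alpha p]; [sidx p] keeps the order of the indices in all the
     others. *)
  have ijp : ~ (i = p%:Z /\ j = p.+1%:Z).
    by case=> ip jp; move: an; rewrite aE ip jp eqxx.
  rewrite aE sreflD sreflN !srefl_dlt //; apply: mem_pos_roots;
    rewrite /sidx; case: ifP => p0; repeat (case: ifP => ?); lia.
have [|_ mm] := uniq_min_size Um sub; first by rewrite size_map.
exact: uniq_perm.
Qed.

(* The weights [- sum c_p alpha_p] with natural coefficients. *)
Definition cone nu : Prop := exists c : 'I_N -> nat, nu = - \sum_(p < N) alpha p *+ c p.

Lemma cone0 : cone 0.
Proof. by exists (fun=> 0%N); rewrite big1 ?oppr0. Qed.

Lemma coneD nu mu : cone nu -> cone mu -> cone (nu + mu).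
Proof.
move=> [c ->] [c' ->]; exists (fun k => c k + c' k)%N.
by rewrite -opprD -big_split; congr (- _); apply: eq_bigr => p _; rewrite mulrnDr.
Qed.

Lemma cone_alpha p : (p < N)%N -> cone (- alpha p).
Proof.
move=> pN; exists (fun k => (k == Ordinal pN)%N : nat).
by rewrite (bigD1 (Ordinal pN)) //= eqxx big1 ?addr0 // => k /negPf->.
Qed.

(** Go from [i] down to [j] by unit steps: [dlt t - dlt (t + 1)] is [- alpha t] for [t >= 0] and, by
    oddness, [- alpha (- t - 1)] for [t < 0]. *)
Lemma cone_dlt i j : (`|i| <= N)%N -> (`|j| <= N)%N -> j <= i -> cone (dlt j - dlt i).
Proof.
move=> iN jN ij; have [n iE] : exists n : nat, i = j + n%:Z by exists `|i - j|%N; lia.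
elim: n i iE iN ij => [|n IH] i iE iN ij.
  by rewrite iE addr0 subrr; apply: cone0.
rewrite -(subrKA (dlt (j + n%:Z))); apply: coneD; first by apply: IH => //; lia.
have -> : i = j + n%:Z + 1 by lia.
set t := j + n%:Z; case: (lerP 0 t) => t0.
  have -> : dlt t - dlt (t + 1) = - alpha `|t|%N.
    rewrite opprB; congr (dlt _ - dlt _); lia.
  by apply: cone_alpha; lia.
have -> : dlt t - dlt (t + 1) = - alpha `|(t + 1)%R|%N.
  rewrite opprB -!dltN addrC; congr (dlt _ + dlt _); lia.
by apply: cone_alpha; lia.
Qed.

Lemma deg_sum (I : Type) (r : seq I) (f : I -> X) :
  deg (\sum_(k <- r) f k) = \sum_(k <- r) deg (f k).
Proof. by apply: (big_morph deg); [exact: degD|exact: deg0]. Qed.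

Lemma degMn nu n : deg (nu *+ n) = deg nu *+ n.
Proof. by elim: n => [|n IH]; rewrite ?mulr0n ?deg0 // !mulrS degD IH. Qed.

Lemma deg_cone (c : 'I_N -> nat) : deg (- \sum_(p < N) alpha p *+ c p) = - (\sum_(p < N) c p)%N%:Z.
Proof.
rewrite degN deg_sum (big_morph Posz PoszD (erefl _)); congr (- _).
by apply: eq_bigr => p _; rewrite degMn deg_alpha // natz.
Qed.

Lemma cone_deg nu : cone nu -> deg nu <= 0.
Proof. by move=> [c ->]; rewrite deg_cone; lia. Qed.

Lemma cone_level_finite (R : comUnitRingType) (f : X -> R) :
  (forall nu, f nu != 0 -> cone nu) -> level_finite deg f.
Proof.
move=> fc j; apply: (@sub_finite_set _ _ ((fun c : {ffun 'I_N -> 'I_(`|j|.+1)} =>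
  - \sum_(p < N) alpha p *+ c p) @` [set: {ffun 'I_N -> 'I_(`|j|.+1)}]%classic)%classic).
  move=> nu /= [nuj /fc [c cE]]; move: nuj; rewrite cE deg_cone => cj.
  have cb k : (c k < `|j|.+1)%N.
    by rewrite ltnS; move: cj; rewrite (bigD1 k) //=; lia.
  exists [ffun k => Ordinal (cb k)] => //; congr (- _).
  by apply: eq_bigr => p _; rewrite ffunE.
exact/finite_image/finite_finset.
Qed.

End Lattice.

(** * Functions alternating under the dotted action of the Weyl group *)

Section Alternating.
Variables (N : nat) (A : {ffun 'I_N -> int}) (n : nat -> int).
Local Notation X := {ffun 'I_N -> int}.
Hypothesis An : forall p, (p < N)%N -> pair_coroot p A = 2 * n p.
Variable R : numFieldType.
Implicit Types (nu : X) (f g : X -> R) (p : nat).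

Definition sdom (y : X) : Prop := forall p, (p < N)%N -> 0 < pair_coroot p y.

(* The reflection of [nu] transported by [nu |-> A + 2 nu]. *)
Definition dot p nu : X := srefl p nu - alpha N p *~ n p.

(** With [A] standing for 2 (Lambda + rho), this is |Lambda + rho + nu|^2 - |Lambda + rho|^2, and
    [n p] is the pairing of Lambda + rho with the simple coroot. *)
Definition quad nu : int := ip nu (A + nu).

Definition alternating g : Prop := forall p nu, (p < N)%N -> g (dot p nu) = - g nu.

Lemma pair_corootD p : {morph @pair_coroot N p : x y / x + y}.
Proof. by move=> x y; rewrite /pair_coroot !crdD; ring. Qed.

Lemma dotE p nu : (p < N)%N -> A + (dot p nu + dot p nu) = srefl p (A + (nu + nu)).
Proof.
move=> pN; rewrite !sreflD /dot [srefl p A]/srefl An //.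
have -> : 2 * n p = n p + n p by ring.
by rewrite mulrzDr opprD [X in A + X = _]addrACA -[RHS]addrA; congr (_ + _); apply: addrC.
Qed.

Lemma quadE nu : 4 * quad nu = ip (A + (nu + nu)) (A + (nu + nu)) - ip A A.
Proof. by rewrite /quad !(ipDl, ipDr) (ipC nu A); ring. Qed.

Lemma quad_dot p nu : (p < N)%N -> quad (dot p nu) = quad nu.
Proof.
move=> pN; apply: (@mulfI _ (4 : int)) => //.
by rewrite !quadE dotE // ip_srefl.
Qed.

Lemma deg_le_ip (y : X) : deg y <= N%:Z * ip y y.
Proof.
rewrite /ip mulr_sumr; apply: ler_sum => k _.
have : y k <= y k * y k by nia.
have := ltn_ord k; nia.
Qed.

(** If [A + 2 nu] is not strictly dominant, some simple coroot pairs with it to 0, and then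
    [g nu = - g nu], or to a negative number, and then reflecting brings it closer to the dominant
    chamber. *)
Lemma alternating_eq0 g : alternating g ->
  (forall nu, sdom (A + (nu + nu)) -> g nu = 0) -> forall nu, g nu = 0.
Proof.
move=> galt gdom nu.
pose y (mu : X) : X := A + (mu + mu).
(* The termination measure: a reflection preserves the norm and here strictly increases the degree,
   while [deg_le_ip] bounds the degree by N times the square of the norm. *)
pose h (mu : X) := `|(N%:Z * ip (y mu) (y mu) - deg (y mu))%R|%N.
have [m] := ubnP (h nu); elim: m nu => // m IH nu hm.
case: (pselect (sdom (y nu))) => [|/existsNP [p /not_implyP [pN /negP]]].
  exact: gdom.
rewrite -leNgt => yp.
have E : dot p nu = nu - alpha N p *~ (pair_coroot p nu + n p).
  by rewrite /dot /srefl mulrzDr opprD addrA.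
have yE : pair_coroot p (y nu) = 2 * (pair_coroot p nu + n p).
  by rewrite !pair_corootD An //; ring.
move: yp; rewrite yE le_eqVlt => /orP[|yp].
  rewrite mulf_eq0 /= => /eqP c0; have := galt p nu pN.
  rewrite E c0 mulr0z subr0 => /eqP; rewrite -subr_eq0 opprK -mulr2n mulrn_eq0.
  by move=> /eqP.
rewrite -[g nu]opprK -(galt p nu pN) IH ?oppr0 //.
move: hm; rewrite !ltnS; apply: leq_trans.
have ipE : ip (y (dot p nu)) (y (dot p nu)) = ip (y nu) (y nu).
  by rewrite /y dotE // ip_srefl.
rewrite /h ipE; have := deg_le_ip (y (dot p nu)); have := deg_le_ip (y nu); rewrite ipE.
have -> : deg (y (dot p nu)) = deg (y nu) - 2 * (pair_coroot p nu + n p).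
  rewrite E {1 2}/y !degD !degN.
  have -> : deg (alpha N p *~ (pair_coroot p nu + n p)) = pair_coroot p nu + n p.
    set c := _ + _; have : deg (alpha N p *~ c) = deg (alpha N p) * c.
      by rewrite /deg mulr_suml; apply: eq_bigr => k _; rewrite -!crd_ord crdZ mulrA.
    by rewrite deg_alpha // mul1r.
  by ring.
by lia.
Qed.

(** Invariance is stated for [n p - 1], the pairing of Lambda with the coroot; the operator
    contributes the sign and the shift from Lambda to Lambda + rho. *)
Lemma diffop_alternating f : (forall p nu, (p < N)%N ->
    f (srefl p nu - alpha N p *~ (n p - 1)) = f nu) ->
  alternating (diffop (pos_roots N) f).
Proof.
move=> fr p nu pN; rewrite /dot -[n p](subrK 1).
apply: diffop_reflection => //.
- exact: sreflD.
- exact: srefl_alpha.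
- exact: alpha_pos_roots.
- exact: perm_srefl_roots.
- by move=> mu; apply: fr.
Qed.

Lemma diffop_cone s f : (forall a, a \in s -> cone (- a)) ->
  (forall nu, f nu != 0 -> cone nu) -> forall nu, diffop s f nu != 0 -> cone nu.
Proof.
elim: s => //= a s IH sa fc nu.
have IH' := IH (fun b bs => sa b (mem_behead (s := a :: s) bs)) fc.
case: (eqVneq (diffop s f nu) 0) => [->|/IH' //].
rewrite sub0r oppr_eq0 => /IH' c; rewrite -(addrK a nu); apply: coneD => //.
by apply: sa; rewrite mem_head.
Qed.

Lemma cone_pos_roots a : a \in pos_roots N -> cone (- a).
Proof.
by case/pos_roots_pair => i [j [ij jN ->]]; rewrite opprB; apply: cone_dlt; lia.
Qed.

Lemma ip_cone (b : X) nu : sdom b -> cone nu -> ip nu b = 0 -> nu = 0.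
Proof.
move=> bd [c ->]; rewrite ipNl.
have -> : ip (\sum_(p < N) alpha N p *+ c p) b =
    \sum_(p < N) ip (alpha N p) b * (c p)%:Z.
  elim/big_rec2: _ => [|p u w _ <-]; first by rewrite ip0l.
  by rewrite ipDl pmulrn ipMzl.
have b0 (p : 'I_N) : 0 < ip (alpha N p) b.
  rewrite ipC ip_alpha //; have := bd p (ltn_ord p); rewrite /pair_coroot.
  by case: ifP; lia.
move=> /eqP; rewrite oppr_eq0 => /eqP /psumr_eq0P c0.
rewrite big1 ?oppr0 // => p _; have /eqP : ip (alpha N p) b * (c p)%:Z = 0.
  by apply: c0 => // q _; rewrite mulr_ge0 // ltW.
by rewrite mulf_eq0 gt_eqF //= => /eqP [->].
Qed.

(** [A + nu] is the midpoint of two strictly dominant weights, hence strictly dominant, and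
    [quad nu] is its pairing with [nu]; no nonzero element of the cone is orthogonal to it. *)
Lemma sdom_quad_eq0 nu : sdom A -> sdom (A + (nu + nu)) -> cone nu ->
  quad nu = 0 -> nu = 0.
Proof.
move=> Ad Bd nc q0; apply: (@ip_cone (A + nu)) => // p pN.
have := Ad p pN; have := Bd p pN; rewrite !pair_corootD.
by move: (pair_coroot p A) (pair_coroot p nu) => x z; lia.
Qed.

(** Every nontrivial shift by positive roots moves 0 to positive degree, outside the support of
    [f]. *)
Lemma diffop0 s f : (forall nu, f nu != 0 -> cone nu) ->
  {subset s <= pos_roots N} -> diffop s f 0 = f 0.
Proof.
move=> fc; elim: s => //= a s IH sub.
have sub' : {subset s <= pos_roots N} by move=> b bs; apply: sub; rewrite inE bs orbT.
rewrite IH // add0r [X in _ - X](_ : _ = 0) ?subr0 //.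
apply/eqP; apply: contraT => /diffop_cone - /(_ _ fc) ac.
have := deg_pos_roots (sub a (mem_head _ _)); rewrite ltNge => /negP; case.
by apply/cone_deg/ac => b bs; apply/cone_pos_roots/sub'.
Qed.

End Alternating.

(* The second order part of the Weyl denominator: the coefficient of e^{rho - c}
   vanishes unless |rho - c|^2 = |rho|^2, with 2 rho = (1, 3, 5, ...). *)
Lemma weyl_denominator_norm (N : nat) (R : numFieldType) (c : {ffun 'I_N -> int}) :
  (\sum_k c k * (c k - (2 * k + 1)%:Z))%:~R *
    diffop (pos_roots N) (fun nu => (nu == 0)%:R : R) (- c) = 0.
Proof.
pose A : {ffun 'I_N -> int} := [ffun k : 'I_N => (2 * k + 1)%:Z].
have crdA p : (p < N)%N -> crd A p.+1%:Z = (2 * p + 1)%:Z.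
  by move=> pN; rewrite -[p]/(val (Ordinal pN)) crd_ord ffunE.
have An p : (p < N)%N -> pair_coroot p A = 2 * 1.
  move=> pN; rewrite /pair_coroot crdA //.
  by case: p pN => [|p] pN; [by [] | rewrite crdA ?(ltnW pN) // !mulr1; lia].
(* The coefficients of the Weyl denominator, alternating for the case Lambda = 0, where [A] is 2 rho
   and every [n p] is 1. *)
pose d := diffop (pos_roots N) (fun nu => (nu == 0)%:R : R).
have dcone nu : d nu != 0 -> cone nu.
  apply: diffop_cone; first exact: cone_pos_roots.
  by move=> mu; case: (eqVneq mu 0) => [-> _|_]; [apply: cone0 | rewrite eqxx].
have dalt : alternating (fun=> 1) d.
  apply: diffop_alternating => p nu pN; rewrite subrr mulr0z subr0.
  by rewrite -[X in srefl p nu == X](@srefl0 N p) (inj_eq (srefl_inj pN)).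
have := @alternating_eq0 _ A (fun=> 1) An R (fun nu => (quad A nu)%:~R * d nu).
move=> /(_ _ _ (- c)) <-.
- rewrite /quad /ip; congr (_%:~R * _); apply: eq_bigr => k _.
  by rewrite !ffunE; ring.
- by move=> p nu pN; rewrite quad_dot // dalt // mulrN.
- move=> nu nd; apply/eqP; rewrite mulf_eq0 orbC.
  apply/orP; case: eqVneq => [|dn]; [by left|right].
  have deg0 := cone_deg (dcone _ dn).
  (* The coordinates 2k + 1 of [A] start at 1 and increase by 2; by integrality, strict dominance of
     [A + 2 nu] makes the coordinates of [nu] nonnegative and nondecreasing. As [nu] has degree at
     most 0, it must vanish. *)
  have crd_pos p : (p < N)%N -> 0 < crd (A + (nu + nu)) p.+1%:Z /\
       (forall k : 'I_N, (k = p :> nat) -> 0 <= nu k).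
    elim: p => [|p IH] pN.
      have := nd 0%N pN; rewrite /pair_coroot eqxx crd0 subr0 => h; split; first by lia.
      move=> k k0; have -> : k = Ordinal pN by apply: val_inj.
      by move: h; rewrite crd_Ordinal !ffunE /=; lia.
    have [IH1 IH2] := IH (ltnW pN); have := nd p.+1 pN; rewrite /pair_coroot (_ : (p.+1 == 0)%N = false) // mulr1 => h.
    split; first by lia.
    move=> k kp; have -> : k = Ordinal pN by apply: val_inj.
    move: h; rewrite !crd_Ordinal ?(ltnW pN) // => pN'.
    by have := IH2 (Ordinal pN') erefl; rewrite !ffunE /=; lia.
  have nu0 : nu = 0.
    have nn (k : 'I_N) : 0 <= nu k by have [_ ->] := crd_pos k (ltn_ord k).
    have S0 : deg nu = 0.
      apply/le_anti; rewrite deg0 sumr_ge0 // => k _.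
      by rewrite mulr_ge0.
    apply/ffunP => k; rewrite ffunE.
    have /eqP : k.+1%:Z * nu k = 0.
      by move: (k) (erefl true); apply/psumr_eq0P => // l _; rewrite mulr_ge0.
    by rewrite mulf_eq0 /= => /eqP.
  by rewrite nu0 /quad ip0l.
Qed.

Lemma level_sum_seq (X : zmodType) (deg : X -> int) (R : comUnitRingType)
    (f : X -> R) (u : seq X) j : uniq u -> (forall nu, nu \notin u -> f nu = 0) ->
  level_sum deg f j = \sum_(nu <- u) (deg nu == j)%:R * f nu.
Proof.
move=> uu fu; rewrite /level_sum fsbig_mkcond (@fsbigE _ _ _ _ _ u) //.
  rewrite (eq_bigl xpredT) => [|nu]; last by rewrite in_setT.
  apply: eq_bigr => nu _; rewrite /patch.
  have -> : (nu \in [set nu | deg nu = j]%classic) = (deg nu == j).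
    by apply/idP/eqP; rewrite inE.
  by case: eqP; rewrite ?mul1r ?mul0r.
by move=> nu _ nuu; rewrite /patch fu // if_same.
Qed.

Lemma level_sum_delta (X : zmodType) (deg : X -> int) (R : comUnitRingType)
    (I : Type) (r : seq I) (c : I -> R) (x : I -> X) j :
  level_sum deg (fun nu => \sum_(k <- r) c k * (nu == x k)%:R) j =
  \sum_(k <- r) c k * (deg (x k) == j)%:R.
Proof.
pose u := undup (map x r).
rewrite (@level_sum_seq _ deg _ _ u _ (undup_uniq _)) => [|nu]; last first.
  rewrite mem_undup; elim: r {u} => [|k r IH]; first by rewrite big_nil.
  rewrite big_cons /= inE negb_or => /andP[/negPf-> /IH ->].
  by rewrite mulr0 addr0.
under eq_bigr do rewrite mulr_sumr.
rewrite exchange_big /= -/u.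
have ru k : List.In k r -> x k \in u.
  rewrite mem_undup; elim: r {u} => //= k' r IH [->|/IH]; rewrite inE ?eqxx //.
  by move=> ->; rewrite orbT.
elim: (r) ru => [|k r' IH] ru; first by rewrite !big_nil.
rewrite !big_cons IH; last by move=> k' k'r; apply: ru; right.
congr (_ + _).
rewrite (bigD1_seq (x k)) ?undup_uniq //=; last by apply: ru; left.
rewrite eqxx mulr1 mulrC big1 ?addr0 // => nu /negPf->.
by rewrite !mulr0.
Qed.

(** * A determinant of Vandermonde type *)

Section ChebyshevDet.
Variables (R : comNzRingType) (N : nat) (u w : 'I_N -> R) (P : R).
Hypothesis uwP : forall j, u j * w j = P.

(* (x^(n+1) - y^(n+1)) / (x - y) as a polynomial in x + y, where x y = P. *)
Fixpoint cheb_pair n : {poly R} * {poly R} :=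
  if n is m.+1 then let: (c, d) := cheb_pair m in (d, 'X * d - P *: c) else (1, 'X).

Let cheb n := (cheb_pair n).1.

Let chebS n : (cheb_pair n).2 = cheb n.+1.
Proof. by rewrite /cheb /=; case: (cheb_pair n). Qed.

Let chebSS n : cheb n.+2 = 'X * cheb n.+1 - P *: cheb n.
Proof. by rewrite -!chebS /cheb /=; case: (cheb_pair n). Qed.

Let cheb_size n : size (cheb n) = n.+1 /\ cheb n \is monic.
Proof.
suff [] : (size (cheb n) = n.+1 /\ cheb n \is monic) /\
          (size (cheb n.+1) = n.+2 /\ cheb n.+1 \is monic) by [].
elim: n => [|n [[s1 m1] [s2 m2]]].
  by rewrite /cheb /= size_poly1 monic1 size_polyX monicX.
split=> //; rewrite chebSS; have sX : size ('X * cheb n.+1) = n.+3.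
  by rewrite mulrC size_mulX ?s2 // -size_poly_gt0 s2.
have sl : (size (- (P *: cheb n))%R < size ('X * cheb n.+1)%R)%N.
  by rewrite size_polyN sX (leq_ltn_trans (size_scale_leq _ _)) // s1.
split; first by rewrite size_polyDl.
by rewrite monicE lead_coefDl // mulrC lead_coefMX; apply/eqP/monicP.
Qed.

(** As all the products [u j * w j] equal the same [P], the entry is [u j - w j] times a polynomial
    in [u j + w j], monic of degree [i] and independent of [j]. The matrix is therefore
    unitriangular times Vandermonde times diagonal. *)
Lemma det_power_differences :
  \det (\matrix_(i < N, j < N) (u j ^+ i.+1 - w j ^+ i.+1)) =
  \prod_j (u j - w j) *
  \prod_(i < N) \prod_(j < N | (i < j)%N) ((u j + w j) - (u i + w i)).
Proof.
have cheb_horner n j : u j ^+ n.+1 - w j ^+ n.+1 = (u j - w j) * (cheb n).[u j + w j].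
  suff [] : u j ^+ n.+1 - w j ^+ n.+1 = (u j - w j) * (cheb n).[u j + w j] /\
     u j ^+ n.+2 - w j ^+ n.+2 = (u j - w j) * (cheb n.+1).[u j + w j] by [].
  elim: n => [|n [IH1 IH2]].
    by rewrite /cheb /= hornerX hornerC; split; ring.
  split=> //; rewrite chebSS hornerD hornerN hornerZ hornerM hornerX.
  have -> (x y : R) : (u j - w j) * ((u j + w j) * x - P * y) =
    (u j + w j) * ((u j - w j) * x) - P * ((u j - w j) * y) by ring.
  by rewrite -IH1 -IH2 -(uwP j) !exprS; ring.
pose C := \matrix_(i < N, k < N) (cheb i)`_k.
pose s : 'rV[R]_N := \row_j (u j + w j).
pose D : 'rV[R]_N := \row_j (u j - w j).
have -> : \matrix_(i < N, j < N) (u j ^+ i.+1 - w j ^+ i.+1) =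
    C *m Vandermonde N s *m diag_mx D.
  apply/matrixP => i j; rewrite mul_mx_diag !mxE cheb_horner mulrC; congr (_ * _).
  have sN : (size (cheb i) <= N)%N by have [-> _] := cheb_size i; apply: ltn_ord.
  by rewrite (horner_coef_wide _ sN); apply: eq_bigr => k _; rewrite !mxE.
rewrite !det_mulmx det_diag det_Vandermonde.
have -> : \det C = 1.
  rewrite det_trig; last first.
    apply/is_trig_mxP => i j ij; rewrite mxE nth_default //.
    by have [-> _] := cheb_size i.
  apply: big1 => i _; rewrite mxE; have [si /monicP] := cheb_size i.
  by rewrite /lead_coef si.
rewrite mul1r mulrC; congr (_ * _); first by apply: eq_bigr => j _; rewrite mxE.
by apply: eq_bigr => i _; apply: eq_bigr => j _; rewrite !mxE.
Qed.
End ChebyshevDet.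

Arguments crd : simpl never.

(** * The Weyl numerator and its product form *)

Section WeylNumerator.
Variables (N : nat) (e : int) (a : {ffun 'I_N -> int}) (n : nat -> int).
Local Notation X := {ffun 'I_N -> int}.
Let A : X := [ffun k => e + 2 * a k].
Hypothesis An : forall p, (p < N)%N -> pair_coroot p A = 2 * n p.
Hypothesis Ad : sdom A.
Variable R : numFieldType.
Implicit Types (nu y : X) (p : nat).

Lemma crd_opp nu i : crd (- nu) i = - crd nu i.
Proof. by apply: (addrI (crd nu i)); rewrite -crdD !subrr -[0]/(0 *~ 0) crdZ mulr0. Qed.

Lemma crd_srefl p y (k : 'I_N) : (p < N)%N ->
  srefl p y k = crd y (sidx p k.+1%:Z).
Proof.
move=> pN; rewrite -crd_ord /srefl crdD crd_opp crdZ /alpha crdD crd_opp.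
have kN : (`|k.+1%:Z| <= N)%N by apply: ltn_ord.
rewrite !crd_dlt // /pair_coroot /sidx; case: (eqVneq p 0%N) => [->|p0] /=.
  case: (eqVneq (k : nat) 0%N) => [->|k0] /=.
    by rewrite crd0 (crdN y 1); ring.
  rewrite (_ : (k.+1 == 1)%N = false); last by lia.
  rewrite (_ : _ - _ - _ = 0 :> int); first by ring.
  by lia.
rewrite mulr1; case: (eqVneq (k.+1%:Z) p.+1%:Z) => [->|k1].
  rewrite (_ : _ - _ - _ = 1 :> int); first by ring.
  by lia.
case: (eqVneq (k.+1%:Z) p%:Z) => [->|k2].
  rewrite (_ : _ - _ - _ = - 1 :> int); first by ring.
  by lia.
rewrite (_ : _ - _ - _ = 0 :> int); last by lia.
rewrite mul0r subr0 !ifF //; lia.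
Qed.

Lemma sdom_mono y p q : sdom y -> (p < q <= N)%N -> crd y p%:Z < crd y q%:Z.
Proof.
move=> yd; elim: q => // q IH /andP[pq qN].
have : crd y q%:Z < crd y q.+1%:Z.
  by have := yd q qN; rewrite /pair_coroot; case: ifP; lia.
move: pq; rewrite ltnS leq_eqVlt => /orP[/eqP-> //|pq] h.
by apply: lt_trans h; apply: IH; rewrite pq ltnW.
Qed.

Lemma sdom_gt0 y (k : 'I_N) : sdom y -> 0 < y k.
Proof.
by move=> yd; rewrite -crd_ord -[0 in X in X < _](crd0 y); apply: sdom_mono => /=.
Qed.

Lemma sdom_ord_mono y (k l : 'I_N) : sdom y -> (k < l)%N -> y k < y l.
Proof. by move=> yd kl; rewrite -!crd_ord; apply: sdom_mono => //; rewrite ltnS kl /=. Qed.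

Lemma sdom_inj y : sdom y -> injective y.
Proof.
move=> yd k l kl; apply: val_inj; case: (ltngtP k l) => // h;
  by have := sdom_ord_mono yd h; rewrite kl ltxx.
Qed.

(** Expanding the determinant over permutations, and over the two terms of each entry, gives the
    signed count of the signed permutations w with [A + 2 nu = w A]. *)
Definition weyl_mx nu : 'M[R]_N :=
  \matrix_(i, j) (((A + (nu + nu)) i == A j)%:R - ((A + (nu + nu)) i == - A j)%:R).

Definition weyl_num nu : R := \det (weyl_mx nu).

(** The reflection [srefl 0] changes the sign of the first row, and the other simple reflections
    exchange two adjacent rows. *)
Lemma weyl_num_alternating : alternating n weyl_num.
Proof.
move=> p nu pN; rewrite /weyl_num /weyl_mx (dotE An _ pN).
set y := A + (nu + nu); case: p pN => [|p] pN.
  pose d : 'rV[R]_N := \row_k (-1) ^+ (k == Ordinal pN).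
  have -> : \matrix_(i, j) ((srefl 0 y i == A j)%:R - (srefl 0 y i == - A j)%:R) =
     diag_mx d *m \matrix_(i, j) ((y i == A j)%:R - (y i == - A j)%:R).
    apply/matrixP => i j; rewrite mul_diag_mx !mxE crd_srefl // /sidx /=.
    case: (eqVneq i (Ordinal pN)) => [->|i0] /=.
      by rewrite (crdN y 1) crd_Ordinal expr1 mulN1r opprB eqr_oppLR eqr_opp.
    rewrite (_ : (i.+1 == 1)%N = false); last first.
      by apply/negP => /eqP i1; case/eqP: i0; apply: val_inj => /=; lia.
    by rewrite crd_ord expr0 mul1r.
  rewrite det_mulmx det_diag -mulN1r; congr (_ * _).
  rewrite (bigD1 (Ordinal pN)) //= mxE eqxx expr1 big1 ?mulr1 // => k /negPf kp.
  by rewrite mxE kp.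
pose k1 := Ordinal (ltnW pN); pose k2 := Ordinal pN.
have -> : \matrix_(i, j) ((srefl p.+1 y i == A j)%:R - (srefl p.+1 y i == - A j)%:R) =
     xrow k1 k2 (\matrix_(i, j) ((y i == A j)%:R - (y i == - A j)%:R)) :> 'M[R]_N.
  apply/matrixP => i j; rewrite !mxE crd_srefl //.
  suff -> : crd y (sidx p.+1 i.+1%:Z) = y (tperm k1 k2 i) by [].
  rewrite /sidx /=; case: tpermP => [->|->|] /=.
  - rewrite (_ : (_ == _) = false) ?eqxx; last by lia.
    by rewrite (crd_Ordinal _ pN).
  - by rewrite eqxx (crd_Ordinal _ (ltnW pN)).
  - move=> i1 i2; have h1 : val i <> p by move=> ip; apply: i1; apply: val_inj.
    have h2 : val i <> p.+1 by move=> ip; apply: i2; apply: val_inj.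
    by rewrite !ifF; [rewrite -crd_ord | move: h1 h2 => /=; lia..].
have k12 : k1 != k2 by apply/eqP => /(congr1 val) /=; lia.
by rewrite xrowE det_mulmx det_perm odd_tperm k12 expr1 mulN1r.
Qed.

(** A nonzero determinant has no zero row, so each coordinate of the strictly dominant [A + 2 nu],
    being positive, is a coordinate of [A]. Both sequences are strictly increasing of the same
    length, hence equal. *)
Lemma weyl_num_sdom nu : sdom (A + (nu + nu)) -> weyl_num nu = (nu == 0)%:R.
Proof.
move=> yd; case: eqVneq => [->|nu0].
  rewrite /weyl_num; have -> : weyl_mx 0 = 1%:M.
    apply/matrixP => i j; rewrite [LHS]mxE !addr0 [RHS]mxE (inj_eq (sdom_inj Ad)).
    rewrite (_ : (A i == - A j) = false) ?subr0 //.
    have := sdom_gt0 i Ad; have := sdom_gt0 j Ad.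
    by move: (A i) (A j) => x z; lia.
  by rewrite det1.
apply/eqP; apply: contraNT nu0 => dn.
set y := A + (nu + nu) in yd.
have row_ex i : exists j, y i = A j.
  suff /existsP [j /eqP] : [exists j, y i == A j] by exists j.
  apply: contraNT dn => /existsPn yA.
  apply/eqP; rewrite /weyl_num (expand_det_row _ i) big1 // => j _.
  rewrite mxE -/y (negPf (yA j)) (_ : (_ == - _) = false) ?subr0 ?mul0r //.
  have := sdom_gt0 i yd; have := sdom_gt0 j Ad.
  by move: (A j) (y i) => x z; lia.
pose sq (z : X) := [seq crd z p.+1%:Z | p <- iota 0 N].
have sq_sorted z : sdom z -> sorted <%R (sq z).
  move=> zd; apply/(sortedP 0) => i; rewrite size_map size_iota => iN.
  rewrite !(nth_map 0%N) ?size_iota ?(ltnW iN) // !nth_iota ?(ltnW iN) // !add0n.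
  by apply: sdom_mono => //; rewrite ltnSn.
have sq_mem (z : X) x : reflect (exists k, x = z k) (x \in sq z).
  apply: (iffP mapP) => [[p]|[k ->]].
    by rewrite mem_iota add0n /= => pN ->; exists (Ordinal pN); rewrite crd_Ordinal.
  by exists (k : nat); rewrite ?crd_ord // mem_iota add0n /=.
have sub : {subset sq y <= sq A}.
  move=> x /sq_mem [k ->]; have [j ->] := row_ex k.
  by apply/sq_mem; exists j.
have sq_uniq z : sdom z -> uniq (sq z).
  by move=> zd; apply: sorted_uniq (sq_sorted z zd); [exact: lt_trans|exact: ltxx].
have [|_ mm] := uniq_min_size (sq_uniq _ yd) sub; first by rewrite !size_map.
have E : sq y = sq A.
  by apply: (irr_sorted_eq lt_trans ltxx) => //; apply: sq_sorted.
apply/eqP/ffunP => k; rewrite [RHS]ffunE.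
have := congr1 (fun s => nth 0 s k) E; rewrite !(nth_map 0%N) ?size_iota //.
rewrite !nth_iota // add0n !crd_ord /y !ffunE.
by move: (a k) (nu k) => x z h; rewrite -[RHS]/(0 : int); lia.
Qed.

(** The solution [nu] of [A + 2 nu = w A], for the signed permutation w given by a permutation and a
    set of sign changes. *)
Definition wpt (sf : 'S_N * {ffun 'I_N -> bool}) : X :=
  [ffun i => if sf.2 i then - (e + a i + a (sf.1 i)) else a (sf.1 i) - a i].

Definition wsg (sf : 'S_N * {ffun 'I_N -> bool}) : nat := (sf.1 + \sum_i sf.2 i)%N.

Lemma prod_sign (S : comNzRingType) (f : 'I_N -> bool) :
  \prod_i (-1) ^+ f i = (-1) ^+ (\sum_i f i)%N :> S.
Proof. by elim/big_rec2: _ => // i x y _ ->; rewrite exprD. Qed.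

Lemma weyl_numE nu :
  weyl_num nu = \sum_sf (-1) ^+ wsg sf * (nu == wpt sf)%:R.
Proof.
rewrite -(pair_bigA _ (fun s f => (-1) ^+ wsg (s, f) * (nu == wpt (s, f))%:R)) /=.
apply: eq_bigr => s _.
transitivity ((-1) ^+ s * \prod_i \sum_(b : bool) (-1) ^+ b *
   (nu i == (if b then - (e + a i + a (s i)) else a (s i) - a i))%:R : R).
  congr (_ * _); apply: eq_bigr => i _; rewrite mxE big_bool /= expr0 expr1 mul1r mulN1r.
  rewrite [LHS]addrC !ffunE; congr (- _%:R + _%:R); congr nat_of_bool;
    apply/eqP/eqP; move: (a i) (a (s i)) (nu i) => x z t; lia.
rewrite bigA_distr_bigA big_distrr /=; apply: eq_bigr => f _.
rewrite big_split /= prod_sign mulrA -exprD; congr (_ * _).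
case: eqVneq => [->|nf].
  by rewrite big1 // => i _; rewrite ffunE eqxx.
have [i ni] : exists i, nu i != wpt (s, f) i.
  apply/existsP; apply: contraNT nf => /existsPn h; apply/eqP/ffunP => i.
  by have := h i; rewrite negbK => /eqP.
by rewrite (bigD1 i) //=; move: ni; rewrite ffunE => /negPf->; rewrite mul0r.
Qed.

(** The product over positive coroots of 1 - q^m, with m the pairing of the coroot with Lambda +
    rho, whose coordinates are e/2 + [a]. *)
Definition weyl_product : fps R :=
  \prod_(j < N) (1 - qvar R ^+ `|(e + 2 * a j)%R|%N) *
  \prod_(i < N) \prod_(j < N | (i < j)%N)
    ((1 - qvar R ^+ `|(a j - a i)%R|%N) * (1 - qvar R ^+ `|(e + a i + a j)%R|%N)).

(** Both sides multiplied by q^K are one determinant. Its row [i] carries the power [i + 1], just as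
    [deg] weighs the coordinates by 1, ..., N, so its expansion is the specialized numerator; its
    factorization is [weyl_product]. *)
Lemma spec_weyl_num : spec (@deg N) weyl_num = weyl_product.
Proof.
have Apos i : 0 < e + 2 * a i by have := sdom_gt0 i Ad; rewrite ffunE.
have amono (i j : 'I_N) : (i < j)%N -> a i < a j.
  by move=> ij; have := sdom_ord_mono Ad ij; rewrite !ffunE; lia.
(* A bound for the [a i], added so that the exponents [M - a i] and [M + e + a i] are natural; their
   sum 2M + e does not depend on [i], as [det_power_differences] requires. *)
pose M : int := \sum_i `|a i|%:Z.
have Ma i : a i <= M.
  rewrite /M (bigD1 i) //=; have : 0 <= \sum_(j | j != i) `|a j|%:Z by apply: sumr_ge0.
  by move: (\sum_(j | _) _) (a i) => s x; lia.
pose m (b : bool) i := if b then `|(M + e + a i)%R|%N else `|(M - a i)%R|%N.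
pose u i := qvar R ^+ m false i; pose w i := qvar R ^+ m true i.
(* The exponent of the term of the identity in the expansion of [\det G]. *)
pose K := (\sum_(i < N) i.+1 * m false i)%N.
pose G := \matrix_(i < N, j < N) (u j ^+ i.+1 - w j ^+ i.+1).
have detG : \det G = qvar R ^+ K * weyl_product.
  rewrite (@det_power_differences _ _ u w (qvar R ^+ `|(2 * M + e)%R|%N)); last first.
    move=> j; rewrite /u /w -exprD; congr (_ ^+ _); rewrite /m.
    by have := Ma j; have := Apos j; lia.
  have uw j : u j - w j = u j * (1 - qvar R ^+ `|(e + 2 * a j)%R|%N).
    rewrite mulrBr mulr1 /u /w -exprD; congr (_ - _ ^+ _); rewrite /m.
    by have := Ma j; have := Apos j; lia.
  have uwij (i j : 'I_N) : (i < j)%N -> (u j + w j) - (u i + w i) =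
      u j * ((1 - qvar R ^+ `|(a j - a i)%R|%N) * (1 - qvar R ^+ `|(e + a i + a j)%R|%N)).
    move=> ij; have aij := amono _ _ ij; have := Ma j; have := Apos j; have := Apos i => hi hj hM.
    have -> : u i = u j * qvar R ^+ `|(a j - a i)%R|%N.
      by rewrite /u -exprD; congr (_ ^+ _); rewrite /m; lia.
    have -> : w i = u j * qvar R ^+ `|(e + a i + a j)%R|%N.
      by rewrite /u /w -exprD; congr (_ ^+ _); rewrite /m; lia.
    have -> : w j = u j * qvar R ^+ `|(a j - a i)%R|%N * qvar R ^+ `|(e + a i + a j)%R|%N.
      by rewrite /u /w -!exprD; congr (_ ^+ _); rewrite /m; lia.
    by ring.
  under eq_bigr do rewrite uw.
  under [X in _ * X]eq_bigr => i _ do (under eq_bigr => j ij do rewrite uwij //).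
  rewrite /weyl_product big_split /=.
  under [X in _ * X = _]eq_bigr do rewrite big_split /=.
  rewrite big_split /= mulrACA; congr (_ * _).
  rewrite (exchange_big_dep xpredT) //= -big_split /=.
  transitivity (\prod_(j < N) u j ^+ j.+1).
    apply: eq_bigr => j _; rewrite prodr_const exprS; congr (_ * _ ^+ _).
    rewrite -[RHS]card_ord -!sum1_card (big_ord_widen_cond N xpredT (fun=> 1%N)) ?(ltnW (ltn_ord j)) //.
  rewrite /K; elim/big_rec2: _ => // j x y _ ->.
  by rewrite /u -exprM exprD mulnC.
apply: fpsP => t.
have -> : fcoef weyl_product t = fcoef (\det G) (K + t)%N.
  by rewrite detG fcoef_qvarXM leq_addr addKn.
rewrite /spec /=.
have -> : level_sum (@deg N) weyl_num (- t%:Z) =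
  level_sum (@deg N) (fun nu => \sum_sf (-1) ^+ wsg sf * (nu == wpt sf)%:R) (- t%:Z) :> R.
  by congr level_sum; apply/funext => nu; apply: weyl_numE.
rewrite level_sum_delta.
have -> : \det G = \sum_sf (-1) ^+ wsg sf * qvar R ^+ (\sum_(i < N) i.+1 * m (sf.2 i) (sf.1 i)).
  rewrite -(pair_bigA _ (fun s (f : {ffun 'I_N -> bool}) =>
     (-1) ^+ wsg (s, f) * qvar R ^+ (\sum_(i < N) i.+1 * m (f i) (s i)))) /=.
  apply: eq_bigr => s _.
  transitivity ((-1) ^+ s * \prod_(i < N) \sum_(b : bool) (-1) ^+ b * qvar R ^+ (i.+1 * m b (s i))).
    congr (_ * _); apply: eq_bigr => i _; rewrite mxE big_bool /= expr0 expr1 mul1r mulN1r.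
    by rewrite addrC /u /w -!exprM ![(i.+1 * _)%N]mulnC.
  rewrite bigA_distr_bigA big_distrr /=; apply: eq_bigr => f _.
  rewrite big_split /= prod_sign mulrA -exprD; congr (_ * _).
  by elim/big_rec2: _ => // i x y _ ->; rewrite exprD.
rewrite fcoef_sum; apply: eq_bigr => -[s f] _.
have signC (k : nat) (g : fps R) r : fcoef ((-1) ^+ k * g) r = (-1) ^+ k * fcoef g r.
  by rewrite -!(signr_odd _ k); case: odd; rewrite ?expr0 ?expr1 ?mul1r ?mulN1r.
have KE : (\sum_(i < N) i.+1 * m (f i) (s i))%N%:Z = K%:Z - deg (wpt (s, f)).
  rewrite /K /deg !(big_morph Posz PoszD (erefl _)) -sumrB.
  apply: eq_bigr => i _; rewrite !PoszM -mulrBr; congr (_ * _); rewrite ffunE /m /=.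
  by have := Ma i; have := Ma (s i); have := Apos (s i); case: (f i); lia.
rewrite signC qvarX; congr (_ * _%:R); congr nat_of_bool => /=.
move: KE; move: (\sum_(i < N) _)%N (deg _) (K) => S d K0 KE.
by apply/eqP/eqP; lia.
Qed.

(** The difference between the operator applied to [f] and [weyl_num] is alternating. At strictly
    dominant [A + 2 nu] both are the indicator of [nu = 0], the former because [quad nu = 0] on its
    support. *)
Lemma spec_dominant (f : X -> R) :
  (forall p nu, (p < N)%N -> f (srefl p nu - alpha N p *~ (n p - 1)) = f nu) ->
  (forall nu, f nu != 0 -> cone nu) -> f 0 = 1 ->
  (forall nu, (quad A nu)%:~R * diffop (pos_roots N) f nu = 0) ->
  spec (@deg N) f * \prod_(b <- pos_roots N) (1 - qvar R ^+ `|deg b|%N) = weyl_product.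
Proof.
move=> fr fc f0 fq; rewrite -spec_diffop; first last.
- move=> nu nu0; apply/eqP; apply: contraTT nu0 => /fc /cone_deg.
  by rewrite leNgt.
- exact: cone_level_finite fc.
- by move=> b /deg_pos_roots /ltW.
- exact: degD.
rewrite -spec_weyl_num; congr (spec _ _); apply/funext => nu.
apply/eqP; rewrite -subr_eq0; apply/eqP.
move: nu; apply: (alternating_eq0 An) => [p nu pN|nu yd].
  by rewrite (diffop_alternating fr) // weyl_num_alternating // opprB addrC opprK.
rewrite weyl_num_sdom //; case: eqVneq => [->|nu0].
  by rewrite diffop0 // ?f0 ?subrr.
rewrite subr0; apply/eqP; apply: contraNT nu0 => dn.
apply/eqP/(sdom_quad_eq0 Ad) => //.
  by apply: diffop_cone dn => //; apply: cone_pos_roots.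
by have /eqP := fq nu; rewrite mulf_eq0 (negPf dn) orbF intr_eq0 => /eqP.
Qed.

End WeylNumerator.

(** * Finite bases, dimensions and traces of subspaces given as sets *)

Section Frames.
Variables (F : fieldType) (V : lmodType F).
Implicit Types (W : set V) (e : seq V).

Definition spans e : set V :=
  [set u | exists c : nat -> F, u = \sum_(i < size e) c i *: e`_i].

Definition free_seq e : Prop :=
  forall c : nat -> F, \sum_(i < size e) c i *: e`_i = 0 ->
  forall i, (i < size e)%N -> c i = 0.

(** [V] itself may be infinite-dimensional, so bases are attached to the subspaces; the coordinates
    are arbitrary outside [W]. *)
Record frame W := Frame {
  fbasis : seq V;
  fcoord : V -> nat -> F;
  frame_free : free_seq fbasis;
  frame_mem : forall i, (i < size fbasis)%N -> W fbasis`_i;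
  frame_coord : forall u, W u ->
    u = \sum_(i < size fbasis) fcoord u i *: fbasis`_i }.

Arguments frame_mem {W} f {i} _.
Arguments frame_coord {W} f {u} _.
Arguments frame_free {W} f {c} _ {i} _.

Definition frame_dim W (fr : frame W) := size (fbasis fr).

Lemma spans_free e : exists b, spans b = spans e /\ free_seq b.
Proof.
elim: e => [|x e [b [bE bfree]]].
  by exists [::]; split=> // c _ i.
have spansP (e' : seq V) u : spans (x :: e') u <->
    exists a w, spans e' w /\ u = a *: x + w.
  split=> [[c ->]|[a [w [[c ->] ->]]]].
    by rewrite big_ord_recl; exists (c 0%N); eexists; split=> //; exists (c \o S).
  by exists (fun i => if i is i'.+1 then c i' else a); rewrite big_ord_recl.
case: (pselect (spans e x)) => [ex|nex].
  exists b; split=> //; apply/seteqP; split=> u.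
    by rewrite bE => eu; apply/spansP; exists 0, u; rewrite scale0r add0r.
  rewrite bE => /spansP [a [w [[c ->] ->]]]; case: ex => c' ->.
  exists (fun i => a * c' i + c i); rewrite scaler_sumr -big_split /=.
  by apply: eq_bigr => i _; rewrite scalerDl scalerA.
exists (x :: b); split.
  by apply/seteqP; split=> u /spansP [a [w [ew ->]]]; apply/spansP;
    exists a, w; rewrite bE in ew *.
move=> c; rewrite big_ord_recl /= => c0.
have c00 : c 0%N = 0.
  apply: contra_notP nex => /eqP c0n; rewrite -bE.
  exists (fun i => - (c 0%N)^-1 * c i.+1).
  transitivity (- (c 0%N)^-1 *: (\sum_(i < size b) c i.+1 *: b`_i)).
    move/eqP: c0; rewrite addr_eq0 => /eqP /(congr1 (fun u => (c 0%N)^-1 *: u)).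
    by rewrite scalerA mulVf // scale1r => ->; rewrite scalerN scaleNr.
  by rewrite scaler_sumr; apply: eq_bigr => i _; rewrite scalerA.
move: c0; rewrite c00 scale0r add0r => c0 [|i] // ib.
exact: (bfree (c \o S)).
Qed.

Lemma spans_mem e u : u \in e -> spans e u.
Proof.
move=> /(nthP 0) [i ie <-]; exists (fun j => (j == i)%:R).
rewrite (bigD1 (Ordinal ie)) //= eqxx scale1r big1 ?addr0 // => j.
by rewrite -val_eqE /= => /negPf->; rewrite scale0r.
Qed.

Lemma spans_subspace e : subspace (spans e).
Proof.
split; first by exists (fun=> 0); rewrite big1 // => i _; rewrite scale0r.
move=> a u w [c ->] [c' ->]; exists (fun i => a * c i + c' i).
rewrite scaler_sumr -big_split /=; apply: eq_bigr => i _.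
by rewrite scalerDl scalerA.
Qed.

Lemma sub_sum W I (r : seq I) (P : pred I) (f : I -> V) :
  subspace W -> (forall i, P i -> W (f i)) -> W (\sum_(i <- r | P i) f i).
Proof.
move=> [W0 Wl] Wf; elim/big_ind: _ => // u w Wu Ww.
by rewrite -[u]scale1r; apply: Wl.
Qed.

Lemma subZ W a u : subspace W -> W u -> W (a *: u).
Proof. by move=> [W0 Wl] Wu; rewrite -[a *: u]addr0; apply: Wl. Qed.

Lemma subD W u w : subspace W -> W u -> W w -> W (u + w).
Proof. by move=> [W0 Wl] Wu Ww; rewrite -[u]scale1r; apply: Wl. Qed.

Lemma subB W u w : subspace W -> W u -> W w -> W (u - w).
Proof. by move=> [W0 Wl] Wu Ww; rewrite addrC -scaleN1r; apply: Wl. Qed.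

Lemma frame_of_spans W e : subspace W -> (forall u, u \in e -> W u) ->
  (forall u, W u -> spans e u) -> inhabited (frame W).
Proof.
move=> Wsub eW We; have [b [bE bfree]] := spans_free e.
have WE : W = spans b.
  apply/seteqP; split=> u; first by rewrite bE; apply: We.
  rewrite bE => -[c ->]; apply: sub_sum => // i _.
  by apply: subZ => //; apply: eW; rewrite mem_nth.
have coP u : exists c : nat -> F, W u -> u = \sum_(i < size b) c i *: b`_i.
  by case: (pselect (W u)) => [|Wu]; [rewrite WE => -[c cE]; exists c | exists (fun=> 0)].
constructor; apply: (@Frame _ b (fun u => sval (cid (coP u)))) => //.
  by move=> i ib; rewrite WE; apply: spans_mem; rewrite mem_nth.
by move=> u Wu; case: cid => c /= /(_ Wu).
Qed.

Lemma frame_has_dim W (fr : frame W) : has_dim W (frame_dim fr).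
Proof.
exists (fun i => (fbasis fr)`_i); split=> [i|u Wu]; first exact: frame_mem.
exists (\row_i fcoord fr u i); split=> [|a aE].
  by rewrite {1}(frame_coord fr Wu); apply: eq_bigr => i _; rewrite mxE.
apply/rowP => i; rewrite mxE; apply/eqP; rewrite -subr_eq0; apply/eqP.
pose c j := if insub j is Some j' then fcoord fr u j - a 0 j' else 0.
have := @frame_free _ fr c.
rewrite (eq_bigr (fun j : 'I__ => fcoord fr u j *: (fbasis fr)`_j
   - a 0 j *: (fbasis fr)`_j)); last by move=> j _; rewrite /c valK scalerBl.
rewrite sumrB -aE -(frame_coord fr Wu) subrr => /(_ erefl _ (ltn_ord i)).
by rewrite /c valK.
Qed.

Lemma fcoord_eq W (fr : frame W) (c : nat -> F) u i :
  W u -> u = \sum_(j < frame_dim fr) c j *: (fbasis fr)`_j ->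
  (i < frame_dim fr)%N -> fcoord fr u i = c i.
Proof.
move=> Wu uE id; apply/eqP; rewrite -subr_eq0; apply/eqP.
apply: (frame_free fr (c := fun i => fcoord fr u i - c i)) => //.
under eq_bigr do rewrite scalerBl.
by rewrite sumrB -uE -frame_coord // subrr.
Qed.

Definition ftrace W (fr : frame W) (S : V -> V) : F :=
  \sum_(i < frame_dim fr) fcoord fr (S (fbasis fr)`_i) i.

Lemma ftraceD W (fr : frame W) S T : subspace W ->
  (forall u, W u -> W (S u)) -> (forall u, W u -> W (T u)) ->
  ftrace fr (fun u => S u + T u) = ftrace fr S + ftrace fr T.
Proof.
move=> Ws WS WT; rewrite -big_split /=; apply: eq_bigr => i _.
have Wb := frame_mem fr (ltn_ord i).
apply: (fcoord_eq (c := fun j => fcoord fr (S (fbasis fr)`_i) j +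
  fcoord fr (T (fbasis fr)`_i) j)) => //; first by apply: subD; auto.
rewrite {1}(frame_coord fr (WS _ Wb)) {1}(frame_coord fr (WT _ Wb)) -big_split /=.
by apply: eq_bigr => j _; rewrite scalerDl.
Qed.

Lemma ftraceZ W (fr : frame W) a : subspace W ->
  ftrace fr (fun u => a *: u) = a * (frame_dim fr)%:R.
Proof.
move=> Ws; rewrite /ftrace -[frame_dim fr in RHS]card_ord mulr_natr -sumr_const.
apply: eq_bigr => i _; have Wb := frame_mem fr (ltn_ord i).
rewrite (fcoord_eq (c := fun j => a * (j == i :> nat)%:R)) ?eqxx ?mulr1 //.
  exact: subZ.
rewrite (bigD1 i) //= eqxx mulr1 big1 ?addr0 // => j /negPf.
by rewrite -val_eqE /= => ->; rewrite mulr0 scale0r.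
Qed.

Lemma eq_ftrace W (fr : frame W) S T : (forall u, W u -> S u = T u) ->
  ftrace fr S = ftrace fr T.
Proof.
by move=> ST; apply: eq_bigr => i _; rewrite ST //; apply: frame_mem.
Qed.

Lemma ftrace_sum W (fr : frame W) I (r : seq I) (S : I -> V -> V) : subspace W ->
  (forall i u, W u -> W (S i u)) ->
  ftrace fr (fun u => \sum_(i <- r) S i u) = \sum_(i <- r) ftrace fr (S i).
Proof.
move=> Ws WS; elim: r => [|i r IH].
  rewrite big_nil -[RHS](mul0r (frame_dim fr)%:R) -ftraceZ //; apply: eq_ftrace => u _.
  by rewrite big_nil scale0r.
rewrite big_cons -IH -ftraceD //.
- by apply: eq_ftrace => u _; rewrite big_cons.
- by move=> u; apply: WS.
- by move=> u Wu; apply: sub_sum => // *; apply: WS.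
Qed.

(** The two maps go between different subspaces; this carries a trace from one weight space to
    another along a root. *)
Lemma ftraceC W W' (fr : frame W) (fr' : frame W') (S T : {linear V -> V}) :
  (forall u, W u -> W' (S u)) -> (forall u, W' u -> W (T u)) ->
  ftrace fr (fun u => T (S u)) = ftrace fr' (fun u => S (T u)).
Proof.
move=> WS WT.
have main W1 W2 (f1 : frame W1) (f2 : frame W2) (S1 T1 : {linear V -> V}) :
    (forall u, W1 u -> W2 (S1 u)) -> (forall u, W2 u -> W1 (T1 u)) ->
    ftrace f1 (fun u => T1 (S1 u)) =
    \sum_(i < frame_dim f1) \sum_(j < frame_dim f2)
      fcoord f2 (S1 (fbasis f1)`_i) j * fcoord f1 (T1 (fbasis f2)`_j) i.
  move=> W12 W21; apply: eq_bigr => i _; have Wb := frame_mem f1 (ltn_ord i).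
  apply: (fcoord_eq (c := fun k => \sum_(j < frame_dim f2)
     fcoord f2 (S1 (fbasis f1)`_i) j * fcoord f1 (T1 (fbasis f2)`_j) k)) => //.
    by apply: W21; apply: W12.
  rewrite {1}(frame_coord f2 (W12 _ Wb)) linear_sum.
  under [RHS]eq_bigr do rewrite scaler_suml.
  rewrite exchange_big /=; apply: eq_bigr => j _; rewrite linearZ /=.
  have Wb' := frame_mem f2 (ltn_ord j).
  rewrite {1}(frame_coord f1 (W21 _ Wb')) scaler_sumr.
  by apply: eq_bigr => k _; rewrite scalerA.
rewrite (main _ _ fr fr') // (main _ _ fr' fr) // exchange_big.
by apply: eq_bigr => i _; apply: eq_bigr => j _; rewrite mulrC.
Qed.

Lemma frame_dim_le W W' (fr : frame W) (fr' : frame W') (S : {linear V -> V}) :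
  subspace W -> (forall u, W u -> W' (S u)) -> (forall u, W u -> S u = 0 -> u = 0) ->
  (frame_dim fr <= frame_dim fr')%N.
Proof.
move=> Ws WS Sinj.
pose M := \matrix_(i < frame_dim fr, j < frame_dim fr')
   fcoord fr' (S (fbasis fr)`_i) j.
suff : row_free M by rewrite /row_free => /eqP <-; apply: rank_leq_col.
rewrite -kermx_eq0; apply/eqP/row_matrixP => r; rewrite row0.
  set a := row r _.
  have aM : a *m M = 0 by rewrite -row_mul mulmx_ker row0.
  pose c j := if insub j is Some j' then a 0 j' else 0.
  pose u := \sum_(i < frame_dim fr) c i *: (fbasis fr)`_i.
  have Wu : W u.
    by apply: sub_sum => // i _; apply: subZ => //; apply: frame_mem.
  have Su : S u = 0.
    rewrite linear_sum; under eq_bigr do rewrite linearZ /=.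
    transitivity (\sum_(j < frame_dim fr') (a *m M) 0 j *: (fbasis fr')`_j).
      under [RHS]eq_bigr do rewrite mxE scaler_suml.
      rewrite exchange_big /=; apply: eq_bigr => i _; rewrite /c valK.
      have Wb := frame_mem fr (ltn_ord i).
      rewrite {1}(frame_coord fr' (WS _ Wb)) scaler_sumr; apply: eq_bigr => j _.
      by rewrite scalerA [M _ _]mxE.
    by rewrite aM big1 // => j _; rewrite mxE scale0r.
  have u0 := Sinj _ Wu Su.
  apply/rowP => i; rewrite [RHS]mxE.
  by have := frame_free fr u0 (ltn_ord i); rewrite /c valK.
Qed.

End Frames.

Arguments frame_mem {F V W} f {i} _.
Arguments frame_coord {F V W} f {u} _.
Arguments frame_free {F V W} f {c} _ {i} _.

(** * Strings of weight spaces under sl(2) *)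

Section Sl2.
Variables (F : numFieldType) (V : lmodType F) (E G : {linear V -> V}).
Variables (S : int -> set V) (n : int).
Hypothesis S_sub : forall t, subspace (S t).
Hypothesis SE : forall t w, S t w -> S (t + 1) (E w).
Hypothesis SG : forall t w, S t w -> S (t - 1) (G w).
Hypothesis EG : forall t w, S t w -> E (G w) - G (E w) = (n + 2 * t)%:~R *: w.
Hypothesis n_ge0 : 0 <= n.

Lemma linear_iter (T : {linear V -> V}) j a u w :
  iter j T (a *: u + w) = a *: iter j T u + iter j T w.
Proof. by elim: j => //= j ->; rewrite linearP. Qed.

Let S_iterE j t w : S t w -> S (t + j%:Z) (iter j E w).
Proof.
elim: j => [|j IH] St /=; first by rewrite addr0.
by rewrite -addn1 PoszD addrA; apply/SE/IH.
Qed.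

Let S_iterG j t w : S t w -> S (t - j%:Z) (iter j G w).
Proof.
elim: j => [|j IH] St /=; first by rewrite subr0.
by rewrite -addn1 PoszD opprD addrA; apply/SG/IH.
Qed.

Let iter_eq0 (T : {linear V -> V}) j : iter j T 0 = 0.
Proof. by elim: j => //= j ->; rewrite linear0. Qed.

(** By induction G E^(r+1) w = - (a + r (n + r + 1)) E^r w, with a nonzero coefficient; hence
    E^(r+1) w = 0 forces E^r w = 0, down to w = 0. *)
Lemma sl2_no_negative_eigenvector (a : int) s w : 0 < a -> S 0 w ->
  iter s E w = 0 -> G (E w) = - a%:~R *: w -> w = 0.
Proof.
move=> a0 Sw Es GE.
have GEs r : G (iter r.+1 E w) = - (a + r%:Z * (n + r%:Z + 1))%:~R *: iter r E w.
  elim: r => [|r IH]; first by rewrite /= mul0r addr0.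
  have := EG (S_iterE r.+1 Sw) => /eqP; rewrite subr_eq addrC -subr_eq => /eqP <-.
  rewrite IH linearZ /= -scalerBl; congr (_ *: _).
  rewrite -[r.+1]addn1 PoszD !rmorphD !rmorphM !rmorphD /=; ring.
elim: s Es => // s IH Es; apply: IH.
have /eqP := GEs s; rewrite Es linear0 eq_sym scaler_eq0 oppr_eq0 intr_eq0.
by case/orP => [|/eqP //]; rewrite gt_eqF // ltr_wpDr // mulr_ge0 // !addr_ge0.
Qed.

(** Half of the symmetry of sl(2) weight multiplicities. If G^(j+1) u = 0 with j < n, applying E
    gives G^j (G E u + a u) = 0 with a = (j + 1)(n - j) > 0; by induction G E u = - a u, so u = 0 by
    the preceding lemma. *)
Lemma sl2_lower_inj w : (forall u, S 0 u -> exists s, iter s E u = 0) ->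
  S 0 w -> iter `|n|%N G w = 0 -> w = 0.
Proof.
move=> Enil Sw.
have EGj j u : S 0 u -> E (iter j.+1 G u) =
    iter j.+1 G (E u) + (j.+1%:Z * (n - j%:Z))%:~R *: iter j G u.
  move=> Su; elim: j => [|j IH].
    by have /eqP := EG Su; rewrite subr_eq addrC => /eqP /= ->; congr (_ + _ *: _);
      rewrite ?mulr0 ?addr0 ?subr0 ?mul1r.
  have /eqP := EG (S_iterG j.+1 Su); rewrite subr_eq addrC => /eqP -> /=.
  rewrite IH linearD linearZ /= -addrA -scalerDl; congr (_ + _ *: _).
  rewrite add0r -[j.+2]addn1 -[j.+1]addn1 !PoszD !(rmorphD, rmorphM, rmorphN) /=; ring.
suff main j : j%:Z <= n -> forall u, S 0 u -> iter j G u = 0 -> u = 0.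
  by apply: main => //; rewrite gez0_abs.
elim: j => // j IH jn u Su Gu.
pose a : int := j.+1%:Z * (n - j%:Z).
have a0 : 0 < a by rewrite mulr_gt0 // subr_gt0; apply: lt_le_trans jn; rewrite ltz_nat.
have Su' : S 0 (a%:~R *: u + G (E u)).
  apply: (S_sub 0).2 => //; have := SG (SE Su).
  by rewrite add0r subrr.
have /IH /(_ _ Su') : j%:Z <= n by apply: le_trans jn; rewrite lez_nat.
rewrite linear_iter addrC -iterSr -EGj // Gu linear0 => /(_ erefl) /eqP.
rewrite addrC addr_eq0 -scaleNr => /eqP GE.
have [s Es] := Enil _ Su.
exact: sl2_no_negative_eigenvector a0 Su Es GE.
Qed.

End Sl2.

Lemma frame_add (F : fieldType) (V : lmodType F) (W W1 W2 : set V)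
    (f1 : frame W1) (f2 : frame W2) : subspace W1 -> subspace W2 ->
  (forall u1 u2, W1 u1 -> W2 u2 -> u1 + u2 = 0 -> u1 = 0) ->
  (forall u, W u <-> exists u1 u2, [/\ W1 u1, W2 u2 & u = u1 + u2]) ->
  exists f : frame W, frame_dim f = (frame_dim f1 + frame_dim f2)%N.
Proof.
move=> S1 S2 dir WE; pose b := fbasis f1 ++ fbasis f2.
have sumb (c : nat -> F) : \sum_(i < size b) c i *: b`_i =
   \sum_(i < frame_dim f1) c i *: (fbasis f1)`_i +
   \sum_(i < frame_dim f2) c (frame_dim f1 + i)%N *: (fbasis f2)`_i.
  rewrite /b size_cat big_split_ord /=; congr (_ + _); apply: eq_bigr => i _ /=.
    by rewrite nth_cat ltn_ord.
  by rewrite nth_cat ltnNge leq_addr /= addKn.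
have W1s (c : nat -> F) : W1 (\sum_(i < frame_dim f1) c i *: (fbasis f1)`_i).
  by apply: sub_sum => // i _; apply: subZ => //; apply: frame_mem.
have W2s (c : nat -> F) : W2 (\sum_(i < frame_dim f2) c i *: (fbasis f2)`_i).
  by apply: sub_sum => // i _; apply: subZ => //; apply: frame_mem.
have bfree : free_seq b.
  move=> c; rewrite sumb => c0; have c1 := dir _ _ (W1s c) (W2s (fun i => c (frame_dim f1 + i)%N)) c0.
  move: c0; rewrite c1 add0r => c2 i; rewrite size_cat => ib.
  case: (ltnP i (frame_dim f1)) => i1; first exact: (frame_free f1 c1).
  rewrite -(subnKC i1).
  apply: (frame_free f2 (c := fun i => c (frame_dim f1 + i)%N) c2).
  by rewrite ltn_subLR.
have co u : exists c : nat -> F, W u -> u = \sum_(i < size b) c i *: b`_i.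
  case: (pselect (W u)) => [|nW]; last by exists (fun=> 0).
  move=> /WE [u1 [u2 [h1 h2 ->]]].
  pose c i := if (i < frame_dim f1)%N then fcoord f1 u1 i
              else fcoord f2 u2 (i - frame_dim f1)%N.
  exists c => _; rewrite (sumb c) /c {1}(frame_coord f1 h1) {1}(frame_coord f2 h2).
  congr (_ + _); apply: eq_bigr => i _; first by rewrite ltn_ord.
  by rewrite ltnNge leq_addr /= addKn.
have bW i : (i < size b)%N -> W b`_i.
  move=> ib; apply/WE; rewrite /b nth_cat; case: ltnP => i1.
    by exists (fbasis f1)`_i, 0; split; [exact: frame_mem|exact: S2.1|rewrite addr0].
  exists 0, (fbasis f2)`_(i - size (fbasis f1)); split; [exact: S1.1| |by rewrite add0r].
  by apply: frame_mem; move: ib; rewrite size_cat -ltn_subLR.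
exists (@Frame _ _ W b (fun u => sval (cid (co u))) bfree bW (fun u => svalP (cid (co u)))).
by rewrite /frame_dim /= size_cat.
Qed.

(** * The highest weight module of so(2N+1) generated by v *)

Section FiniteRank.
Variables (F : numFieldType) (V : lmodType F) (X : int -> int -> {linear V -> V}).
Variables (N : nat) (B : {ffun 'I_N -> int}) (v : V).
Local Notation lattice := {ffun 'I_N -> int}.
Implicit Types (nu mu : lattice) (i j k l : int) (u w : V) (p : nat).

(* The relations of so(2N+1), for X_{ij} = E_{ij} - E_{-j,-i}. *)
Hypothesis XN : forall i j u, X (- j) (- i) u = - X i j u.
Hypothesis Xbr : forall i j k l u, X i j (X k l u) - X k l (X i j u) =
  (j == k)%:R *: X i l u - (l == i)%:R *: X k j u
  - (k == - i)%:R *: X (- j) l u + (l == - j)%:R *: X k (- i) u.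
Hypothesis Xdiag : forall k, (`|k| <= N)%N -> X k k v = - ((crd B k)%:~R / 2) *: v.
Hypothesis Xpos : forall i j, i < j -> X i j v = 0.

(** Weight spaces relative to the highest weight, generated by lowering operators instead of being
    defined as eigenspaces: only vectors reached from [v] may be counted. *)
Inductive wsp : lattice -> V -> Prop :=
| wsp_v : wsp 0 v
| wsp_0 nu : wsp nu 0
| wsp_lin nu a u w : wsp nu u -> wsp nu w -> wsp nu (a *: u + w)
| wsp_act nu i j u : (`|i| <= N)%N -> (`|j| <= N)%N -> j < i -> wsp nu u ->
    wsp (nu + (dlt N j - dlt N i)) (X i j u).

Lemma wsp_sub nu : subspace (wsp nu).
Proof. by split; [apply: wsp_0 | move=> *; apply: wsp_lin]. Qed.

Lemma wsp_cone nu u : wsp nu u -> u = 0 \/ cone nu.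
Proof.
elim=> [|nu'|nu' a u' w' _ IHu _ IHw|nu' i j u' iN jN ij _ IH].
- by right; apply: cone0.
- by left.
- by case: IHu IHw => [->|?] [->|?]; [left; rewrite scaler0 addr0|right..].
- case: IH => [->|c]; first by left; rewrite linear0.
  by right; apply: coneD => //; apply: cone_dlt => //; apply: ltW.
Qed.

(** The k-th coordinate of Lambda + nu. It is minus the eigenvalue of [X k k], as [X i j] is given
    the weight [dlt j - dlt i]. *)
Definition wval k nu : F := (crd B k)%:~R / 2 + (crd nu k)%:~R.

Lemma Xcomm i j k l u : X i j (X k l u) = X k l (X i j u) +
  ((j == k)%:R *: X i l u - (l == i)%:R *: X k j u
  - (k == - i)%:R *: X (- j) l u + (l == - j)%:R *: X k (- i) u).
Proof. by rewrite -Xbr addrC subrK. Qed.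

Lemma wsp_diag k nu u : (`|k| <= N)%N -> wsp nu u -> X k k u = - wval k nu *: u.
Proof.
move=> kN; elim=> [|nu'|nu' a u' w' _ IHu _ IHw|nu' i j u' iN jN ij _ IH].
- by rewrite Xdiag // /wval -[0]/(0 *~ 0) crdZ mulr0 addr0.
- by rewrite linear0 scaler0.
- by rewrite linearP IHu IHw scalerDr !scalerA mulrC.
rewrite Xcomm IH linearZ /=.
have -> : (k == i)%:R *: X k j u' - (j == k)%:R *: X i k u' -
    (i == - k)%:R *: X (- k) j u' + (j == - k)%:R *: X i (- k) u' =
    ((k == i)%:R - (j == k)%:R - (i == - k)%:R + (j == - k)%:R) *: X i j u'.
  rewrite scalerDl !scalerBl.
  congr (_ - _ - _ + _).
  - by case: eqP => [->|]; rewrite ?scale0r.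
  - by case: eqP => [->|]; rewrite ?scale0r.
  - by case: eqP => [->|]; rewrite ?scale0r.
  - by case: eqP => [->|]; rewrite ?scale0r.
rewrite -scalerDl; congr (_ *: _).
rewrite /wval crdD crdD -dltN !crd_dlt // (eq_sym k i) eqr_oppLR eqr_opp.
by rewrite !(rmorphD, rmorphN) /= !pmulrn; ring.
Qed.

(** An arbitrary operator is commuted to the right through the lowering operators until it meets
    [v], where raising ones vanish and diagonal ones are scalars. *)
Lemma wsp_X i j nu u : (`|i| <= N)%N -> (`|j| <= N)%N -> wsp nu u ->
  wsp (nu + (dlt N j - dlt N i)) (X i j u).
Proof.
move=> iN jN ws; elim: ws i j iN jN => [|nu'|nu' a u' w' _ IHu _ IHw|nu' k l u' kN lN kl _ IH] i j iN jN.
- case: (ltgtP i j) => ij.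
  + by rewrite Xpos //; apply: wsp_0.
  + by apply: wsp_act => //; apply: wsp_v.
  + rewrite ij subrr add0r Xdiag //; apply: subZ; [exact: wsp_sub|exact: wsp_v].
- by rewrite linear0; apply: wsp_0.
- by rewrite linearP; apply: wsp_lin; [apply: IHu | apply: IHw].
rewrite Xcomm; apply: subD; first exact: wsp_sub.
  rewrite -addrA [X in nu' + X]addrC addrA.
  by apply: wsp_act => //; apply: IH.
have term (b : bool) i' j' : (`|i'| <= N)%N -> (`|j'| <= N)%N ->
   (b -> dlt N l - dlt N k + (dlt N j - dlt N i) = dlt N j' - dlt N i') ->
   wsp (nu' + (dlt N l - dlt N k) + (dlt N j - dlt N i)) (b%:R *: X i' j' u').
  move=> i'N j'N; case: b => [/(_ isT) E|_]; last by rewrite scale0r; apply: wsp_0.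
  by rewrite scale1r -addrA E; apply: IH.
apply: subD; first exact: wsp_sub; last first.
  apply: term; rewrite ?abszN // => /eqP ->; rewrite !dltN.
  by move: (dlt N j) (dlt N i) (dlt N k) => x y z; apply/ffunP => t; rewrite !ffunE; ring.
apply: subB; first exact: wsp_sub; last first.
  apply: term; rewrite ?abszN // => /eqP ->; rewrite !dltN.
  by move: (dlt N j) (dlt N i) (dlt N l) => x y z; apply/ffunP => t; rewrite !ffunE; ring.
apply: subB; first exact: wsp_sub; last first.
  apply: term; rewrite // => /eqP ->.
  by move: (dlt N j) (dlt N i) (dlt N k) => x y z; apply/ffunP => t; rewrite !ffunE; ring.
apply: term; rewrite // => /eqP ->.
by move: (dlt N l) (dlt N i) (dlt N k) => x y z; apply/ffunP => t; rewrite !ffunE; ring.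
Qed.

(* The number of times ad X_{p+1,p} can act on the row index [k], resp. on the
   column index [l], of X_{kl} before it vanishes. *)
Definition row_height p k : nat :=
  if k == - p.+1%:Z then (if p == 0%N then 2%N else 1%N) else (k == p%:Z).
Definition col_height p l : nat :=
  if l == p.+1%:Z then (if p == 0%N then 2%N else 1%N) else (l == - p%:Z).

Lemma iter_linear0 (f : {linear V -> V}) K : iter K f 0 = 0.
Proof. by elim: K => //= K ->; rewrite linear0. Qed.

Lemma iter_linearD (f : {linear V -> V}) K u w :
  iter K f (u + w) = iter K f u + iter K f w.
Proof. by elim: K => //= K ->; rewrite linearD. Qed.

Lemma iter_linearZ (f : {linear V -> V}) K a u : iter K f (a *: u) = a *: iter K f u.
Proof. by elim: K => //= K ->; rewrite linearZ. Qed.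

Lemma iter_ge0 (f : {linear V -> V}) K K' u : (K <= K')%N ->
  iter K f u = 0 -> iter K' f u = 0.
Proof.
move=> /subnK <- fu; elim: (K' - K)%N => //= d IH.
by rewrite IH linear0.
Qed.

(** Each commutator of [X k l] with [X p.+1 p] lowers the sum of its two heights, so fewer than [m]
    of the factors can be absorbed; the remaining ones, more than [K], kill [u]. *)
Lemma nilpotent_X p m k l K u : (row_height p k + col_height p l < m)%N ->
  iter K (X p.+1%:Z p%:Z) u = 0 -> iter (K + m) (X p.+1%:Z p%:Z) (X k l u) = 0.
Proof.
elim: m k l K u => // m IHm k l K; elim: K => [|K IHK] u hm.
  by move=> u0; rewrite (_ : u = 0) // linear0 iter_linear0.
move=> fu; rewrite addSn iterSr Xcomm iter_linearD.
rewrite IHK // ?add0r; last by rewrite -iterSr.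
have E : (K + m.+1 = K.+1 + m)%N by rewrite addnS.
have term (b : bool) k' l' : (b -> row_height p k' + col_height p l' < m)%N ->
    iter (K + m.+1) (X p.+1%:Z p%:Z) (b%:R *: X k' l' u) = 0.
  case: b => [/(_ isT) h|_]; last by rewrite scale0r iter_linear0.
  by rewrite scale1r E; apply: IHm.
have tN (b : bool) k' l' : (b -> row_height p k' + col_height p l' < m)%N ->
    iter (K + m.+1) (X p.+1%:Z p%:Z) (- (b%:R *: X k' l' u)) = 0.
  by move=> h; rewrite -scaleN1r iter_linearZ term // scaler0.
rewrite !iter_linearD !tN ?term ?addr0 //; move: hm; rewrite /row_height /col_height;
  case: (eqVneq p 0%N) => [->|p0] /=; repeat (case: ifP => ?); move=> /=; lia.
Qed.

Hypothesis Xnil : forall p, (p < N)%N -> exists K, iter K (X p.+1%:Z p%:Z) v = 0.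

Lemma lower_nilpotent p nu u : (p < N)%N -> wsp nu u ->
  exists K, iter K (X p.+1%:Z p%:Z) u = 0.
Proof.
move=> pN; elim=> [|nu'|nu' a u' w' _ [K IHu] _ [K' IHw]|nu' i j u' _ _ _ _ [K IH]].
- exact: Xnil.
- by exists 0%N.
- exists (K + K')%N; rewrite iter_linearD iter_linearZ.
  rewrite (iter_ge0 _ IHu) ?leq_addr // (iter_ge0 _ IHw) ?leq_addl //.
  by rewrite scaler0 addr0.
exists (K + (row_height p i + col_height p j).+1)%N; exact: nilpotent_X.
Qed.

(** Raising more than [|deg nu|] times leads to positive degree, where the weight spaces are
    zero. *)
Lemma raise_nilpotent p nu u : (p < N)%N -> wsp nu u ->
  exists K, iter K (X p%:Z p.+1%:Z) u = 0.
Proof.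
move=> pN ws; exists `|deg nu|.+1.
have : wsp (nu + alpha N p *~ `|deg nu|.+1%:Z) (iter `|deg nu|.+1 (X p%:Z p.+1%:Z) u).
  elim: `|deg nu|.+1 => [|K IH]; first by rewrite mulr0z addr0.
  rewrite intS mulrzDr mulr1z [alpha _ _ + _]addrC addrA; apply: wsp_X => //; lia.
case/wsp_cone => // /cone_deg; rewrite degD.
have -> : deg (alpha N p *~ `|deg nu|.+1%:Z) = `|deg nu|.+1%:Z.
  by rewrite -pmulrn degMn deg_alpha // natz.
lia.
Qed.

Variable fr : forall nu, frame (wsp nu).
Local Notation m nu := (frame_dim (fr nu)).

(* <Lambda, alpha_p^vee> *)
Variable lev : nat -> int.
Hypothesis levE : forall p, (p < N)%N -> pair_coroot p B = 2 * lev p.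

Lemma iter_linear_ex (f : {linear V -> V}) K :
  exists T : {linear V -> V}, forall u, T u = iter K f u.
Proof.
elim: K => [|K [T TE]]; first by exists idfun.
by exists (f \o T : {linear V -> V}) => u /=; rewrite TE.
Qed.

Lemma pair_coroot_alpha p : (p < N)%N -> pair_coroot p (alpha N p) = 2.
Proof.
move=> pN; have := ip_alpha_alpha pN; rewrite ip_alpha // /pair_coroot => ->.
by case: ifP.
Qed.

Lemma pair_corootZ p mu (t : int) : pair_coroot p (mu *~ t) = pair_coroot p mu * t.
Proof. by rewrite /pair_coroot !crdZ; ring. Qed.

(** Weyl invariance of the multiplicities: with [c mu] the pairing of Lambda + mu with the coroot,
    the [|c mu|]-th power of the lowering operator, or of the raising one if [c mu < 0], is
    injective on the weight space. *)
Lemma frame_dim_srefl p nu : (p < N)%N ->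
  m (srefl p nu - alpha N p *~ lev p) = m nu.
Proof.
move=> pN.
(* The coroot of the short simple root carries a factor 2; it is put into the lowering operator. *)
pose s : F := if p == 0%N then 2 else 1.
have s0 : s != 0 by rewrite /s; case: ifP; rewrite ?pnatr_eq0 ?oner_eq0.
pose E := X p%:Z p.+1%:Z; pose G : {linear V -> V} := s \*: X p.+1%:Z p%:Z.
pose S mu (t : int) := wsp (mu + alpha N p *~ t).
pose c mu := pair_coroot p mu + lev p.
have p1N : (`|p.+1%:Z| <= N)%N by [].
have pN' : (`|p%:Z| <= N)%N by apply: ltnW.
have SE mu t u : S mu t u -> S mu (t + 1) (E u).
  by rewrite /S mulrzDr mulr1z addrA; apply: wsp_X.
have SG mu t u : S mu t u -> S mu (t - 1) (G u).
  rewrite /S mulrzDr mulrN1z addrA /alpha opprB => ws; apply: subZ; first exact: wsp_sub.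
  exact: wsp_X.
have EG mu t u : S mu t u -> E (G u) - G (E u) = (c mu + 2 * t)%:~R *: u.
  move=> ws; rewrite [G _]/= [G (E u)]/= linearZ /= -scalerBr Xbr !eqxx.
  rewrite (_ : (_ == - p%:Z) = false); last by lia.
  rewrite (_ : (_ == - p.+1%:Z) = false); last by lia.
  rewrite !scale0r !scale1r subr0 addr0 (wsp_diag pN' ws) (wsp_diag p1N ws).
  rewrite -scalerBl opprK scalerA; congr (_ *: _).
  have PF x : (pair_coroot p x)%:~R = ((crd x p.+1%:Z)%:~R - (crd x p%:Z)%:~R) * s :> F.
    by rewrite /pair_coroot /s intrM intrB; case: ifP.
  have -> : c mu + 2 * t = lev p + pair_coroot p (mu + alpha N p *~ t).
    by rewrite pair_corootD pair_corootZ pair_coroot_alpha // /c; ring.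
  have LF : (lev p)%:~R = ((crd B p.+1%:Z)%:~R - (crd B p%:Z)%:~R) * s / 2 :> F.
    by rewrite -PF levE // intrM mulrC mulKf // pnatr_eq0.
  by rewrite intrD LF PF /wval; field.
have Enil mu u : wsp mu u -> exists K, iter K E u = 0 by apply: raise_nilpotent.
have Gnil mu u : wsp mu u -> exists K, iter K G u = 0.
  move=> /(lower_nilpotent pN) [K fu]; exists K.
  suff -> : iter K G u = s ^+ K *: iter K (X p.+1%:Z p%:Z) u by rewrite fu scaler0.
  elim: K {fu} => [|K IH]; first by rewrite scale1r.
  by rewrite iterS IH /= linearZ /= scalerA -exprS.
have S0 mu u : S mu 0 u = wsp mu u by rewrite /S mulr0z addr0.
have iterSG mu K u : wsp mu u -> S mu (- K%:Z) (iter K G u).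
  elim: K u => [|K IH] u ws; first by rewrite oppr0 S0.
  by rewrite /= intS opprD addrC; apply/SG/IH.
have iterSE mu K u : wsp mu u -> S mu K%:Z (iter K E u).
  elim: K u => [|K IH] u ws; first by rewrite S0.
  by rewrite /= intS addrC; apply/SE/IH.
have le mu : (m mu <= m (mu - alpha N p *~ c mu)%R)%N.
  case: (leP 0 (c mu)) => c0.
    have [T TE] := iter_linear_ex G `|c mu|%N.
    apply: (@frame_dim_le _ _ _ _ _ _ T) => [|u ws|u ws]; first exact: wsp_sub.
      by have := iterSG mu `|c mu|%N u ws; rewrite gez0_abs // /S mulrNz TE.
    rewrite TE; apply: (@sl2_lower_inj _ _ E G (S mu) (c mu)) => //.
    - by move=> t; apply: wsp_sub.
    - exact: SE.
    - exact: SG.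
    - exact: EG.
    - by move=> w; rewrite S0; apply: Enil.
    - by rewrite S0.
  have [T TE] := iter_linear_ex E `|- c mu|%N.
  apply: (@frame_dim_le _ _ _ _ _ _ T) => [|u ws|u ws]; first exact: wsp_sub.
    have := iterSE mu `|- c mu|%N u ws.
    by rewrite gez0_abs ?oppr_ge0 ?ltW // /S mulrNz TE.
  rewrite TE; apply: (@sl2_lower_inj _ _ G E (fun t => S mu (- t)) (- c mu)) => //.
  - by move=> t; apply: wsp_sub.
  - by move=> t w; rewrite opprD; apply: SG.
  - by move=> t w; rewrite opprB addrC; apply: SE.
  - move=> t w wt; rewrite -opprB (EG _ _ _ wt) -scaleNr -rmorphN; congr (_%:~R *: _).
    by ring.
  - by rewrite oppr_ge0 ltW.
  - by move=> w; rewrite oppr0 S0; apply: Gnil.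
  - by rewrite oppr0 S0.
have -> : srefl p nu - alpha N p *~ lev p = nu - alpha N p *~ c nu.
  by rewrite /srefl /c mulrzDr opprD addrA.
(* The reverse inequality is [le] at the reflected weight, since the reflection is an involution. *)
apply/eqP; rewrite eqn_leq le andbT; set mu := nu - _.
have -> : nu = mu - alpha N p *~ c mu.
  have -> : c mu = - c nu.
    rewrite /c /mu -mulrNz pair_corootD pair_corootZ pair_coroot_alpha // /c; ring.
  by rewrite mulrNz opprK /mu subrK.
exact: le.
Qed.

Lemma wsp_lower_iter p n : (p < N)%N ->
  wsp (- (alpha N p *~ n%:Z)) (iter n (X p.+1%:Z p%:Z) v).
Proof.
move=> pN; elim: n => [|n IH]; first by rewrite mulr0z oppr0; apply: wsp_v.
rewrite iterS intS mulrzDr mulr1z opprD addrC /alpha opprB.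
by apply: wsp_X => //; apply: ltnW.
Qed.

(** For [n = lev p] the coefficient vanishes: the raising operator kills the power [lev p + 1] of
    the lowering operator on [v]. This will give the nilpotency assumed in [Xnil]. *)
Lemma raise_lower_iter p n : (p < N)%N ->
  (if p == 0%N then 2 else 1) *: X p%:Z p.+1%:Z (iter n.+1 (X p.+1%:Z p%:Z) v) =
  (n.+1%:Z * (lev p - n%:Z))%:~R *: iter n (X p.+1%:Z p%:Z) v.
Proof.
move=> pN; set s : F := if p == 0%N then 2 else 1.
have p1N : (`|p.+1%:Z| <= N)%N by [].
have pN' : (`|p%:Z| <= N)%N by apply: ltnW.
have br (k : nat) u : wsp (- (alpha N p *~ k%:Z)) u -> s *: X p%:Z p.+1%:Z (X p.+1%:Z p%:Z u) =
   s *: X p.+1%:Z p%:Z (X p%:Z p.+1%:Z u) + (lev p - 2 * k%:Z)%:~R *: u.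
  move=> ws; rewrite Xcomm !eqxx scalerDr; congr (_ + _).
  rewrite (_ : (_ == - p%:Z) = false); last by lia.
  rewrite (_ : (_ == - p.+1%:Z) = false); last by lia.
  rewrite !scale0r !scale1r subr0 addr0 (wsp_diag pN' ws) (wsp_diag p1N ws).
  rewrite -scalerBl opprK scalerA; congr (_ *: _).
  have PF x : (pair_coroot p x)%:~R = ((crd x p.+1%:Z)%:~R - (crd x p%:Z)%:~R) * s :> F.
    by rewrite /pair_coroot /s intrM intrB; case: ifP.
  have -> : lev p - 2 * k%:Z = lev p + pair_coroot p (- (alpha N p *~ k%:Z)).
    by rewrite -mulrNz pair_corootZ pair_coroot_alpha //; ring.
  have LF : (lev p)%:~R = ((crd B p.+1%:Z)%:~R - (crd B p%:Z)%:~R) * s / 2 :> F.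
    by rewrite -PF levE // intrM mulrC mulKf // pnatr_eq0.
  by rewrite intrD LF PF /wval; field.
elim: n => [|n IH].
  rewrite /= (br 0%N); last by rewrite mulr0z oppr0; apply: wsp_v.
  have e0 : X p%:Z p.+1%:Z v = 0 by apply: Xpos; lia.
  by rewrite e0 (linear0 (X _ _)) scaler0 add0r mulr0 mul1r.
rewrite [iter n.+2 _ _]/= -/(iter n.+1 _ _) (br n.+1); last exact: wsp_lower_iter.
rewrite -linearZ /= -/(iter n.+1 _ _) IH linearZ /= -/(iter n.+1 _ _) -scalerDl.
congr (_ *: _); rewrite -intrD; congr (_%:~R); rewrite !intS; ring.
Qed.

Definition lowering : seq (int * int) :=
  [seq ij <- [seq (i, j) | i <- sseq N, j <- sseq N] | ij.2 < ij.1].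

Fixpoint words n : seq (lattice * V) :=
  if n is n'.+1 then
    [seq (x.1 + (dlt N ij.2 - dlt N ij.1), X ij.1 ij.2 x.2) | ij <- lowering, x <- words n']
  else [:: (0, v)].

Definition words_below M nu : seq V :=
  [seq x.2 | x <- flatten [seq words n | n <- iota 0 M] & x.1 == nu].

Lemma mem_lowering i j : ((i, j) \in lowering) = [&& j < i, (`|i| <= N)%N & (`|j| <= N)%N].
Proof.
rewrite mem_filter /=; congr (_ && _); apply/allpairsP/andP => [[[i' j'] /= []]|[iN jN]].
  by rewrite !mem_sseq => ? ? [-> ->].
by exists (i, j); rewrite !mem_sseq.
Qed.

Lemma words_wsp n x : x \in words n -> wsp x.1 x.2.
Proof.
elim: n x => [|n IH] x /=; first by rewrite inE => /eqP->; apply: wsp_v.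
case/allpairsP => -[[i j] y] [/=]; rewrite mem_lowering => /and3P[ji iN jN] /IH yw ->.
exact: wsp_act.
Qed.

Lemma words_belowP M nu w : w \in words_below M nu <->
  exists n, (n < M)%N /\ (nu, w) \in words n.
Proof.
split=> [/mapP [[mu x]]|[n [nM wn]]].
  rewrite mem_filter /= => /andP[/eqP-> /flattenP [s /mapP [n]]].
  by rewrite mem_iota add0n => nM -> xs ->; exists n.
apply/mapP; exists (nu, w) => //; rewrite mem_filter /= eqxx.
by apply/flattenP; exists (words n) => //; apply: map_f; rewrite mem_iota add0n.
Qed.

(** Each lowering operator decreases the degree by at least 1, so only words of length at most
    [- deg nu] matter; in particular weight spaces are finite-dimensional. *)
Lemma wsp_words nu u M : wsp nu u -> - deg nu < M%:Z -> spans (words_below M nu) u.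
Proof.
move=> ws; elim: ws M => [|nu'|nu' a u' w' _ IHu _ IHw|nu' i j u' iN jN ij ws IH] M hM.
- apply: spans_mem; apply/words_belowP; exists 0%N; split; last by rewrite /= inE.
  by move: hM; rewrite deg0; lia.
- by have [] := spans_subspace (words_below M nu').
- by have [_ L] := spans_subspace (words_below M nu'); apply: L; [apply: IHu|apply: IHw].
case: (wsp_cone ws) => [->|/cone_deg c].
  by rewrite linear0; have [] := spans_subspace (words_below M (nu' + (dlt N j - dlt N i))).
case: M hM => [|M] hM; first by move: hM; rewrite degD degD degN !deg_dlt //; lia.
have [c' ->] : spans (words_below M nu') u'.
  by apply: IH; move: hM; rewrite degD degD degN !deg_dlt //; lia.
rewrite linear_sum; apply: sub_sum; first exact: spans_subspace.
move=> k _; rewrite linearZ /=; apply: subZ; first exact: spans_subspace.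
apply: spans_mem; apply/words_belowP.
have /words_belowP [n [nM nw]] := mem_nth 0 (ltn_ord k).
exists n.+1; split=> //=; apply/allpairsP; exists ((i, j), (nu', (words_below M nu')`_k)).
by rewrite mem_lowering ij iN jN.
Qed.

Lemma wsp_frame nu : inhabited (frame (wsp nu)).
Proof.
apply: (@frame_of_spans _ _ _ (words_below `|deg nu|.+1 nu)).
- exact: wsp_sub.
- by move=> u /words_belowP [n [_ /words_wsp]].
- by move=> u ws; apply: wsp_words => //; lia.
Qed.

Lemma frame_dim0 : v != 0 -> m 0 = 1%N.
Proof.
move=> v0.
have wsp0 u : wsp 0 u -> exists a, u = a *: v.
  move=> /(wsp_words (M := 1)); rewrite deg0 => /(_ isT) [c ->].
  pose L : set V := [set u | exists a, u = a *: v]%classic.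
  have S : subspace L.
    split; first by exists 0; rewrite scale0r.
    by move=> a u1 u2 [b ->] [b' ->]; exists (a * b + b'); rewrite scalerDl scalerA.
  apply: (@sub_sum _ _ L) => // i _; apply: (@subZ _ _ L) => //.
  have /words_belowP [n [n1 nw]] := mem_nth 0 (ltn_ord i).
  case: n n1 nw => // _; rewrite inE => /eqP [->]; exists 1; by rewrite scale1r.
have free1 : free_seq [:: v].
  move=> c; rewrite big_ord_recl big_ord0 /= addr0 => /eqP.
  by rewrite scaler_eq0 (negPf v0) orbF => /eqP c0 [|i].
have co u : exists c : nat -> F, wsp 0 u -> u = \sum_(i < 1) c i *: [:: v]`_i.
  case: (pselect (wsp 0 u)) => [/wsp0 [a ->]|]; last by exists (fun=> 0).
  by exists (fun=> a); rewrite big_ord_recl big_ord0 addr0.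
have mem1 n : (n < 1)%N -> wsp 0 [:: v]`_n by case: n => // _; apply: wsp_v.
pose f : frame (wsp 0) := @Frame _ _ (wsp 0) [:: v] (fun u => sval (cid (co u))) free1
  mem1 (fun u => svalP (cid (co u))).
apply/eqP; rewrite eqn_leq.
rewrite (@frame_dim_le _ _ _ _ (fr 0) f idfun) //; last exact: wsp_sub.
by rewrite (@frame_dim_le _ _ _ _ f (fr 0) idfun) //; apply: wsp_sub.
Qed.

(** Distinct weights differ at some coordinate k; [X k k] plus the value [wval] of the first weight
    kills its term and multiplies each other term by a scalar that is nonzero for the weight under
    consideration. *)
Lemma wsp_free (s : seq lattice) (f : lattice -> V) : uniq s ->
  (forall nu, wsp nu (f nu)) -> \sum_(nu <- s) f nu = 0 -> forall nu, nu \in s -> f nu = 0.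
Proof.
elim: s f => // mu s IH f /= /andP[mus us] fw; rewrite big_cons => f0.
have fs nu : nu \in s -> f nu = 0.
  move=> nus; have numu : nu != mu by apply: contraNneq mus => <-.
  have /eqP/ffunP/existsNP [k /eqP nk] := numu.
  have kN : (`|k.+1%:Z| <= N)%N by apply: ltn_ord.
  have := IH (fun nu => (wval k.+1%:Z mu - wval k.+1%:Z nu) *: f nu) us.
  move=> /(_ (fun nu => subZ _ (wsp_sub nu) (fw nu))) /(_ _ nu nus).
  have E : \sum_(nu <- s) (wval k.+1%:Z mu - wval k.+1%:Z nu) *: f nu = 0.
    have := congr1 (fun x => X k.+1%:Z k.+1%:Z x + wval k.+1%:Z mu *: x) f0.
    rewrite linear0 scaler0 addr0 linearD linear_sum (wsp_diag kN (fw mu)) scalerDr.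
    rewrite addrACA -scalerDl addNr scale0r add0r scaler_sumr -big_split /=.
    move=> H; rewrite -[RHS]H; apply: eq_bigr => nu' _; rewrite (wsp_diag kN (fw nu')) -scalerDl.
    by rewrite addrC.
  move=> /(_ E) /eqP; rewrite scaler_eq0 => /orP[|/eqP //].
  rewrite /wval opprD addrACA subrr add0r subr_eq0 eqr_int !crd_ord => /eqP E'.
  by rewrite E' eqxx in nk.
move=> nu; rewrite inE => /orP[/eqP->|/fs //].
by move: f0; rewrite big_seq big1 ?addr0.
Qed.

Inductive degree_part (t : int) : V -> Prop :=
| degree_part_in nu u : deg nu = - t -> wsp nu u -> degree_part t u
| degree_part_0 : degree_part t 0
| degree_part_lin a u w : degree_part t u -> degree_part t w -> degree_part t (a *: u + w).

Lemma degree_part_sub t : subspace (degree_part t).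
Proof. by split; [apply: degree_part_0 | move=> *; apply: degree_part_lin]. Qed.

Lemma degree_part_X i j t u : (`|i| <= N)%N -> (`|j| <= N)%N ->
  degree_part t u -> degree_part (t - (j - i)) (X i j u).
Proof.
move=> iN jN; elim=> [nu u' nut ws||a u' w' _ IHu _ IHw].
- apply: (degree_part_in (nu := nu + (dlt N j - dlt N i))); last exact: wsp_X.
  by rewrite !degD degN !deg_dlt // nut; ring.
- by rewrite linear0; apply: degree_part_0.
- by rewrite linearP; apply: degree_part_lin.
Qed.

Lemma frame_dim_cone nu : (0 < m nu)%N -> cone nu.
Proof.
move=> m0; case: (wsp_cone (frame_mem (fr nu) m0)) => // b0; exfalso.
have := frame_free (fr nu) (c := fun n => (n == 0%N)%:R) _ m0.
rewrite big1 => [|i _]; last first.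
  by case: eqP => [->|_]; rewrite ?b0 ?scaler0 ?scale0r.
by move=> /(_ erefl) /eqP; rewrite oner_eq0.
Qed.

Lemma degree_part_dim J : exists d, has_dim (degree_part J%:Z) d /\
  fcoef (spec (@deg N) (fun nu => (m nu)%:R : rat)) J = d%:R.
Proof.
have fin : finite_set [set nu : lattice | deg nu = - J%:Z /\ (m nu)%:R != 0 :> rat]%classic.
  apply: (@cone_level_finite N rat (fun nu => (m nu)%:R)) => nu.
  by rewrite pnatr_eq0 -lt0n; apply: frame_dim_cone.
have /finite_seqP [s0 s0E] := fin; pose s := undup s0.
have us : uniq s by apply: undup_uniq.
have sP nu : nu \in s <-> deg nu = - J%:Z /\ m nu != 0%N.
  rewrite mem_undup -(pnatr_eq0 rat).
  by have /(congr1 (fun A => A nu)) /= -> := s0E.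
pose W (t : seq lattice) : set V := [set u | exists f : lattice -> V,
   (forall nu, wsp nu (f nu)) /\ u = \sum_(nu <- t) f nu]%classic.
have Wsub t : subspace (W t).
  split; first by exists (fun=> 0); split; [move=> nu; apply: wsp_0|rewrite big1].
  move=> a u w [f [fw ->]] [g [gw ->]]; exists (fun nu => a *: f nu + g nu).
  split; first by move=> nu; apply: wsp_lin.
  by rewrite scaler_sumr -big_split.
have Wfr t : uniq t -> exists f : frame (W t), frame_dim f = (\sum_(nu <- t) m nu)%N.
  elim: t => [_|mu t IH /= /andP[mut ut]].
    have f0 : free_seq ([::] : seq V) by [].
    have fm n : (n < size ([::] : seq V))%N -> W [::] ([::] : seq V)`_n by [].
    have fc u : W [::] u -> u = \sum_(i < size ([::] : seq V)) (0 : F) *: [::]`_i.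
      by move=> [f [_ ->]]; rewrite big_nil big_ord0.
    exists (@Frame _ _ (W [::]) [::] (fun _ _ => 0) f0 fm fc).
    by rewrite big_nil.
  have [f fd] := IH ut.
  rewrite big_cons -fd; apply: frame_add.
  - exact: wsp_sub.
  - exact: Wsub.
  - move=> u1 u2 w1 [g [gw ->]] h.
    have := @wsp_free (mu :: t) (fun nu => if nu == mu then u1 else g nu).
    move=> /(_ _ _ _ mu (mem_head _ _)); rewrite eqxx; apply; rewrite /= ?mut //.
      by move=> nu; case: eqP => [->|].
    rewrite big_cons eqxx -[RHS]h; congr (_ + _); rewrite !big_seq.
    by apply: eq_bigr => nu nut; case: eqP => // numu; rewrite -numu nut in mut.
  - move=> u; split=> [[g [gw ->]]|[u1 [u2 [w1 [g [gw ->]] ->]]]].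
      rewrite big_cons; exists (g mu), (\sum_(nu <- t) g nu); split=> //.
      by exists g.
    exists (fun nu => if nu == mu then u1 else g nu); split.
      by move=> nu; case: eqP => [->|].
    rewrite big_cons eqxx; congr (_ + _); rewrite !big_seq.
    by apply: eq_bigr => nu nut; case: eqP => // numu; rewrite -numu nut in mut.
have dWE : degree_part J%:Z = W s.
  apply/seteqP; split=> u; last first.
    move=> [f [fw ->]]; rewrite big_seq; apply: sub_sum => [|nu /sP [nuJ _]].
      exact: degree_part_sub.
    exact: degree_part_in (fw nu).
  elim=> [nu u' nuJ ws||a u1 u2 _ IH1 _ IH2]; [|exact: (Wsub s).1|exact: (Wsub s).2].
  case: (eqVneq (m nu) 0%N) => m0.
    have -> : u' = 0.
      rewrite (frame_coord (fr nu) ws).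
      by rewrite -/(frame_dim (fr nu)) m0 big_ord0.
    exact: (Wsub s).1.
  have nus : nu \in s by apply/sP.
  exists (fun mu => if mu == nu then u' else 0); split.
    by move=> mu; case: eqP => [->|_]; [|apply: wsp_0].
  by rewrite (bigD1_seq nu) //= eqxx big1 ?addr0 // => mu /negPf->.
have [f fd] := Wfr s us; exists (frame_dim f); split.
  by rewrite dWE; apply: frame_has_dim.
rewrite fd natr_sum /= /level_sum (@fsbigE _ _ _ _ _ s) //.
- by rewrite big_seq_cond [RHS]big_seq_cond; apply: eq_bigl => nu;
     case: (boolP (nu \in s)) => //= /sP [nuJ _]; rewrite mem_set.
- by move=> nu /= /sP [].
move=> nu /= nuJ; apply: contraNeq => m0; apply/sP; split=> //.
by move: m0; rewrite pnatr_eq0.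
Qed.

Lemma sum_pick n (G : int -> V) i : (`|i| <= n)%N ->
  \sum_(j <- sseq n) (i == j)%:R *: G j = G i.
Proof.
move=> iN; rewrite (bigD1_seq i) ?mem_sseq ?uniq_sseq //= eqxx scale1r.
by rewrite big1 ?addr0 // => j; rewrite eq_sym => /negPf->; rewrite scale0r.
Qed.

Lemma sum_pickN n (G : int -> V) i : (`|i| <= n)%N ->
  \sum_(j <- sseq n) (j == - i)%:R *: G j = G (- i).
Proof.
by move=> iN; under eq_bigr do rewrite eq_sym; apply: sum_pick; rewrite abszN.
Qed.

Definition casimir u : V := \sum_(i <- sseq N) \sum_(j <- sseq N) X i j (X j i u).

(** The brackets produce eight double sums, each collapsing to a single one; they cancel in the
    pairs t1, t6; t2, t5; t3, t8; t4, t7. *)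
Lemma casimir_comm k l u : (`|k| <= N)%N -> (`|l| <= N)%N ->
  X k l (casimir u) = casimir (X k l u).
Proof.
move=> kN lN; apply/eqP; rewrite -subr_eq0 /casimir linear_sum -sumrB; apply/eqP.
pose t1 i j := (l == i)%:R *: X k j (X j i u).
pose t2 i j := (j == k)%:R *: X i l (X j i u).
pose t3 i j := (i == - k)%:R *: X (- l) j (X j i u).
pose t4 i j := (j == - l)%:R *: X i (- k) (X j i u).
pose t5 i j := (l == j)%:R *: X i j (X k i u).
pose t6 i j := (i == k)%:R *: X i j (X j l u).
pose t7 i j := (j == - k)%:R *: X i j (X (- l) i u).
pose t8 i j := (i == - l)%:R *: X i j (X j (- k) u).
have E i : X k l (\sum_(j <- sseq N) X i j (X j i u)) -
    \sum_(j <- sseq N) X i j (X j i (X k l u)) =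
    \sum_(j <- sseq N) (t1 i j - t2 i j - t3 i j + t4 i j +
                        (t5 i j - t6 i j - t7 i j + t8 i j)).
  rewrite linear_sum -sumrB; apply: eq_bigr => j _; rewrite Xcomm.
  have zm (x y z : V) : x + y + z - x = z + y by rewrite addrC addrA addKr addrC.
  rewrite (Xcomm k l j i) linearD zm; congr (_ + _).
  by rewrite linearD !linearB !linearZ.
under eq_bigr do rewrite E.
under eq_bigr do rewrite !big_split /= !sumrN.
rewrite !big_split /= !sumrN.
have -> : \sum_(i <- sseq N) \sum_(j <- sseq N) t1 i j = \sum_(j <- sseq N) X k j (X j l u).
  by rewrite exchange_big; apply: eq_bigr => j _; apply: (sum_pick (fun i => X k j (X j i u))).
have -> : \sum_(i <- sseq N) \sum_(j <- sseq N) t2 i j = \sum_(i <- sseq N) X i l (X k i u).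
  apply: eq_bigr => i _; rewrite -(sum_pick (fun j => X i l (X j i u)) kN).
  by apply: eq_bigr => j _; rewrite eq_sym.
have -> : \sum_(i <- sseq N) \sum_(j <- sseq N) t3 i j = \sum_(j <- sseq N) X (- l) j (X j (- k) u).
  by rewrite exchange_big; apply: eq_bigr => j _; apply: (sum_pickN (fun i => X (- l) j (X j i u))).
have -> : \sum_(i <- sseq N) \sum_(j <- sseq N) t4 i j = \sum_(i <- sseq N) X i (- k) (X (- l) i u).
  by apply: eq_bigr => i _; apply: (sum_pickN (fun j => X i (- k) (X j i u))).
have -> : \sum_(i <- sseq N) \sum_(j <- sseq N) t5 i j = \sum_(i <- sseq N) X i l (X k i u).
  by apply: eq_bigr => i _; apply: (sum_pick (fun j => X i j (X k i u))).
have -> : \sum_(i <- sseq N) \sum_(j <- sseq N) t6 i j = \sum_(j <- sseq N) X k j (X j l u).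
  rewrite exchange_big; apply: eq_bigr => j _; rewrite -(sum_pick (fun i => X i j (X j l u)) kN).
  by apply: eq_bigr => i _; rewrite eq_sym.
have -> : \sum_(i <- sseq N) \sum_(j <- sseq N) t7 i j = \sum_(i <- sseq N) X i (- k) (X (- l) i u).
  by apply: eq_bigr => i _; apply: (sum_pickN (fun j => X i j (X (- l) i u))).
have -> : \sum_(i <- sseq N) \sum_(j <- sseq N) t8 i j = \sum_(j <- sseq N) X (- l) j (X j (- k) u).
  by rewrite exchange_big; apply: eq_bigr => j _; apply: (sum_pickN (fun i => X i j (X j (- k) u))).
move: (\sum_(j <- _) X k j _) (\sum_(i <- _) X i l _) (\sum_(j <- _) X (- l) j _)
  (\sum_(i <- _) X i (- k) _) => x y z t.
have -> : y - x - t + z = - (x - y - z + t).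
  by rewrite !opprD !opprK [- x + y]addrC -!addrA; congr (_ + (_ + _)); apply: addrC.
by rewrite subrr.
Qed.

Lemma sum_sseqN n (g : int -> V) : \sum_(j <- sseq n) g (- j) = \sum_(j <- sseq n) g j.
Proof.
elim: n => [|n IH] /=; first by rewrite !big_seq1 oppr0.
by rewrite !big_cons IH opprK !addrA [g _ + g _]addrC.
Qed.

Lemma sum_sseq_odd (Z : zmodType) n (g : int -> Z) : g 0 = 0 -> (forall j, g (- j) = - g j) ->
  \sum_(j <- sseq n) g j = 0.
Proof.
move=> g0 gN; elim: n => [|n IH] /=; first by rewrite big_seq1.
by rewrite !big_cons IH gN addr0 subrr.
Qed.

Lemma sum_pos_pairs (Z : zmodType) n (g : int * int -> Z) :
  \sum_(ij <- pos_pairs n) g ij = \sum_(m < n) \sum_(i <- sseq m) g (i, m.+1%:Z).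
Proof.
rewrite /pos_pairs big_allpairs_dep /=.
by rewrite -[n in iota 0 n]subn0 -/(index_iota 0 n) big_mkord.
Qed.

(** The involution (i, j) |-> (- j, - i) of the square fixes only the antidiagonal, where [G]
    vanishes; [S] takes one element of each remaining orbit. *)
Lemma sum_square_sym n (G : int -> int -> V) :
  (forall i j, G (- j) (- i) = G i j) -> (forall i, G i (- i) = 0) ->
  let S := \sum_(m < n) G m.+1%:Z m.+1%:Z + \sum_(ij <- pos_pairs n) (G ij.1 ij.2 + G ij.2 ij.1) in
  \sum_(i <- sseq n) \sum_(j <- sseq n) G i j = S + S.
Proof.
move=> GN G0 /=; rewrite sum_pos_pairs.
elim: n => [|n IH] /=.
  by rewrite !big_ord0 !big_seq1 -[X in G _ X]oppr0 G0 !addr0.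
have H i : \sum_(j <- [:: n.+1%:Z, - n.+1%:Z & sseq n]) G i j =
   G i n.+1%:Z + (G i (- n.+1%:Z) + \sum_(j <- sseq n) G i j) by rewrite !big_cons.
rewrite (eq_bigr _ (fun i _ => H i)) !big_cons !big_split /= IH !big_ord_recr /= big_split /=.
have -> : G n.+1%:Z (- n.+1%:Z) = 0 by apply: G0.
have -> : G (- n.+1%:Z) n.+1%:Z = 0 by rewrite -[X in G _ X]opprK G0.
have -> : G (- n.+1%:Z) (- n.+1%:Z) = G n.+1%:Z n.+1%:Z by apply: GN.
have -> : \sum_(j <- sseq n) G (- n.+1%:Z) j = \sum_(j <- sseq n) G j n.+1%:Z.
  by rewrite -[RHS]sum_sseqN; apply: eq_bigr => j _; rewrite -(GN _ n.+1%:Z) opprK.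
have -> : \sum_(j <- sseq n) G j (- n.+1%:Z) = \sum_(j <- sseq n) G n.+1%:Z j.
  by rewrite -[RHS]sum_sseqN; apply: eq_bigr => j _; rewrite -(GN n.+1%:Z) opprK.
move: (\sum_(j <- sseq n) G j _) (\sum_(j <- sseq n) G _ j) => a b.
move: (\sum_(i < n) \sum_(k <- _) _) (\sum_(i < n) G _ _) (G n.+1%:Z _) => d c g.
rewrite !add0r !addrA.
by rewrite [LHS](ACl (7*1*8*4*2*9*3*10*5*6)).
Qed.

Lemma XNN i j u : X i (- j) u = - X j (- i) u.
Proof. by rewrite -XN opprK. Qed.

Lemma X_antidiag i u : X i (- i) u = 0.
Proof.
have /eqP := XNN i i u; rewrite -subr_eq0 opprK -mulr2n -scaler_nat.
by rewrite scaler_eq0 pnatr_eq0 => /eqP.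
Qed.

Definition half_casimir u : V :=
  \sum_(k < N) X k.+1%:Z k.+1%:Z (X k.+1%:Z k.+1%:Z u) +
  \sum_(ij <- pos_pairs N) (X ij.1 ij.2 (X ij.2 ij.1 u) + X ij.2 ij.1 (X ij.1 ij.2 u)).

Lemma casimirE u : casimir u = half_casimir u + half_casimir u.
Proof.
apply: (@sum_square_sym N (fun i j => X i j (X j i u))) => [i j|i].
  by rewrite !XN linearN opprK.
by rewrite X_antidiag.
Qed.

Lemma pos_pairsP (ij : int * int) : ij \in pos_pairs N ->
  [/\ `|ij.1|%:Z < ij.2, (`|ij.1| <= N)%N & (`|ij.2| <= N)%N].
Proof.
by case: ij => i j; rewrite mem_pos_pairs /= => /andP[h1 h2]; split; lia.
Qed.

Lemma pos_pair_br (ij : int * int) nu u : ij \in pos_pairs N -> wsp nu u ->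
  X ij.1 ij.2 (X ij.2 ij.1 u) = X ij.2 ij.1 (X ij.1 ij.2 u) + (wval ij.2 nu - wval ij.1 nu) *: u.
Proof.
case: ij => i j /pos_pairsP /= [ij iN jN] ws; rewrite Xcomm !eqxx.
rewrite (_ : (j == - i) = false); last by lia.
rewrite (_ : (i == - j) = false); last by lia.
rewrite !scale0r !scale1r subr0 addr0 (wsp_diag iN ws) (wsp_diag jN ws).
by congr (_ + _); rewrite -scalerBl opprK addrC.
Qed.

(** (Lambda + nu, Lambda + nu + 2 rho): the value of [half_casimir] on a vector of weight Lambda +
    nu killed by all raising operators. *)
Definition kappa nu : F :=
  \sum_(k < N) wval k.+1%:Z nu ^+ 2 + \sum_(ij <- pos_pairs N) (wval ij.2 nu - wval ij.1 nu).

Lemma half_casimir_v : half_casimir v = kappa 0 *: v.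
Proof.
rewrite /half_casimir /kappa scalerDl !scaler_suml; congr (_ + _).
  apply: eq_bigr => k _; have kN : (`|k.+1%:Z| <= N)%N by apply: ltn_ord.
  by rewrite !(wsp_diag kN wsp_v) linearZ /= (wsp_diag kN wsp_v) scalerA mulrNN expr2.
rewrite !big_seq; apply: eq_bigr => ij ijP; rewrite (pos_pair_br ijP wsp_v).
have [h _ _] := pos_pairsP ijP.
by rewrite Xpos ?linear0 ?add0r ?addr0 //; lia.
Qed.

Lemma casimir_linear a u w : casimir (a *: u + w) = a *: casimir u + casimir w.
Proof.
rewrite /casimir scaler_sumr -big_split; apply: eq_bigr => i _.
by rewrite scaler_sumr -big_split; apply: eq_bigr => j _; rewrite !linearP.
Qed.

Lemma half_casimir_wsp nu u : wsp nu u -> half_casimir u = kappa 0 *: u.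
Proof.
move=> ws; suff H : casimir u = (kappa 0 *+ 2) *: u.
  have : half_casimir u *+ 2 = (kappa 0 *: u) *+ 2.
    by rewrite mulr2n -casimirE H scalerMnl.
  by rewrite -!scaler_nat => /scalerI; apply; rewrite pnatr_eq0.
elim: ws => [|nu'|nu' a u' w' _ IHu _ IHw|nu' i j u' iN jN _ _ IH].
- by rewrite casimirE half_casimir_v -scalerDl -mulr2n.
- have := casimir_linear 0 0 0; rewrite scaler0 addr0 scale0r add0r.
  by rewrite {1}/casimir big1 ?scaler0 // => i _; rewrite big1 // => j _; rewrite !linear0.
- by rewrite casimir_linear IHu IHw scalerDr !scalerA mulrC.
- by rewrite -casimir_comm // IH linearZ.
Qed.

Definition ptrace (ij : int * int) nu : F :=
  ftrace (fr nu) (fun u => X ij.2 ij.1 (X ij.1 ij.2 u)).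

Lemma wsp_raise (ij : int * int) nu u : ij \in pos_pairs N -> wsp nu u ->
  wsp (nu + pair_root N ij) (X ij.1 ij.2 u).
Proof. by move=> /pos_pairsP [_ iN jN]; apply: wsp_X. Qed.

Lemma wsp_lower (ij : int * int) nu u : ij \in pos_pairs N -> wsp nu u ->
  wsp (nu - pair_root N ij) (X ij.2 ij.1 u).
Proof. by move=> /pos_pairsP [_ iN jN]; rewrite /pair_root opprB; apply: wsp_X. Qed.

Lemma wsp_raise_lower (ij : int * int) nu u : ij \in pos_pairs N -> wsp nu u ->
  wsp nu (X ij.2 ij.1 (X ij.1 ij.2 u)).
Proof.
by move=> ijP ws; rewrite -[nu](addrK (pair_root N ij)); apply/wsp_lower/wsp_raise.
Qed.

Lemma wsp_lower_raise (ij : int * int) nu u : ij \in pos_pairs N -> wsp nu u ->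
  wsp nu (X ij.1 ij.2 (X ij.2 ij.1 u)).
Proof.
by move=> ijP ws; rewrite -[nu](subrK (pair_root N ij)); apply/wsp_raise/wsp_lower.
Qed.

Lemma ptrace_br ij nu : ij \in pos_pairs N ->
  ftrace (fr nu) (fun u => X ij.1 ij.2 (X ij.2 ij.1 u)) =
  ptrace ij nu + (wval ij.2 nu - wval ij.1 nu) * (m nu)%:R.
Proof.
move=> ijP; rewrite -ftraceZ; last exact: wsp_sub.
rewrite -ftraceD; [|exact: wsp_sub| |by move=> u; apply: subZ; apply: wsp_sub].
  by apply: eq_ftrace => u ws; apply: pos_pair_br ws.
by move=> u; apply: wsp_raise_lower.
Qed.

(** By cyclicity, [ptrace ij nu] is the trace, on the space of weight nu + a, of the same two
    operators in the opposite order; their commutator is the scalar on the left. *)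
Lemma ptrace_shift ij nu : ij \in pos_pairs N ->
  (wval ij.2 (nu + pair_root N ij) - wval ij.1 (nu + pair_root N ij)) * (m (nu + pair_root N ij))%:R =
  ptrace ij nu - ptrace ij (nu + pair_root N ij).
Proof.
move=> ijP; apply/eqP; rewrite eq_sym subr_eq addrC -ptrace_br //.
rewrite /ptrace (@ftraceC _ _ _ _ (fr nu) (fr (nu + pair_root N ij)) (X ij.1 ij.2) (X ij.2 ij.1)) //.
  by move=> u; apply: wsp_raise.
by move=> u ws; rewrite -[nu](addrK (pair_root N ij)); apply: wsp_lower.
Qed.

(** Take the trace of [half_casimir], which is the scalar [kappa 0]: for each positive root, raising
    and lowering in both orders give twice [ptrace] plus a commutator, and the commutators make up
    the linear part of [kappa nu]. *)
Lemma freudenthal nu :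
  (kappa nu - kappa 0) * (m nu)%:R = - (2 * \sum_(ij <- pos_pairs N) ptrace ij nu).
Proof.
have : ftrace (fr nu) half_casimir = kappa 0 * (m nu)%:R.
  rewrite -ftraceZ; last exact: wsp_sub.
  by apply: eq_ftrace => u; apply: half_casimir_wsp.
pose S1 u := \sum_(k < N) X k.+1%:Z k.+1%:Z (X k.+1%:Z k.+1%:Z u).
(* Extended by 0 outside [pos_pairs], because [ftrace_sum] wants every member of the family to
   preserve the subspace. *)
pose t (ij : int * int) u := if ij \in pos_pairs N then
  X ij.1 ij.2 (X ij.2 ij.1 u) + X ij.2 ij.1 (X ij.1 ij.2 u) else 0.
have tE : ftrace (fr nu) half_casimir =
   ftrace (fr nu) (fun u => \sum_(k < N) (wval k.+1%:Z nu ^+ 2) *: u +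
     \sum_(ij <- pos_pairs N) t ij u).
  apply: eq_ftrace => u ws; congr (_ + _).
    apply: eq_bigr => k _; have kN : (`|k.+1%:Z| <= N)%N by apply: ltn_ord.
    by rewrite !(wsp_diag kN ws) linearZ /= (wsp_diag kN ws) scalerA mulrNN expr2.
  by rewrite !big_seq; apply: eq_bigr => ij ijP; rewrite /t ijP.
have tw ij u : wsp nu u -> wsp nu (t ij u).
  rewrite /t; case: ifP => [ijP ws|_ _]; last exact: wsp_0.
  by apply: subD; [exact: wsp_sub | exact: wsp_lower_raise | exact: wsp_raise_lower].
rewrite tE ftraceD; first last.
- by move=> u ws; apply: sub_sum => [|ij _]; [exact: wsp_sub | exact: tw].
- move=> u ws; apply: sub_sum => [|k _]; first exact: wsp_sub.
  by apply: subZ => //; apply: wsp_sub.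
- exact: wsp_sub.
rewrite !ftrace_sum; [| exact: wsp_sub | by move=> ij u; apply: tw | exact: wsp_sub
  | by move=> k u; apply: subZ; apply: wsp_sub].
have -> : \sum_(ij <- pos_pairs N) ftrace (fr nu) (t ij) =
   2 * \sum_(ij <- pos_pairs N) ptrace ij nu +
   (\sum_(ij <- pos_pairs N) (wval ij.2 nu - wval ij.1 nu)) * (m nu)%:R.
  rewrite mulr_sumr mulr_suml -big_split /= !big_seq; apply: eq_bigr => ij ijP.
  have -> : ftrace (fr nu) (t ij) = ftrace (fr nu) (fun u =>
      X ij.1 ij.2 (X ij.2 ij.1 u) + X ij.2 ij.1 (X ij.1 ij.2 u)).
    by apply: eq_ftrace => u _; rewrite /t ijP.
  rewrite ftraceD; [|exact: wsp_sub|by move=> u; apply: wsp_lower_raise|by move=> u; apply: wsp_raise_lower].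
  by rewrite ptrace_br // -/(ptrace ij nu); ring.
have -> : \sum_(k < N) ftrace (fr nu) [eta GRing.scale (wval k.+1%:Z nu ^+ 2)] =
   (\sum_(k < N) wval k.+1%:Z nu ^+ 2) * (m nu)%:R.
  by rewrite mulr_suml; apply: eq_bigr => k _; rewrite ftraceZ //; apply: wsp_sub.
rewrite mulrBl => <-; rewrite /kappa; ring.
Qed.

Lemma sum_wval nu mu : \sum_(k < N) (nu k)%:~R * wval k.+1%:Z mu =
  (ip nu B)%:~R / 2 + (ip nu mu)%:~R.
Proof.
rewrite /ip !rmorph_sum mulr_suml -big_split; apply: eq_bigr => k _ /=.
by rewrite /wval !crd_ord !intrM mulrDr mulrA.
Qed.

Lemma pair_root_wval ij nu : ij \in pos_pairs N ->
  \sum_(k < N) (pair_root N ij k)%:~R * wval k.+1%:Z nu = wval ij.2 nu - wval ij.1 nu.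
Proof.
move=> /pos_pairsP [_ iN jN]; rewrite sum_wval /pair_root !ipDl !ipNl !(ipC (dlt _ _)) !ip_dlt //.
by rewrite /wval !intrB; ring.
Qed.

(** 2 (Lambda + rho), where 2 rho = (1, 3, 5, ...). *)
Definition twice_shifted : lattice := [ffun k : 'I_N => B k + (2 * k + 1)%:Z].

Lemma size_sseq n : size (sseq n) = (2 * n + 1)%N.
Proof. by elim: n => //= n ->; lia. Qed.

(** In the sum over the pairs with [j = k + 1], the terms in [i] cancel by oddness and [2k + 1]
    copies of the coordinate remain: the pairing with 2 rho. *)
Lemma kappa_quad nu : kappa nu - kappa 0 = (quad twice_shifted nu)%:~R.
Proof.
have w0 k : wval k nu = wval k 0 + (crd nu k)%:~R.
  by rewrite /wval -[in crd 0 k](mulr0z (0 : lattice)) crdZ mulr0 addr0.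
have -> : kappa nu - kappa 0 = \sum_(k < N) (wval k.+1%:Z nu ^+ 2 - wval k.+1%:Z 0 ^+ 2) +
   (\sum_(ij <- pos_pairs N) (crd nu ij.2 - crd nu ij.1))%:~R.
  rewrite sumrB rmorph_sum /kappa opprD addrACA; congr (_ + _); rewrite -sumrB.
  by apply: eq_bigr => ij _; rewrite !w0 /= intrB; ring.
rewrite sum_pos_pairs /=.
have -> : \sum_(k < N) \sum_(i <- sseq k) (crd nu k.+1%:Z - crd nu i) =
   \sum_(k < N) (2 * k + 1)%:Z * nu k.
  apply: eq_bigr => k _; rewrite sumrB (sum_sseq_odd _ (crd0 nu) (crdN nu)) subr0.
  by rewrite big_const_seq count_predT size_sseq iter_addr_0 crd_ord -mulr_natl natz.
rewrite /quad /ip !rmorph_sum -big_split; apply: eq_bigr => k _ /=.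
by rewrite w0 /wval !crd_ord !ffunE !(intrM, intrD); field.
Qed.

(** [diffop_laplacian] with H(c, mu) = (c, Lambda + mu) m(mu) and g(c) = (c, c - 2 rho), the latter
    vanishing on the exponents of the denominator. *)
Lemma quad_diffop nu :
  (quad twice_shifted nu)%:~R * diffop (pos_roots N) (fun mu => (m mu)%:R) nu = 0 :> F.
Proof.
apply: (@diffop_laplacian _ _ _ (pair_root N) (pos_pairs N)
  (fun c mu => (\sum_(k < N) (c k)%:~R * wval k.+1%:Z mu) * (m mu)%:R) ptrace
  (fun mu => (m mu)%:R) (fun mu => (quad twice_shifted mu)%:~R)
  (fun c => (\sum_k c k * (c k - (2 * k + 1)%:Z))%:~R)).
- move=> mu a b; rewrite -mulrDl -big_split; congr (_ * _); apply: eq_bigr => k _.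
  by rewrite ffunE intrD mulrDl.
- by move=> ij mu ijP; rewrite pair_root_wval // ptrace_shift.
- move=> mu c; rewrite mulrA -!mulrDl -mulrBl; congr (_ * _).
  rewrite mulr_sumr /quad /ip !rmorph_sum -big_split -sumrB; apply: eq_bigr => k _ /=.
  by rewrite /wval !crd_ord !ffunE !(intrM, intrD, intrB); field.
- by move=> c; apply: weyl_denominator_norm.
- by move=> mu; rewrite -kappa_quad freudenthal.
Qed.

Lemma spec_frame_dim (e : int) (a : lattice) : v != 0 ->
  (forall k : 'I_N, twice_shifted k = e + 2 * a k) -> sdom twice_shifted ->
  spec (@deg N) (fun nu => (m nu)%:R) * \prod_(b <- pos_roots N) (1 - qvar rat ^+ `|deg b|%N) =
  weyl_product e a rat.
Proof.
move=> v0 aE dom.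
have AE : twice_shifted = [ffun t => e + 2 * a t] by apply/ffunP => t; rewrite aE ffunE.
have An p : (p < N)%N -> pair_coroot p twice_shifted = 2 * (lev p + 1).
  move=> pN; rewrite mulrDr -levE // /pair_coroot mulr1 crd_Ordinal ffunE.
  rewrite crd_Ordinal; case: p pN => [|p] pN /=; first by rewrite !crd0; lia.
  by rewrite !(crd_Ordinal _ (ltnW pN)) ffunE /=; lia.
rewrite AE in An dom.
apply: (spec_dominant An dom) => [p nu pN|nu||nu].
- by rewrite addrK frame_dim_srefl.
- by rewrite pnatr_eq0 -lt0n; apply: frame_dim_cone.
- by rewrite frame_dim0.
(* Multiplicities are natural numbers, so the identity over [F] descends to the rationals, where the
   character lives. *)
rewrite -AE; apply/eqP; rewrite -(fmorph_eq0 (ratr : rat -> F)) rmorphM /= ratr_int.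
rewrite -diffop_map_val.
rewrite (@eq_diffop _ _ _ _ (fun mu => (m mu)%:R)) => [|mu]; last by rewrite rmorph_nat.
by rewrite quad_diffop.
Qed.

End FiniteRank.

(** * Homogeneous elements of the central extension *)

Section InfiniteMatrices.
Variable F : numFieldType.
Implicit Types (A B : zmat F) (x y : ghat F) (i j k l d : int).

Definition mx_deg d A : Prop := forall i j, j - i != d -> A i j = 0.

Definition hg d x : Prop := tb_infty x /\ hat_deg d x.

Lemma fsum_single (f : int -> F) k : (forall i, i != k -> f i = 0) ->
  \sum_(i \in [set: int]) f i = f k.
Proof.
move=> fk; rewrite (@fsbigE _ _ _ _ _ [:: k]) //.
  by rewrite big_mkcond big_seq1 in_setT.
by move=> i _; rewrite inE => /fk.
Qed.

Lemma zmulmx_deg d A B i j : mx_deg d A -> zmulmx A B i j = A i (i + d) * B (i + d) j.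
Proof.
move=> Ad; apply: (fsum_single (f := fun k => A i k * B k j)) => k kd.
by rewrite Ad ?mul0r // subr_eq addrC.
Qed.

Definition jj i : F := (i <= 0)%R%:R.

Lemma Jmx_commE d A i j : mx_deg d A ->
  (zmulmx (Jmx F) A - zmulmx A (Jmx F)) i j = (jj i - jj j) * A i j.
Proof.
move=> Ad; rewrite !fctE (zmulmx_deg _ _ _ Ad).
have -> : zmulmx (Jmx F) A i j = jj i * A i j.
  rewrite (@zmulmx_deg 0) ?addr0 /Jmx ?eqxx // => k l kl.
  by rewrite /Jmx (_ : (k == l) = false) //; lia.
rewrite mulrBl; congr (_ - _).
case: (eqVneq (j - i) d) => [<-|jd].
  by rewrite addrC subrK /Jmx eqxx mulrC.
by rewrite [A i j]Ad // mulr0 /Jmx; case: eqP => [E|_];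
  rewrite ?mulr0 //; case/eqP: jd; rewrite -E addrAC subrr add0r.
Qed.

Lemma cocycle_deg d A B : mx_deg d A -> cocycle A B =
  \sum_(i \in [set: int]) (jj i - jj (i + d)) * A i (i + d) * B (i + d) i.
Proof.
move=> Ad; rewrite /cocycle /ztrace; apply: eq_fsbigr => i _.
rewrite (@zmulmx_deg d) ?(Jmx_commE _ _ Ad) // => k l kl.
by rewrite (Jmx_commE _ _ Ad) Ad // mulr0.
Qed.

Lemma mx_deg_is_gl d A : mx_deg d A -> is_gl A.
Proof.
move=> Ad; apply: (@sub_finite_set _ _ [set d]%classic); last exact: finite_set1.
move=> e [i Ai]; apply/eqP; apply: contraNT Ai => ed.
by rewrite Ad // addrAC subrr add0r.
Qed.

Lemma is_glD A B (a : F) : is_gl A -> is_gl B -> is_gl (a *: A + B).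
Proof.
move=> gA gB; apply: (@sub_finite_set _ _ ([set d : int | exists i : int, A i (i + d) != 0] `|`
   [set d : int | exists i : int, B i (i + d) != 0])%classic); last by rewrite finite_setU.
move=> d [k]; case: (eqVneq (A k (k + d)) 0) => [Ai|Ai]; last by move=> _; left; exists k.
by rewrite !fctE Ai scaler0 add0r => Bi; right; exists k.
Qed.

Lemma lin1E (a : F) x y i j : (a *: x + y).1 i j = a * x.1 i j + y.1 i j.
Proof. exact: erefl. Qed.

Lemma lin2E (a : F) x y : (a *: x + y).2 = a * x.2 + y.2.
Proof. exact: erefl. Qed.

Lemma tb_lin (a : F) x y : tb_infty x -> tb_infty y -> tb_infty (a *: x + y).
Proof.
have E : (a *: x + y).1 = a *: x.1 + y.1 by exact: erefl.
move=> [gx hx] [gy hy]; split; first by rewrite E; apply: is_glD.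
by move=> i j; rewrite !lin1E hx (hy i j) mulrN opprD.
Qed.

Lemma tb0 : @tb_infty F 0.
Proof.
split=> [|i j]; last by rewrite (_ : (0 : ghat F).1 i j = 0) ?oppr0.
exact: (@mx_deg_is_gl 0 (0 : ghat F).1).
Qed.

Lemma hg_mx d x : hg d x -> mx_deg d x.1.
Proof. by case=> _ []. Qed.

Lemma hg_anti d x i j : hg d x -> x.1 (- j) (- i) = - x.1 i j.
Proof. by case=> -[_ h] _; rewrite h !opprK. Qed.

Lemma hg_lin d (a : F) x y : hg d x -> hg d y -> hg d (a *: x + y).
Proof.
move=> [tx [dx zx]] [ty [dy zy]]; split; first exact: tb_lin.
split; first by move=> i j ij; rewrite lin1E dx ?dy // mulr0 addr0.
by move=> d0; rewrite lin2E zx ?zy // mulr0 addr0.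
Qed.

Lemma hatbr_mxE a b x y i j : hg a x -> hg b y -> (hatbr x y).1 i j =
  x.1 i (i + a) * y.1 (i + a) j - y.1 i (i + b) * x.1 (i + b) j.
Proof.
by move=> /hg_mx hx /hg_mx hy; rewrite /hatbr /= !fctE (zmulmx_deg _ _ _ hx) (zmulmx_deg _ _ _ hy).
Qed.

Lemma hg_br a b x y : hg a x -> hg b y -> hg (a + b) (hatbr x y).
Proof.
move=> hx hy.
have dx := hg_mx hx; have dy := hg_mx hy.
have D : mx_deg (a + b) (hatbr x y).1.
  move=> i j ij; rewrite (hatbr_mxE _ _ hx hy) [y.1 (i + a) j]dy ?[x.1 (i + b) j]dx.
  - by rewrite !mulr0 subrr.
  - by move: ij; apply: contraNneq; lia.
  - by move: ij; apply: contraNneq; lia.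
split; last first.
  split=> // ab; rewrite /= (cocycle_deg _ dx) fsbig1 // => i _.
  by rewrite [y.1 _ _]dy ?mulr0 //; move: ab; apply: contraNneq; lia.
split; first exact: mx_deg_is_gl D.
move=> i j; case: (eqVneq (j - i) (a + b)) => ij; last first.
  by rewrite !D ?oppr0 //; move: ij; apply: contraNneq; lia.
rewrite !(hatbr_mxE _ _ hx hy) opprB.
have -> : j = i + a + b by lia.
rewrite [x.1 (- _) _](_ : _ = - x.1 (i + b) (i + a + b)); last first.
  by rewrite -(hg_anti _ _ hx); congr (x.1 _ _); lia.
rewrite [y.1 (- _) _](_ : _ = - y.1 (i + a) (i + a + b)); last first.
  by rewrite -(hg_anti _ _ hy); congr (y.1 _ _); lia.
rewrite [y.1 _ (- i)](_ : _ = - y.1 i (i + b)); last first.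
  by rewrite -(hg_anti _ _ hy); congr (y.1 _ _); lia.
rewrite [x.1 _ (- i)](_ : _ = - x.1 i (i + a)); last first.
  by rewrite -(hg_anti _ _ hx); congr (x.1 _ _); lia.
by ring.
Qed.

(* The homogeneous components. *)
Definition hcomp x d : ghat F :=
  (fun i j => if j - i == d then x.1 i j else 0, if d == 0 then x.2 else 0).

Lemma hg_hcomp x d : tb_infty x -> hg d (hcomp x d).
Proof.
move=> [_ hx]; have D : mx_deg d (hcomp x d).1 by move=> i j /negPf /= ->.
split; last by split=> // /negPf /= ->.
split; first exact: mx_deg_is_gl D.
move=> i j /=; rewrite (_ : - i - - j = j - i); last by lia.
by case: eqP => _; rewrite ?oppr0 // hx.
Qed.

Lemma hcomp_sum x : tb_infty x -> exists s : seq int, x = \sum_(d <- s) hcomp x d.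
Proof.
(* [0] is added by hand: the central part belongs to [hcomp x 0] even if the diagonal of [x]
   vanishes. *)
move=> [/finite_seqP [s0 s0E] _]; pose s := undup (0 :: s0).
exists s; have us : uniq s by apply: undup_uniq.
have E (t : seq int) : \sum_(d <- t) hcomp x d =
   ((fun i j => \sum_(d <- t) (hcomp x d).1 i j) : zmat F, \sum_(d <- t) (hcomp x d).2).
  elim: t => [|d t IH].
    by rewrite !big_nil; congr pair; apply/funext => i; apply/funext => j; rewrite big_nil.
  rewrite !big_cons IH; congr pair; apply/funext => i; apply/funext => j.
  by rewrite [in RHS]big_cons.
rewrite E; case: x {E} s0E => A z /= s0E; congr pair.
  apply/funext => i; apply/funext => j; case: (eqVneq (A i j) 0) => Aij.
    by rewrite big1 // => d _; rewrite Aij if_same.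
  have ds : j - i \in s.
    rewrite mem_undup inE; apply/orP; right.
    have : [set` s0]%classic (j - i) by rewrite -s0E; exists i; rewrite addrC subrK.
    by [].
  rewrite (bigD1_seq (j - i)) //= eqxx big1 ?addr0 // => d.
  by rewrite eq_sym => /negPf->.
rewrite (bigD1_seq 0) //= ?mem_undup ?mem_head // ?eqxx big1 ?addr0 // => d /negPf->.
by [].
Qed.

End InfiniteMatrices.

(** * Finite matrices and the splitting of the cocycle *)

Section FiniteElements.
Variable F : numFieldType.
Implicit Types (x y : ghat F) (i j k l d p q : int).

Lemma add1E x y i j : (x + y).1 i j = x.1 i j + y.1 i j.
Proof. exact: erefl. Qed.
Lemma opp1E x i j : (- x).1 i j = - x.1 i j.
Proof. exact: erefl. Qed.
Lemma scale1E (a : F) x i j : (a *: x).1 i j = a * x.1 i j.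
Proof. exact: erefl. Qed.
Lemma add2E x y : (x + y).2 = x.2 + y.2.
Proof. exact: erefl. Qed.
Lemma opp2E x : (- x).2 = - x.2.
Proof. exact: erefl. Qed.
Lemma scale2E (a : F) x : (a *: x).2 = a * x.2.
Proof. exact: erefl. Qed.

Lemma ghat_eq x y : (forall i j, x.1 i j = y.1 i j) -> x.2 = y.2 -> x = y.
Proof.
case: x y => [A z] [B w] /= AB ->; congr pair.
by apply/funext => i; apply/funext => j; apply: AB.
Qed.

(* E_{ij} - E_{-j,-i}, with the central term that makes the cocycle of two such
   elements vanish. *)
Definition Fel i j : ghat F :=
  ((fun p q => (p == i)%:R * (q == j)%:R - (p == - j)%:R * (q == - i)%:R),
   (i == j)%:R * (jj F i - jj F (- i))).

Lemma FelE i j p q :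
  (Fel i j).1 p q = (p == i)%:R * (q == j)%:R - (p == - j)%:R * (q == - i)%:R.
Proof. by []. Qed.

Lemma Fel2E i j : (Fel i j).2 = (i == j)%:R * (jj F i - jj F (- i)).
Proof. by []. Qed.

Lemma Fel_deg i j : mx_deg (j - i) (Fel i j).1.
Proof.
move=> p q pq; rewrite FelE; case: (eqVneq p i) => [pi|_].
  rewrite (_ : (q == j) = false); last by lia.
  case: (eqVneq p (- j)) => [pj|_]; rewrite ?mulr0 ?mul0r ?subrr //.
  by rewrite (_ : (q == - i) = false) ?mulr0 ?subrr //; lia.
case: (eqVneq p (- j)) => [pj|_]; rewrite ?mulr0 ?mul0r ?subrr //.
by rewrite (_ : (q == - i) = false) ?mulr0 ?subrr //; lia.
Qed.

Lemma hg_Fel i j : hg (j - i) (Fel i j).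
Proof.
split; split; [exact: mx_deg_is_gl (@Fel_deg i j)| |exact: Fel_deg|].
  move=> p q; rewrite !FelE !eqr_opp (eqr_oppLR p) (eqr_oppLR q) opprB.
  by rewrite mulrC [X in _ - X]mulrC; congr (_ - _); rewrite mulrC.
rewrite /= => ij; rewrite (_ : (i == j) = false) ?mul0r //.
by apply/negP => /eqP ij'; rewrite ij' subrr eqxx in ij.
Qed.

Lemma FelN i j : Fel (- j) (- i) = - Fel i j.
Proof.
apply: ghat_eq => [p q|]; first by rewrite opp1E !FelE !opprK opprB.
rewrite opp2E /= eqr_opp opprK [j == i]eq_sym -mulrN opprB.
by case: eqP => [->|]; rewrite ?mul0r.
Qed.

Lemma fsum_pair (f : int -> F) a b : a != b ->
  (forall i, i != a -> i != b -> f i = 0) ->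
  \sum_(i \in [set: int]) f i = f a + f b.
Proof.
move=> ab fab; rewrite (@fsbigE _ _ _ _ _ [:: a; b]) //=.
- by rewrite big_mkcond big_cons big_seq1 !in_setT.
- by rewrite inE ab.
- by move=> i _; rewrite !inE negb_or => /andP[]; apply: fab.
Qed.

Lemma cocycle_Fel i j B : cocycle (Fel i j).1 B =
  (jj F i - jj F j) * B j i - (jj F (- j) - jj F (- i)) * B (- i) (- j).
Proof.
rewrite (cocycle_deg _ (@Fel_deg i j)).
pose G p := (jj F p - jj F (p + (j - i))) * B (p + (j - i)) p.
have E p : (jj F p - jj F (p + (j - i))) * (Fel i j).1 p (p + (j - i)) * B (p + (j - i)) p =
   ((p == i)%:R - (p == - j)%:R) * G p.
  rewrite FelE /G (_ : (_ == j) = (p == i)); last by apply/eqP/eqP; lia.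
  rewrite (_ : (_ == - i) = (p == - j)); last by apply/eqP/eqP; lia.
  by case: (p == i); case: (p == - j); rewrite /=; ring.
have -> : (jj F i - jj F j) * B j i - (jj F (- j) - jj F (- i)) * B (- i) (- j) = G i - G (- j).
  rewrite /G [i + _](_ : _ = j); last by lia.
  by rewrite [- j + _](_ : _ = - i) //; lia.
under eq_fsbigr do rewrite E.
case: (eqVneq i (- j)) => [->|ij].
  by rewrite subrr fsbig1 // => p _; rewrite subrr mul0r.
rewrite (fsum_pair ij) => [|p /negPf-> /negPf->]; last by rewrite subrr mul0r.
rewrite !eqxx (negPf ij) [- j == i]eq_sym (negPf ij) /=; ring.
Qed.

Lemma zmulmx_Fel i j B p q : zmulmx (Fel i j).1 B p q =
  (p == i)%:R * B j q - (p == - j)%:R * B (- i) q.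
Proof.
rewrite (zmulmx_deg _ _ _ (@Fel_deg i j)) FelE.
rewrite (_ : (_ == j) = (p == i)); last by apply/eqP/eqP; lia.
rewrite (_ : (_ == - i) = (p == - j)); last by apply/eqP/eqP; lia.
case: (eqVneq p i) => [->|pi]; last first.
  case: (eqVneq p (- j)) => [->|pj]; last by rewrite !mul0r subrr mul0r.
  by rewrite [- j + _](_ : _ = - i) /=; [ring|lia].
rewrite [i + _](_ : _ = j); last by lia.
by case: (eqVneq i (- j)) => [->|_] /=; rewrite ?opprK; ring.
Qed.

(** On finite matrices Tr([J, A] B) = Tr(J [A, B]), so A |-> (A, Tr(J A)) preserves brackets; the
    central term of [Fel i j] is this trace. *)
Lemma Fel_br i j k l : hatbr (Fel i j) (Fel k l) =
  (j == k)%:R *: Fel i l - (l == i)%:R *: Fel k j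
  - (k == - i)%:R *: Fel (- j) l + (l == - j)%:R *: Fel k (- i).
Proof.
apply: ghat_eq => [p q|].
  rewrite !(add1E, opp1E, scale1E) /hatbr [LHS]/= !fctE !zmulmx_Fel !FelE !opprK.
  have e1 : (j == - l) = (l == - j) by rewrite -eqr_oppLR eq_sym.
  have e2 : (- i == k) = (k == - i) by rewrite eq_sym.
  have e3 : (- i == - l) = (l == i) by rewrite eqr_opp eq_sym.
  have e4 : (- k == i) = (k == - i) by rewrite eqr_oppLR.
  have e5 : (- k == - j) = (j == k) by rewrite eqr_opp eq_sym.
  by rewrite e1 e2 e3 e4 e5; ring.
rewrite !(add2E, opp2E, scale2E) -[LHS]/(cocycle (Fel i j).1 (Fel k l).1).
rewrite cocycle_Fel !FelE !Fel2E !opprK.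
have e1 : (j == - l) = (l == - j) by rewrite -eqr_oppLR eq_sym.
have e2 : (- i == k) = (k == - i) by rewrite eq_sym.
have e3 : (- i == - l) = (l == i) by rewrite eqr_opp eq_sym.
have e6 : (- j == l) = (l == - j) by rewrite eq_sym.
have e7 : (i == - k) = (k == - i) by rewrite -eqr_oppLR eq_sym.
have e8 : (- j == - k) = (j == k) by rewrite eqr_opp.
rewrite e1 e2 e3 e6 e7 e8 [i == l]eq_sym [k == j]eq_sym.
have -> : (j == k)%:R * (jj F k - jj F (- k)) = (j == k)%:R * (jj F j - jj F (- j)).
  by case: eqP => [->|]; rewrite ?mul0r.
have -> : (k == - i)%:R * (jj F k - jj F (- k)) = (k == - i)%:R * (jj F (- i) - jj F i).
  by case: eqP => [->|]; rewrite ?mul0r ?opprK.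
ring.
Qed.

(* A homogeneous element is a finite combination of the [Fel i j] and of the
   central element, up to an element supported far from the origin. *)
Definition far (M : nat) x : Prop :=
  forall i j, x.1 i j != 0 -> (M < `|i|)%N /\ (M < `|j|)%N.

Lemma near_far d (M : nat) x : hg d x -> exists y (s : seq int) (c : int -> F) (z : F),
  [/\ hg d y, y.2 = 0, far M y,
      forall i, i \in s -> (`|i| <= M + `|d|)%N /\ (`|(i + d)%R| <= M + `|d|)%N
    & x = \sum_(i <- s) c i *: Fel i (i + d) + z *: central F + y].
Proof.
move=> hx; have dx := hg_mx hx.
pose near i j := (`|i| <= M)%N || (`|j| <= M)%N.
pose y : ghat F := (fun i j => if near i j then 0 else x.1 i j, 0).
have hy : hg d y.
  have D : mx_deg d y.1 by move=> i j ij /=; rewrite dx // if_same.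
  split; split=> //; first exact: mx_deg_is_gl D.
  move=> i j /=; rewrite /near !abszN orbC; case: ifP => _; first by rewrite oppr0.
  by rewrite (hg_anti _ _ hx) opprK.
pose s := [seq i <- sseq (M + `|d|) | (`|(i + d)%R| <= M + `|d|)%N].
(* Halved because every entry is met twice, by [Fel i (i + d)] and by its mirror image, whose index
   [- (i + d)] is in [s] as well. *)
pose c i : F := (if near i (i + d) then x.1 i (i + d) else 0) / 2.
(* What is left of the central part of [x] after the central corrections of the [Fel]. *)
pose z : F := x.2 - \sum_(i <- s) c i * (Fel i (i + d)).2.
exists y, s, c, z; split=> //.
- move=> i j /=; rewrite /near; case: ifP; first by rewrite eqxx.
  by move=> /negbT; rewrite negb_or -!ltnNge => /andP[].
- by move=> i; rewrite mem_filter mem_sseq => /andP[].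
have us : uniq s by rewrite filter_uniq // uniq_sseq.
have S1 p q : (\sum_(i <- s) c i *: Fel i (i + d)).1 p q =
    \sum_(i <- s) c i * (Fel i (i + d)).1 p q.
  elim: s {us z} => [|i s IH]; first by rewrite !big_nil.
  by rewrite !big_cons add1E scale1E IH.
have S2 : (\sum_(i <- s) c i *: Fel i (i + d)).2 = \sum_(i <- s) c i * (Fel i (i + d)).2.
  elim: s {us z S1} => [|i s IH]; first by rewrite !big_nil.
  by rewrite !big_cons add2E scale2E IH.
apply: ghat_eq => [p q|]; last first.
  by rewrite !add2E scale2E S2 /z /= mulr1 addr0 addrC subrK.
rewrite !add1E scale1E S1 [(central F).1 p q](_ : _ = 0) // mulr0 addr0.
case: (eqVneq (q - p) d) => [qE|qp]; last first.
  rewrite dx // [y.1 p q](hg_mx hy) // addr0 big1 // => i _.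
  by rewrite (@Fel_deg i (i + d)) ?mulr0 //; move: qp; apply: contraNneq; lia.
have pick r : \sum_(i <- s) c i * (r == i)%:R = c r.
  case: (boolP (r \in s)) => rs.
    rewrite (bigD1_seq r) //= eqxx mulr1 big1 ?addr0 // => i.
    by rewrite eq_sym => /negPf->; rewrite mulr0.
  rewrite big_seq big1 => [|i is_]; last first.
    by case: eqP => [ri|]; rewrite ?mulr0 //; rewrite ri is_ in rs.
  rewrite /c; case: ifP => [nr|_]; last by rewrite mul0r.
  by move: rs; rewrite mem_filter mem_sseq; move: nr; rewrite /near; lia.
have -> : \sum_(i <- s) c i * (Fel i (i + d)).1 p q = c p - c (- q).
  rewrite -!pick -sumrB; apply: eq_bigr => i _; rewrite -mulrBr; congr (_ * _).
  rewrite FelE (_ : (q == i + d) = (p == i)); last by apply/eqP/eqP; lia.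
  rewrite (_ : (p == - (i + d)) = (- q == i)); last by apply/eqP/eqP; lia.
  rewrite (_ : (q == - i) = (- q == i)); last by apply/eqP/eqP; lia.
  by case: (p == i); case: (- q == i); rewrite /=; ring.
rewrite /c [p + d](_ : _ = q); last by lia.
rewrite [- q + d](_ : _ = - p); last by lia.
rewrite {2}/near !abszN orbC -/(near p q) (hg_anti _ _ hx) /= .
by case: ifP => _; field.
Qed.

End FiniteElements.

(** * Reduction of the module over the infinite matrices to so(2N+1) *)

Section HighestWeightModule.
Variables (F : numFieldType) (V : lmodType F) (La : ghat F -> F).
Variables (rho : ghat F -> V -> V) (L : nat -> set V) (v : V).
Hypothesis H : irr_highest_weight_module (@tb_infty F) La rho L v.
Implicit Types (x y : ghat F) (u w : V) (d t : int) (j k M n : nat).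

Lemma rho_linear x : tb_infty x -> forall a u w, rho x (a *: u + w) = a *: rho x u + rho x w.
Proof. by move=> gx; case: (hw_rep H) => h _ _; apply: h. Qed.

Lemma rho_lin x y a u : tb_infty x -> tb_infty y -> rho (a *: x + y) u = a *: rho x u + rho y u.
Proof. by move=> gx gy; case: (hw_rep H) => _ h _; apply: h. Qed.

Lemma rho_comm x y u : tb_infty x -> tb_infty y ->
  rho x (rho y u) = rho y (rho x u) + rho (hatbr x y) u.
Proof. by move=> gx gy; case: (hw_rep H) => _ _ ->; rewrite // addrC subrK. Qed.

Lemma rho0l u : rho 0 u = 0.
Proof.
have := rho_lin 1 u (tb0 F) (tb0 F); rewrite scaler0 addr0 scale1r => /eqP.
by rewrite -subr_eq0 opprD addNKr oppr_eq0 => /eqP.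
Qed.

Lemma rhoZl a x u : tb_infty x -> rho (a *: x) u = a *: rho x u.
Proof. by move=> gx; rewrite -[a *: x]addr0 rho_lin ?rho0l ?addr0 //; apply: tb0. Qed.

Lemma rhoDl x y u : tb_infty x -> tb_infty y -> rho (x + y) u = rho x u + rho y u.
Proof. by move=> gx gy; rewrite -[x in LHS]scale1r rho_lin // scale1r. Qed.

Lemma rho0r x : tb_infty x -> rho x 0 = 0.
Proof.
move=> gx; have := rho_linear gx 1 0 0; rewrite scaler0 addr0 scale1r => /eqP.
by rewrite -subr_eq0 opprD addNKr oppr_eq0 => /eqP.
Qed.

Lemma rhoZr x a u : tb_infty x -> rho x (a *: u) = a *: rho x u.
Proof. by move=> gx; have := rho_linear gx a u 0; rewrite !addr0 rho0r // addr0. Qed.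

Lemma tb_sum (I : Type) (r : seq I) (f : I -> ghat F) :
  (forall z, tb_infty (f z)) -> tb_infty (\sum_(z <- r) f z).
Proof.
move=> gf; elim: r => [|z r IH]; first by rewrite big_nil; apply: tb0.
by rewrite big_cons -[f z]scale1r; apply: tb_lin.
Qed.

Lemma rho_suml (I : Type) (r : seq I) (f : I -> ghat F) u :
  (forall z, tb_infty (f z)) -> rho (\sum_(z <- r) f z) u = \sum_(z <- r) rho (f z) u.
Proof.
move=> gf; elim: r => [|z r IH]; first by rewrite !big_nil rho0l.
by rewrite !big_cons rhoDl ?IH //; apply: tb_sum.
Qed.

(* The span of the vectors y_1 ... y_m u0 with the y_i homogeneous of nonpositive
   degree, graded by their degree. *)
Inductive gen (t0 : int) (u0 : V) : int -> V -> Prop :=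
| gen_base : gen t0 u0 t0 u0
| gen_0 t : gen t0 u0 t 0
| gen_lin t a u w : gen t0 u0 t u -> gen t0 u0 t w -> gen t0 u0 t (a *: u + w)
| gen_act t n y w : hg (- n%:Z) y -> gen t0 u0 t w -> gen t0 u0 (t + n%:Z) (rho y w).

Definition singular u : Prop := forall d x, 0 < d -> hg d x -> rho x u = 0.

(** Induction on the generation: elements of positive degree are commuted to the right until they
    reach [u0], which they kill. *)
Lemma gen_hg t0 u0 t w d x : singular u0 -> gen t0 u0 t w -> hg d x ->
  gen t0 u0 (t - d) (rho x w).
Proof.
move=> su gw; elim: gw d x => [|t'|t' a u' w' _ IHu _ IHw|t' n y w' hy gw' IH] d x hx.
- case: (ltrP 0 d) => d0; first by rewrite (su d x) //; apply: gen_0.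
  rewrite (_ : t0 - d = t0 + `|d|%N%:Z); last by lia.
  by apply: gen_act; [rewrite (_ : - _ = d) //; lia | apply: gen_base].
- by rewrite rho0r; [apply: gen_0 | case: hx].
- by rewrite rho_linear; [apply: gen_lin; [apply: IHu|apply: IHw] | case: hx].
rewrite rho_comm; [|by case: hx|by case: hy].
rewrite -[rho y _]scale1r; apply: gen_lin.
  by rewrite addrAC; apply: gen_act => //; apply: IH.
rewrite (_ : t' + n%:Z - d = t' - (d + - n%:Z)); last by ring.
by apply: IH; apply: hg_br.
Qed.

Inductive gen_span (t0 : int) (u0 : V) : V -> Prop :=
| gen_span_in t w : gen t0 u0 t w -> gen_span t0 u0 w
| gen_span_lin a u w : gen_span t0 u0 u -> gen_span t0 u0 w -> gen_span t0 u0 (a *: u + w).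

Lemma gen_span_sub t0 u0 : subspace (gen_span t0 u0).
Proof.
by split; [apply: (gen_span_in (t := 0)); apply: gen_0 | move=> *; apply: gen_span_lin].
Qed.

Lemma gen_span_submodule t0 u0 : singular u0 ->
  submodule (@tb_infty F) rho (gen_span t0 u0).
Proof.
move=> su; split; first exact: gen_span_sub.
move=> x w gx; elim=> [t w' gw|a u w' _ IHu _ IHw]; last first.
  by rewrite rho_linear //; apply: gen_span_lin.
have [s ->] := hcomp_sum gx; rewrite rho_suml; last by move=> d; case: (hg_hcomp d gx).
apply: sub_sum => [|d _]; first exact: gen_span_sub.
by apply: (gen_span_in (t := t - d)); apply: gen_hg => //; apply: hg_hcomp.
Qed.

Lemma graded_part_sub t : subspace (graded_part L t).
Proof.
case: (hw_grading H) => Ls _ _; case: t => j /=; first exact: Ls.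
by split=> // a u w -> ->; rewrite scaler0 addr0.
Qed.

Lemma gen_graded (j0 : nat) u0 t w : L j0 u0 -> gen j0%:Z u0 t w -> graded_part L t w.
Proof.
move=> Lu; elim=> [//|t'|t' a u' w' _ IHu _ IHw|t' n y w' hy _ IH].
- by case: (graded_part_sub t').
- by case: (graded_part_sub t') => _; apply.
case: t' IH => j /=.
  move=> Lw; have := hw_degree H hy.1 hy.2 Lw.
  by rewrite opprK.
by move=> ->; rewrite rho0r; [case: (graded_part_sub (Negz j + n%:Z)) | case: hy].
Qed.

Lemma gen_lt t0 u0 t w : gen t0 u0 t w -> t < t0 -> w = 0.
Proof.
elim=> [|//|t' a u' w' _ IHu _ IHw|t' n y w' hy _ IH] tt0.
- by rewrite ltxx in tt0.
- by rewrite IHu // IHw // scaler0 addr0.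
- by rewrite IH ?rho0r //; [case: hy | lia].
Qed.

Lemma direct_component n (f : nat -> V) j u : (forall k, L k (f k)) -> L j u ->
  u = \sum_(k < n) f k -> u = if (j < n)%N then f j else 0.
Proof.
move=> Lf Lu uE; case: (hw_grading H) => Ls _ Ld.
pose f' k := (if (k < n)%N then f k else 0) - (if k == j then u else 0).
have Lf' k : L k (f' k).
  have [L0 _] := Ls k.
  apply: subB; [exact: Ls| by case: ifP | by case: eqP => [->|]].
have := Ld (n + j.+1)%N f' Lf' _ j; rewrite /f' eqxx => h.
apply/eqP; rewrite eq_sym -subr_eq0; apply/eqP; apply: h; last by rewrite addnS ltnS leq_addl.
rewrite sumrB big_split_ord /= [X in _ + X - _]big1 => [|k _]; last first.
  by rewrite ltnNge leq_addr.
rewrite addr0 (eq_bigr (fun k : 'I_n => f k)) => [|k _]; last by rewrite ltn_ord.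
rewrite -uE; have jn : (j < n + j.+1)%N by rewrite addnS ltnS leq_addl.
rewrite (bigD1 (Ordinal jn)) //= eqxx big1 ?addr0 ?subrr // => k.
by rewrite -val_eqE /= => /negPf->.
Qed.

Lemma gen_span_graded (j0 : nat) u0 w : gen_span j0%:Z u0 w ->
  exists n (f : nat -> V), (forall k, gen j0%:Z u0 k%:Z (f k)) /\ w = \sum_(k < n) f k.
Proof.
elim=> [t w' gw|a u' w' _ [n [f [fg ->]]] _ [n' [f' [fg' ->]]]].
  case: t gw => [j gw|j gw]; last first.
    exists 0%N, (fun=> 0); split; first by move=> k; apply: gen_0.
    by rewrite big_ord0 (gen_lt gw).
  exists j.+1, (fun k => if k == j then w' else 0); split.
    by move=> k; case: eqP => [->|_] //; apply: gen_0.
  by rewrite big_ord_recr /= eqxx big1 ?add0r // => k _; rewrite ltn_eqF.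
pose c (m : nat) (h : nat -> V) k := if (k < m)%N then h k else 0.
have cg m (h : nat -> V) k : (forall k, gen j0%:Z u0 k%:Z (h k)) -> gen j0%:Z u0 k%:Z (c m h k).
  by rewrite /c => hg; case: ifP => // _; apply: gen_0.
have csum m m' (h : nat -> V) : (m <= m')%N -> \sum_(k < m') c m h k = \sum_(k < m) h k.
  move=> mm; rewrite -(subnKC mm) big_split_ord /= [X in _ + X]big1 => [|k _]; last first.
    by rewrite /c ltnNge leq_addr.
  by rewrite addr0; apply: eq_bigr => k _; rewrite /c /= ltn_ord.
exists (n + n')%N, (fun k => a *: c n f k + c n' f' k); split.
  by move=> k; apply: gen_lin; apply: cg.
by rewrite big_split -scaler_sumr !csum ?leq_addr ?leq_addl.
Qed.

Lemma singular_v : singular v.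
Proof. by move=> d x d0 [gx dx]; apply: (hw_killed H d0). Qed.

Lemma gen_v u j : L j u -> gen 0 v j%:Z u.
Proof.
move=> Lu; have T := hw_generated H (gen_span_submodule 0 singular_v).
have : gen_span 0 v u.
  by rewrite T //; apply: (gen_span_in (t := 0)); apply: gen_base.
move=> /(@gen_span_graded 0 v) [n [f [fg uE]]].
have Lf k : L k (f k) by apply: (gen_graded (hw_vector H).1 (fg k)).
rewrite (direct_component Lf Lu uE); case: ifP => _; [exact: fg | exact: gen_0].
Qed.

(** A nonzero singular vector would generate the whole module, yet what it generates has no
    component of degree below [j], and [v] has degree 0. *)
Lemma singular_eq0 u j : L j u -> (0 < j)%N -> singular u -> u = 0.
Proof.
move=> Lu j0 su; case: (hw_irreducible H (gen_span_submodule j%:Z su)) => T.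
  have : gen_span j%:Z u u by apply: (gen_span_in (t := j%:Z)); apply: gen_base.
  by rewrite T.
have : gen_span j%:Z u v by rewrite T.
case/gen_span_graded => n [f [fg vE]]; case: (hw_vector H) => Lv /eqP v0; exfalso; apply: v0.
have Lf k : L k (f k) by apply: (gen_graded Lu (fg k)).
by rewrite (direct_component Lf Lv vE) (gen_lt (fg 0%N)) ?if_same.
Qed.

Variables (tc n1 : nat) (lam : nat -> nat).
Hypothesis La_weight : forall x, is_cartan x ->
  La x = \sum_(i \in [set i : nat | (0 < i)%N]%classic) x.1 i%:Z i%:Z * La (hdiag F i)
         + x.2 * La (central F).
Hypothesis La_central : La (central F) = tc%:R / 2.
Hypothesis La_hdiag : forall k, (0 < k)%N -> La (hdiag F k) = (lam k)%:R.
Hypothesis lam_support : forall k, (n1 < k)%N -> lam k = 0%N.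
Hypothesis lam_decr : forall k, (0 < k)%N -> (lam k.+1 <= lam k)%N.
Hypothesis lam_level : (2 * lam 1 <= tc)%N.

Lemma hg_cartan x : hg 0 x -> is_cartan x.
Proof. by move=> hx; split; [case: hx | move=> i; apply: hg_anti hx]. Qed.

Lemma La_far x : hg 0 x -> far n1 x -> x.2 = 0 -> La x = 0.
Proof.
move=> hx fx x2; rewrite (La_weight (hg_cartan hx)) x2 mul0r addr0 fsbig1 // => i /= i0.
case: (eqVneq (x.1 i%:Z i%:Z) 0) => [->|/fx [ni _]]; first by rewrite mul0r.
by rewrite La_hdiag // lam_support // mulr0.
Qed.

(** A bracket with an element of degree [e] moves the support by at most [|e|]. It has no central
    part: for [|i| > M >= |d|] the indices i and i + d have the same sign, so the far element
    commutes with J. *)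
Lemma far_br d e M x y : hg d x -> far M x -> hg e y -> (`|d| <= M)%N -> (`|e| <= M)%N ->
  far (M - `|e|)%N (hatbr x y) /\ (hatbr x y).2 = 0.
Proof.
move=> hx fx hy dM eM; split.
  move=> i j; rewrite (hatbr_mxE _ _ hx hy) => nz.
  case: (eqVneq (x.1 i (i + d) * y.1 (i + d) j) 0) => [z1|].
    move: nz; rewrite z1 sub0r oppr_eq0 mulf_eq0 negb_or => /andP[y0 /fx [h1 h2]].
    by split; lia.
  rewrite mulf_eq0 negb_or => /andP[/fx [h1 h2] y0].
  have : j - (i + d) = e by apply/eqP; apply: contraNT y0 => /(hg_mx hy) ->.
  by split; lia.
rewrite /hatbr [LHS]/= (cocycle_deg _ (hg_mx hx)) fsbig1 // => i _.
case: (eqVneq (x.1 i (i + d)) 0) => [->|/fx [h1 h2]]; first by rewrite mulr0 mul0r.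
rewrite (_ : jj F (i + d) = jj F i) ?subrr ?mul0r // /jj; congr (_%:R).
by congr nat_of_bool; lia.
Qed.

(** In degree 0, [x] acts by Lambda, which does not see indices beyond [n1]. In degree d < 0, [x v]
    is singular of positive degree: for y of degree e > 0, y x v = - [x, y] v, and [x, y] is still
    far enough and has degree closer to 0, or positive. *)
Lemma far_v d M x : hg d x -> far M x -> x.2 = 0 -> (n1 + `|d| <= M)%N -> rho x v = 0.
Proof.
have [m] := ubnP `|d|%N; elim: m d M x => // m IH d M x dm hx fx x2 nM.
case: (ltrgtP d 0) => d0; last first.
- rewrite d0 in hx; rewrite (hw_weight H hx.1 hx.2) La_far ?scale0r // => i j /fx [].
  by lia.
- by apply: singular_v hx.
apply: (@singular_eq0 _ `|d|%N).
- have := hw_degree H hx.1 hx.2 (hw_vector H).1.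
  by rewrite (_ : 0%N%:Z - d = `|d|%N%:Z) //; lia.
- by lia.
move=> e y e0 hy; have := rho_comm v hx.1 hy.1.
rewrite (singular_v e0 hy) rho0r; last by case: hx.
move=> /eqP; rewrite eq_sym addr_eq0 => /eqP ->.
have hb := hg_br hx hy.
case: (ltrP 0 (d + e)) => de; first by rewrite (singular_v de hb) oppr0.
have dM : (`|d| <= M)%N by lia.
have eM : (`|e| <= M)%N by lia.
have [fb b2] := far_br hx fx hy dM eM.
rewrite (IH (d + e) (M - `|e|)%N _ _ hb fb b2) ?oppr0 //; lia.
Qed.

(** The factor 2 in front of [|t|]: commuting past an element of degree [- n] costs [n] in the
    distance of the support and may raise the size of the degree by [n]. *)
Lemma far_gen t w d M x : gen 0 v t w -> hg d x -> far M x -> x.2 = 0 ->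
  (n1 + `|d| + 2 * `|t| <= M)%N -> rho x w = 0.
Proof.
move=> gw; elim: gw d M x => [|t'|t' a u w' _ IHu _ IHw|t' n y w' hy gw IH] d M x hx fx x2 nM.
- by apply: far_v hx fx x2 _; lia.
- by rewrite rho0r; case: hx.
- rewrite rho_linear; last by case: hx.
  by rewrite (IHu d M) // (IHw d M) // scaler0 addr0.
case: (ltrP t' 0) => t0.
  by rewrite (gen_lt gw t0) (rho0r hy.1) (rho0r hx.1).
have nM' : (n1 + `|d| + 2 * `|t'| <= M)%N by lia.
rewrite (rho_comm _ hx.1 hy.1) (IH d M x) // (rho0r hy.1) add0r.
have dM : (`|d| <= M)%N by lia.
have eM : (`|- n%:Z| <= M)%N by lia.
have [fb b2] := far_br hx fx hy dM eM.
apply: (IH _ _ _ (hg_br hx hy) fb b2); lia.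
Qed.

Lemma tb_Fel (i j : int) : tb_infty (Fel F i j).
Proof. by case: (hg_Fel F i j). Qed.

Definition Xop (p q : int) u := rho (Fel F p q) u.

Lemma Xop_linear (p q : int) : linear (Xop p q).
Proof. by move=> a u w; apply/rho_linear/tb_Fel. Qed.

HB.instance Definition _ (p q : int) := GRing.isLinear.Build F V V *:%R (Xop p q) (Xop_linear p q).

Lemma XopN (i j : int) u : Xop (- j) (- i) u = - Xop i j u.
Proof.
rewrite /Xop FelN -scaleN1r rhoZl ?scaleN1r //; exact: tb_Fel.
Qed.

Lemma Xop_br (i j k l : int) u : Xop i j (Xop k l u) - Xop k l (Xop i j u) =
  (j == k)%:R *: Xop i l u - (l == i)%:R *: Xop k j u
  - (k == - i)%:R *: Xop (- j) l u + (l == - j)%:R *: Xop k (- i) u.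
Proof.
rewrite /Xop rho_comm; try exact: tb_Fel.
rewrite addrC addKr Fel_br.
have tbZ (a : F) p q : tb_infty (a *: Fel F p q).
  by rewrite -[_ *: _]addr0; apply: tb_lin; [apply: tb_Fel | apply: tb0].
have tbN x : tb_infty x -> tb_infty (- x).
  by move=> gx; rewrite -scaleN1r -[_ *: _]addr0; apply: tb_lin => //; apply: tb0.
have tbD x y : tb_infty x -> tb_infty y -> tb_infty (x + y).
  by move=> gx gy; rewrite -[x]scale1r; apply: tb_lin.
have rN x : tb_infty x -> rho (- x) u = - rho x u.
  by move=> gx; rewrite -scaleN1r rhoZl // scaleN1r.
rewrite !rhoDl ?rN ?rhoZl //; auto 10 using tb_Fel.
Qed.

Lemma Xop_pos (i j : int) : i < j -> Xop i j v = 0.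
Proof. by move=> ij; apply: (singular_v (d := j - i)); [rewrite subr_gt0 | apply: hg_Fel]. Qed.

(** [Fel k k] acts on [v] by lambda_k - c, its central correction being -1; the coordinate of the
    weight is the opposite, doubled since c may be a half-integer. *)
Definition doubled_weight (N : nat) : {ffun 'I_N -> int} :=
  [ffun k : 'I_N => tc%:Z - 2 * (lam k.+1)%:Z].

Lemma La_Fel k : (0 < k)%N -> La (Fel F k%:Z k%:Z) = (lam k)%:R - tc%:R / 2.
Proof.
move=> k0; have hF : hg 0 (Fel F k%:Z k%:Z) by rewrite -(subrr k%:Z); apply: hg_Fel.
rewrite (La_weight (hg_cartan hF)) (@fsbigE _ _ _ _ _ [:: k]) //.
- rewrite big_mkcond big_seq1 mem_set // La_hdiag // FelE Fel2E !eqxx.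
  rewrite (_ : (k%:Z == - k%:Z) = false); last by lia.
  rewrite /jj (_ : (k%:Z <= 0) = false); last by lia.
  rewrite (_ : (- k%:Z <= 0) = true); last by lia.
  by rewrite La_central /=; ring.
- by move=> i /=; rewrite inE => /eqP->.
- move=> i i0; rewrite inE => ik; rewrite FelE.
  rewrite (_ : (i%:Z == k%:Z) = false); last by apply/eqP => -[E]; rewrite E eqxx in ik.
  by rewrite (_ : (i%:Z == - k%:Z) = false) ?mul0r ?subrr ?mul0r //; lia.
Qed.

Lemma Xop_diag N (k : int) : (`|k| <= N)%N ->
  Xop k k v = - ((crd (doubled_weight N) k)%:~R / 2) *: v.
Proof.
have pos j : (0 < j <= N)%N -> Xop j%:Z j%:Z v = - ((crd (doubled_weight N) j%:Z)%:~R / 2) *: v.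
  case: j => // j /= jN.
  have hF : hg 0 (Fel F j.+1%:Z j.+1%:Z) by rewrite -(subrr j.+1%:Z); apply: hg_Fel.
  rewrite /Xop (hw_weight H hF.1 hF.2) La_Fel // crd_Ordinal ffunE /=; congr (_ *: _).
  by rewrite intrB intrM; field.
case: k => [[|j]|j] kN.
- rewrite crd0 mul0r oppr0 scale0r.
  have : Xop 0 0 v = - Xop 0 0 v by rewrite -XopN oppr0.
  move=> /eqP; rewrite -subr_eq0 opprK -mulr2n -scaler_nat scaler_eq0 pnatr_eq0.
  by move=> /eqP.
- exact: pos.
- rewrite NegzE XopN pos // crdN -scaleNr; congr (_ *: _).
  by rewrite intrN mulNr.
Qed.

(** The values of Lambda on the coroots H_p. *)
Definition levels (p : nat) : nat := if p == 0%N then (tc - 2 * lam 1)%N else (lam p - lam p.+1)%N.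

Lemma levelsE N p : (p < N)%N -> pair_coroot p (doubled_weight N) = 2 * (levels p)%:Z.
Proof.
move=> pN; rewrite /pair_coroot crd_Ordinal ffunE /levels.
case: p pN => [|p] pN; first by rewrite eqxx crd0 /=; lia.
rewrite (crd_Ordinal _ (ltnW pN)) ffunE /= mulr1.
by have := lam_decr (ltn0Sn p); lia.
Qed.

Local Notation lower p := (Xop p.+1%:Z p%:Z).

Lemma lower_iter_graded p n : L n (iter n (lower p) v).
Proof.
elim: n => [|n IH]; first exact: (hw_vector H).1.
have hF := hg_Fel F p.+1%:Z p%:Z.
have := hw_degree H hF.1 hF.2 IH.
by rewrite (_ : n%:Z - (p%:Z - p.+1%:Z) = n.+1%:Z) //; lia.
Qed.

(** Rows [p] and [- p - 1] of [y] vanish, hence [y] commutes with [lower p] and can be moved to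
    [v]. *)
Lemma hg1_off_kills p y n : hg 1 y -> y.1 p%:Z p.+1%:Z = 0 ->
  rho y (iter n (lower p) v) = 0.
Proof.
move=> hy y0.
have row (k : int) : y.1 p%:Z k = 0.
  case: (eqVneq k p.+1%:Z) => [-> //|kp]; apply: (hg_mx hy).
  by move: kp; apply: contraNneq; lia.
have row' (k : int) : y.1 (- p.+1%:Z) k = 0.
  case: (eqVneq k (- p%:Z)) => [->|kp]; first by rewrite (hg_anti _ _ hy) y0 oppr0.
  by apply: (hg_mx hy); move: kp; apply: contraNneq; lia.
have hF := hg_Fel F p.+1%:Z p%:Z.
have prod0 (a b : int) : y.1 a (a + 1) * (Fel F p.+1%:Z p%:Z).1 (a + 1) b = 0.
  rewrite FelE; case: (eqVneq (a + 1) p.+1%:Z) => [E|_].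
    by rewrite (_ : a = p%:Z) ?row ?mul0r //; lia.
  case: (eqVneq (a + 1) (- p%:Z)) => [E|_]; last by rewrite !mul0r subrr mulr0.
  by rewrite (_ : a = - p.+1%:Z) ?row' ?mul0r //; lia.
have b0 : hatbr y (Fel F p.+1%:Z p%:Z) = 0.
  apply: ghat_eq => [a b|].
    rewrite (hatbr_mxE _ _ hy hF) prod0 sub0r FelE [RHS](_ : _ = 0) //.
    case: (eqVneq a p.+1%:Z) => [->|_].
      rewrite [p.+1%:Z + _](_ : _ = p%:Z); last by lia.
      by rewrite row mulr0 oppr0.
    case: (eqVneq a (- p%:Z)) => [->|_]; last by rewrite !mul0r subrr mul0r oppr0.
    rewrite [- p%:Z + _](_ : _ = - p.+1%:Z); last by lia.
    by rewrite row' mulr0 oppr0.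
  rewrite -[LHS]/(cocycle y.1 (Fel F p.+1%:Z p%:Z).1) (cocycle_deg _ (hg_mx hy)).
  by rewrite fsbig1 // => a _; rewrite -mulrA prod0 mulr0.
elim: n => [|n IH]; first exact: (singular_v _ hy).
rewrite iterS -[lower p (iter n _ _)]/(rho (Fel F p.+1%:Z p%:Z) (iter n (lower p) v)) (rho_comm _ hy.1 hF.1) IH b0 rho0l addr0.
exact: (rho0r hF.1).
Qed.

(** The bracket with [lower p] has degree d - 1. For d = 2 its entry at (p, p + 1) is zero, so the
    preceding lemma applies. *)
Lemma hg_ge2_kills p n d x : 2 <= d -> hg d x -> rho x (iter n (lower p) v) = 0.
Proof.
have hF := hg_Fel F p.+1%:Z p%:Z.
elim: n d x => [|n IH] d x d2 hx; first by apply: (singular_v _ hx); lia.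
rewrite iterS -[lower p (iter n _ _)]/(rho (Fel F p.+1%:Z p%:Z) (iter n (lower p) v)) (rho_comm _ hx.1 hF.1) (IH d x) // (rho0r hF.1) add0r.
have hb := hg_br hx hF; case: (eqVneq d 2) => [dE|dn]; last by apply: (IH _ _ _ hb); lia.
apply: hg1_off_kills; first by move: hb; rewrite dE (_ : 2 + _ = 1) //; lia.
rewrite (hatbr_mxE _ _ hx hF) !FelE dE.
rewrite (_ : (p%:Z + 2 == p.+1%:Z) = false); last by lia.
rewrite (_ : (p%:Z + 2 == - p%:Z) = false); last by lia.
rewrite (_ : (p%:Z == p.+1%:Z) = false); last by lia.
rewrite !mul0r subrr mulr0 !sub0r.
case: (eqVneq p%:Z (- p%:Z)) => [pE|_]; last by rewrite !mul0r oppr0 mul0r oppr0.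
rewrite (_ : p = 0%N); last by lia.
(* The case [p = 0] needs this entry, which lies on the antidiagonal and vanishes by
   antisymmetry. *)
have x0 : x.1 (- 1) 1 = 0.
  have /eqP := hg_anti (- 1) 1 hx; rewrite opprK -subr_eq0 opprK -mulr2n mulrn_eq0.
  by move=> /eqP.
by rewrite [0 + _](_ : _ = - 1) // x0 mulr0 oppr0.
Qed.

(** The power [levels p + 1] of the lowering operator maps [v] to a singular vector of positive
    degree, which is 0. In degree 1, [x] is split into a multiple of the raising operator at [p] and
    a part that commutes with [lower p]. *)
Lemma Xop_nil p : exists K, iter K (lower p) v = 0.
Proof.
exists (levels p).+1; apply: (@singular_eq0 _ (levels p).+1); [exact: lower_iter_graded|by []|].
move=> d x d0 hx; case: (ltrP 1 d) => d1; first by apply: hg_ge2_kills hx; lia.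
have dE : d = 1 by lia.
rewrite dE in hx.
pose c := x.1 p%:Z p.+1%:Z; have hF := hg_Fel F p%:Z p.+1%:Z.
have hF1 : hg 1 (Fel F p%:Z p.+1%:Z) by rewrite -[X in hg X _](_ : p.+1%:Z - p%:Z = 1) //; lia.
pose y := (- c) *: Fel F p%:Z p.+1%:Z + x.
have hy : hg 1 y by apply: hg_lin.
have -> : x = c *: Fel F p%:Z p.+1%:Z + y.
  by rewrite /y scaleNr addrA subrr add0r.
rewrite (rho_lin _ _ hF.1 hy.1).
have -> : rho y (iter (levels p).+1 (lower p) v) = 0.
  apply: hg1_off_kills => //; rewrite /y lin1E FelE !eqxx (_ : (p%:Z == - p.+1%:Z) = false); last by lia.
  by rewrite mul0r subr0 !mulr1 addNr.
rewrite addr0; have pp : (p < p.+1)%N by [].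
have /eqP := @raise_lower_iter F V Xop p.+1 (doubled_weight p.+1) v Xop_br
  (@Xop_diag p.+1) Xop_pos (fun p => (levels p)%:Z) (@levelsE p.+1) p (levels p) pp.
rewrite subrr mulr0 scale0r scaler_eq0 => /orP[|/eqP e0].
  by case: ifP; rewrite ?pnatr_eq0 ?oner_eq0.
by rewrite -[rho _ _]/(Xop p%:Z p.+1%:Z _) e0 scaler0.
Qed.

(** The weight gives this on [v] only; the eigenspace of the central element is a submodule
    containing [v], hence everything. *)
Lemma rho_central u : rho (central F) u = (tc%:R / 2) *: u.
Proof.
have gc : tb_infty (central F).
  split; first by apply: (@mx_deg_is_gl _ 0) => i j _.
  by move=> i j; rewrite oppr0.
have hc : hg 0 (central F) by split.
have br0 x : tb_infty x -> hatbr (central F) x = 0.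
  move=> gx; apply: ghat_eq => [i j|].
    rewrite /hatbr [LHS]/= !fctE (@zmulmx_deg _ 0) // mul0r sub0r.
    by rewrite /zmulmx fsbig1 ?oppr0 // => k _; rewrite mulr0.
  rewrite -[LHS]/(cocycle (central F).1 x.1) (cocycle_deg _ (hg_mx hc)) fsbig1 // => i _.
  by rewrite mulr0 mul0r.
pose W : set V := [set u | rho (central F) u = (tc%:R / 2) *: u]%classic.
have Wv : W v by rewrite /W /= (hw_weight H gc hc.2) La_central.
suff Ws : submodule (@tb_infty F) rho W.
  have T := hw_generated H Ws Wv.
  by have : W u by rewrite T.
split; first split.
- by rewrite /W /= rho0r // scaler0.
- move=> a u1 u2; rewrite /W /= => h1 h2.
  by rewrite rho_linear // h1 h2 scalerDr !scalerA mulrC.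
- move=> x w gx; rewrite /W /= => hw; rewrite rho_comm // hw br0 // rho0l addr0.
  by rewrite rhoZr.
Qed.

(** Each element acting on a vector of small degree is split into near matrices, a central part and
    a far part; the far part acts by zero and the near ones belong to so(2N+1). *)
Lemma gen_degree_part N (J : nat) t w : (n1 + 2 * J <= N)%N -> gen 0 v t w -> t <= J%:Z ->
  degree_part Xop N v t w.
Proof.
move=> JN; elim=> [|t'|t' a u w' _ IHu _ IHw|t' n y w' hy gw IH] tJ.
- by apply: (degree_part_in (nu := 0)); rewrite ?deg0 ?oppr0 //; apply: wsp_v.
- exact: degree_part_0.
- by apply: degree_part_lin; [apply: IHu | apply: IHw].
case: (ltrP t' 0) => t0.
  by rewrite (gen_lt gw t0) (rho0r hy.1); apply: degree_part_0.
have IH' := IH (_ : t' <= J%:Z).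
have {IH'} wt : degree_part Xop N v t' w' by apply: IH'; lia.
(* The cut [n1 + n + 2 |t'|] is what [far_gen] requires; the near part then has indices up to
   [n1 + 2 (n + t')], at most [n1 + 2 J]. *)
have [yf [s [c [z [hyf yf2 ff sP yE]]]]] := near_far (n1 + n + 2 * `|t'|)%N hy.
have tbF (i : int) : tb_infty (c i *: Fel F i (i + - n%:Z)).
  by rewrite -[_ *: _]addr0; apply: tb_lin; [apply: tb_Fel|apply: tb0].
have gc : tb_infty (central F).
  split; first by apply: (@mx_deg_is_gl _ 0) => i j _.
  by move=> i j; rewrite oppr0.
have tbz : tb_infty (z *: central F).
  by rewrite -[_ *: _]addr0; apply: tb_lin => //; apply: tb0.
have zn : (0 < n)%N -> z = 0.
  move=> n0; have := congr1 snd yE; rewrite !add2E scale2E yf2 addr0 /= mulr1.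
  case: hy => _ [_ ->]; last by lia.
  have -> : (\sum_(i <- s) c i *: Fel F i (i + - n%:Z)).2 = 0.
    elim: (s) => [|i s' IHs]; first by rewrite big_nil.
    rewrite big_cons add2E scale2E IHs Fel2E (_ : (_ == _) = false); last by lia.
    by rewrite mul0r mulr0 addr0.
  by rewrite add0r.
rewrite yE rhoDl; [|by rewrite -[X in tb_infty X]addr0 -addrA -[\sum_(i <- s) _]scale1r; apply: tb_lin; [apply: tb_sum | rewrite addr0]|by case: hyf].
rewrite (far_gen gw hyf ff yf2) ?addr0; last by lia.
rewrite rhoDl //; last exact: tb_sum.
apply: subD; first exact: degree_part_sub.
  rewrite rho_suml // big_seq; apply: sub_sum => [|i is_]; first exact: degree_part_sub.
  rewrite rhoZl; last exact: tb_Fel.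
  apply: subZ; first exact: degree_part_sub.
  have [i1 i2] := sP i is_.
  rewrite (_ : t' + n%:Z = t' - (i + - n%:Z - i)); last by ring.
  have di : (`|i : int| <= N)%N by clear -i1 tJ t0 JN; lia.
  have dj : (`|i + - n%:Z : int| <= N)%N by clear -i2 tJ t0 JN; lia.
  have := degree_part_X Xop_br (@Xop_diag N) Xop_pos di dj wt.
  by apply.
rewrite rhoZl // rho_central; case: (posnP n) => [n0|n0].
  rewrite n0 addr0; apply: subZ; first exact: degree_part_sub.
  by apply: subZ => //; apply: degree_part_sub.
by rewrite zn // scale0r; apply: degree_part_0.
Qed.

Lemma wsp_graded N (nu : {ffun 'I_N -> int}) u : wsp Xop v nu u -> graded_part L (- deg nu) u.
Proof.
elim=> [|nu'|nu' a u' w' _ IHu _ IHw|nu' i j u' iN jN _ _ IH].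
- by rewrite deg0 oppr0; case: (hw_vector H).
- by case: (graded_part_sub (- deg nu')).
- by case: (graded_part_sub (- deg nu')) => _; apply.
have hF := hg_Fel F i j; rewrite !degD degN !deg_dlt // opprD.
case: (- deg nu') IH => [] m /= hu.
  by have := hw_degree H hF.1 hF.2 hu; apply.
by rewrite hu linear0; case: (graded_part_sub (Negz m - (j - i))).
Qed.

(** The coordinates of 2 (Lambda + rho) are tc - 2 lambda_(k+1) + 2k + 1, with k counted from 0:
    hence e = tc + 1 and a_k = k - lambda_(k+1). *)
Lemma truncated_dim N J : (n1 + 2 * J <= N)%N -> exists d : nat, has_dim (L J) d /\
  exists S : fps rat, S * \prod_(b <- pos_roots N) (1 - qvar rat ^+ `|deg b|%N) =
    weyl_product (tc%:Z + 1) [ffun k : 'I_N => k%:Z - (lam k.+1)%:Z] rat /\ fcoef S J = d%:R.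
Proof.
move=> JN.
have frx (nu : {ffun 'I_N -> int}) : inhabited (frame (wsp Xop v nu)) by apply: wsp_frame.
pose fr (nu : {ffun 'I_N -> int}) : frame (wsp Xop v nu) :=
  let: exist f _ := cid (match frx nu with inhabits f => ex_intro (fun=> True) f I end) in f.
have LJ : L J = degree_part Xop N v J%:Z.
  apply/seteqP; split=> u.
    by move=> Lu; apply: gen_degree_part JN (gen_v Lu) (lexx _).
  elim=> [nu w nuJ /wsp_graded||a w w' _ IHw _ IHw'].
  - by rewrite nuJ opprK.
  - by case: (graded_part_sub J%:Z).
  - by case: (graded_part_sub J%:Z) => _; apply.
have [d [dimd Sd]] := degree_part_dim Xop_br (@Xop_diag N) fr J.
exists d; rewrite LJ; split=> //; eexists; split; last exact: Sd.
have lev : forall p, (p < N)%N -> exists K, iter K (Xop p.+1 p) v = 0.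
  by move=> p _; apply: Xop_nil.
apply: (@spec_frame_dim F V Xop N (doubled_weight N) v XopN Xop_br (@Xop_diag N) Xop_pos lev
  fr (fun p => (levels p)%:Z) (@levelsE N)).
- by case: (hw_vector H).
- by move=> k; rewrite !ffunE; lia.
move=> p pN; have -> : twice_shifted (doubled_weight N) =
    [ffun k : 'I_N => (tc%:Z + 1) + 2 * (k%:Z - (lam k.+1)%:Z)].
  by apply/ffunP => k; rewrite !ffunE; lia.
rewrite /pair_coroot crd_Ordinal ffunE.
case: p pN => [|p] pN; first by rewrite eqxx crd0 /=; lia.
rewrite (crd_Ordinal _ (ltnW pN)) ffunE /= mulr1.
by have := lam_decr (ltn0Sn p); lia.
Qed.

End HighestWeightModule.

(** * From b_infty to tb_infty *)

Section Untwist.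
Variable F : numFieldType.
Implicit Types (x y : ghat F) (i j k : int).

(* d_i d_{-i} = (-1)^i, so that conjugation by diag(d_i) exchanges the forms
   defining b_infty and tb_infty. *)
Definition dsign i : F := if 0 < i then (-1) ^ i else 1.

Lemma sqr_sign i : (-1) ^ i * (-1) ^ i = 1 :> F.
Proof. by rewrite -exprzMl ?unitrN1 // mulrNN mulr1 exp1rz. Qed.

Lemma dsign_sqr i : dsign i * dsign i = 1.
Proof. by rewrite /dsign; case: ifP => _; rewrite ?mulr1 ?sqr_sign. Qed.

Lemma dsignN i : dsign (- i) = (-1) ^ i * dsign i.
Proof.
rewrite /dsign oppr_gt0; case: (ltrgtP i 0) => [i0|i0|->]; last by rewrite expr0z mulr1.
  by rewrite mulr1 -exprz_inv invrN1.
by rewrite sqr_sign.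
Qed.

Definition untwist x : ghat F := (fun i j => dsign i * dsign j * x.1 i j, x.2).

Lemma untwistK : involutive untwist.
Proof.
move=> x; apply: ghat_eq => // i j.
by rewrite /untwist /= mulrA mulrACA !dsign_sqr !mul1r.
Qed.

Lemma untwist_lin a x y : untwist (a *: x + y) = a *: untwist x + untwist y.
Proof.
apply: ghat_eq => [i j|]; last exact: erefl.
rewrite add1E scale1E -[LHS]/(dsign i * dsign j * (a *: x + y).1 i j) add1E scale1E.
by rewrite mulrDr mulrCA.
Qed.

Lemma untwist_deg d x : hat_deg d x -> hat_deg d (untwist x).
Proof. by case=> h1 h2; split=> // i j ij; rewrite /untwist /= h1 // mulr0. Qed.

Lemma untwist_deg0 x : hat_deg 0 x -> untwist x = x.
Proof.
case=> h _; apply: ghat_eq => // i j; rewrite /untwist /=.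
case: (eqVneq i j) => [->|ij]; first by rewrite dsign_sqr mul1r.
by rewrite h ?mulr0 // subr_eq0 eq_sym.
Qed.

Lemma untwist_gl x : is_gl x.1 -> is_gl (untwist x).1.
Proof.
apply: sub_finite_set => d [k nz]; exists k.
by apply: contraNneq nz; rewrite /untwist /= => ->; rewrite mulr0.
Qed.

Lemma sign_parity i j : (-1) ^ (i + j + 1) = - ((-1) ^ i * (-1) ^ j) :> F.
Proof. by rewrite !exprzDr ?unitrN1 // expr1z mulrN1. Qed.

Lemma untwist_b x : b_infty x -> tb_infty (untwist x).
Proof.
case=> gx sx; split; first exact: untwist_gl.
move=> i j; rewrite /untwist /= sx sign_parity !dsignN.
by move: ((-1) ^ i : F) ((-1) ^ j : F) (dsign i) (dsign j) => *; ring.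
Qed.

Lemma untwist_tb x : tb_infty x -> b_infty (untwist x).
Proof.
case=> gx sx; split; first exact: untwist_gl.
move=> i j; rewrite /untwist /= sx sign_parity !dsignN.
have := sqr_sign i; have := sqr_sign j.
move: ((-1) ^ i : F) ((-1) ^ j : F) (dsign i) (dsign j) => a b c d bb aa.
rewrite -[LHS]mul1r -aa -[LHS]mul1r -bb; ring.
Qed.

Lemma zmulmx_untwist (A B : zmat F) :
  zmulmx (fun i j => dsign i * dsign j * A i j) (fun i j => dsign i * dsign j * B i j) =
  (fun i j => dsign i * dsign j * zmulmx A B i j).
Proof.
apply/funext => i; apply/funext => j; rewrite /zmulmx mulr_fsumr; apply: eq_fsbigr => k _.
by rewrite -[RHS]mul1r -(dsign_sqr k); ring.
Qed.

Lemma untwist_br x y : hatbr (untwist x) (untwist y) = untwist (hatbr x y).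
Proof.
have JE : Jmx F = fun i j => dsign i * dsign j * Jmx F i j.
  apply/funext => i; apply/funext => j; rewrite /Jmx.
  by case: eqP => [->|_]; rewrite ?mulr0 // dsign_sqr mul1r.
apply: ghat_eq => [i j|].
  rewrite /hatbr /untwist /= !fctE !zmulmx_untwist.
  by rewrite mulrBr.
rewrite -[LHS]/(cocycle _ _) -[RHS]/(cocycle _ _) /cocycle {1}JE [X in _ - zmulmx _ X]JE /untwist /=.
rewrite !zmulmx_untwist.
rewrite (_ : (_ - _) = fun i j => dsign i * dsign j * (zmulmx (Jmx F) x.1 - zmulmx x.1 (Jmx F)) i j).
  by rewrite zmulmx_untwist /ztrace; apply: eq_fsbigr => k _; rewrite dsign_sqr mul1r.
by apply/funext => i; apply/funext => j; rewrite !fctE mulrBr.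
Qed.

(** Conjugation by a diagonal matrix fixes the elements of degree 0 and commutes with J, so the
    weight, the gradation and the cocycle are unchanged. *)
Lemma untwist_module (V : lmodType F) (La : ghat F -> F) (rho : ghat F -> V -> V)
    (L : nat -> set V) (v : V) :
  irr_highest_weight_module (@b_infty F) La rho L v ->
  irr_highest_weight_module (@tb_infty F) La (rho \o untwist) L v.
Proof.
case=> [[r1 r2 r3] gr dg vec wt kl gen irr].
have subm W : submodule (@tb_infty F) (rho \o untwist) W -> submodule (@b_infty F) rho W.
  case=> sW aW; split=> // x w gx Ww; rewrite -[x]untwistK.
  by apply: aW => //; apply: untwist_b.
split=> //.
- split=> [x gx|x y gx gy a u|x y gx gy u] /=.
  + exact/r1/untwist_tb.
  + by rewrite untwist_lin; apply: r2; apply: untwist_tb.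
  + by rewrite -untwist_br; apply: r3; apply: untwist_tb.
- by move=> d x j u gx /untwist_deg hx; apply: dg => //; apply: untwist_tb.
- by move=> x gx hx; rewrite /= -[in RHS](untwist_deg0 hx); apply: wt; [exact: untwist_tb | exact: untwist_deg].
- by move=> d x d0 gx hx; apply: (kl d) => //; [exact: untwist_tb | exact: untwist_deg].
- by move=> W /subm; apply: gen.
- by move=> W /subm; apply: irr.
Qed.

End Untwist.

(** * Finite product identities *)

(* The finite product identities hold for any sequence [q] in place of 1 - q^m. *)
Section ProductIdentities.
Variables (R : comNzRingType) (q : nat -> R).

Definition qfact n : R := \prod_(1 <= j < n.+1) q j.

Lemma qfactS n : qfact n.+1 = qfact n * q n.+1.
Proof. by rewrite /qfact big_nat_recr. Qed.

Lemma qfact0 : qfact 0 = 1.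
Proof. by rewrite /qfact big_nil. Qed.

Lemma qfactD a b : qfact (a + b) = qfact a * \prod_(0 <= i < b) q (a + i).+1.
Proof.
elim: b => [|b IH]; first by rewrite addn0 big_nil mulr1.
by rewrite addnS qfactS IH big_nat_recr //= mulrA.
Qed.

(** The product over the pairs i <= j in the Weyl numerator for lambda = 0; with [tc = 0] it is the
    corresponding part of the denominator. *)
Definition eprod (tc N : nat) : R :=
  \prod_(0 <= j < N) \prod_(0 <= i < j.+1) q (tc + (i + j).+1).

Lemma eprodS tc N : eprod tc N.+1 = eprod tc N * \prod_(0 <= i < N.+1) q (tc + (i + N).+1).
Proof. by rewrite /eprod big_nat_recr. Qed.

Lemma eprod0 tc : eprod tc 0 = 1.
Proof. by rewrite /eprod big_geq. Qed.

(** Adding 2 to [tc] amounts to replacing (i, j) by (i + 1, j + 1); the pairs with i = 0 are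
    missing. *)
Lemma eprod_shift2 tc N :
  eprod tc.+2 N * \prod_(0 <= j < N.+1) q (tc + j).+1 = eprod tc N.+1.
Proof.
elim: N => [|N IH]; first by rewrite eprodS !eprod0 !big_nat1 addnS addn0.
rewrite [RHS]eprodS -IH [in LHS]eprodS (big_nat_recr N.+1) //= -!mulrA; congr (_ * _).
rewrite [LHS]mulrCA; congr (_ * _); rewrite mulrC [RHS]big_nat_recl //.
congr (_ * _); first by congr (q _); lia.
by apply: eq_bigr => i _; congr (q _); lia.
Qed.

(** Adding 1 to [tc] amounts to replacing (i, j) by (i, j + 1); the diagonal pairs, with odd values
    2i + 1, are missing. *)
Lemma eprod1_odd N : eprod 1 N * \prod_(0 <= i < N.+1) q (2 * i).+1 = eprod 0 N.+1.
Proof.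
elim: N => [|N IH]; first by rewrite eprodS !eprod0 !big_nat1.
rewrite [RHS]eprodS -IH [in LHS]eprodS !(big_nat_recr N.+1) //= -!mulrA; congr (_ * _).
rewrite [LHS]mulrCA; congr (_ * _); congr (_ * _); last by congr (q _); lia.
by apply: eq_bigr => i _; congr (q _); lia.
Qed.

Lemma odd_even_qfact n :
  (\prod_(0 <= i < n) q (2 * i).+1) * (\prod_(1 <= i < n.+1) q (2 * i)) = qfact (2 * n).
Proof.
elim: n => [|n IH]; first by rewrite big_geq // big_geq // mulr1 qfact0.
rewrite big_nat_recr //= big_nat_recr //= mulrACA IH mulnS !qfactS -mulrA.
by congr (_ * (_ * _)); congr (q _); lia.
Qed.

Lemma prod_triangle m (f : nat -> nat -> R) :
  \prod_(0 <= i < m.+1) \prod_(i.+1 <= j < m.+1) f i j =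
  \prod_(0 <= j < m) \prod_(0 <= i < j.+1) f i j.+1.
Proof.
elim: m => [|m IH]; first by rewrite big_nat1 !big_geq.
rewrite [RHS]big_nat_recr //= -IH big_nat_recr //= [X in _ * X]big_geq // mulr1 -big_split /=.
by apply: eq_big_nat => i /andP[_ im]; rewrite big_nat_recr.
Qed.

Section SignedPart.
Variables (tc m : nat) (l : nat -> nat).
Hypothesis l_support : forall i, (m <= i)%N -> l i = 0%N.
Hypothesis l_level : forall i, (2 * l i <= tc)%N.

Definition bprod (N : nat) : R :=
  \prod_(0 <= j < N) \prod_(0 <= i < j.+1) q (tc + (i + j).+1 - l i - l j).

(** For j >= m the factors of the two products differ only in the rows i < m, where [l i] shifts the
    argument; along a row they telescope to quotients of [qfact]. The identity is multiplied out
    because [q] is arbitrary. *)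
Lemma bprod_eprod M :
  bprod (m + M) * eprod tc m *
    \prod_(0 <= i < m) (qfact (tc + i + m - l i) * qfact (tc + i + m + M)) =
  eprod tc (m + M) * bprod m *
    \prod_(0 <= i < m) (qfact (tc + i + m) * qfact (tc + i + m + M - l i)).
Proof.
elim: M => [|M IH].
  rewrite addn0 [bprod m * _]mulrC; congr (_ * _); apply: eq_bigr => i _.
  by rewrite addn0 mulrC.
have split_row (h : nat -> nat -> nat) : \prod_(0 <= i < (m + M).+1) q (h i (m + M)%N) =
    (\prod_(0 <= i < m) q (h i (m + M)%N)) * \prod_(m <= i < (m + M).+1) q (h i (m + M)%N).
  by rewrite (@big_cat_nat _ _ _ m) //= ltnW // ltnS leq_addr.
have lhs : \prod_(0 <= i < m) (qfact (tc + i + m - l i) * qfact (tc + i + m + M.+1)) =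
    (\prod_(0 <= i < m) (qfact (tc + i + m - l i) * qfact (tc + i + m + M))) *
    \prod_(0 <= i < m) q (tc + (i + (m + M)).+1).
  rewrite -big_split; apply: eq_bigr => i _ /=; rewrite addnS qfactS mulrA.
  by congr (_ * q _); lia.
have rhs : \prod_(0 <= i < m) (qfact (tc + i + m) * qfact (tc + i + m + M.+1 - l i)) =
    (\prod_(0 <= i < m) (qfact (tc + i + m) * qfact (tc + i + m + M - l i))) *
    \prod_(0 <= i < m) q (tc + (i + (m + M)).+1 - l i - l (m + M)).
  rewrite -big_split; apply: eq_bigr => i _ /=; have li := l_level i.
  rewrite (_ : tc + i + m + M.+1 - l i = (tc + i + m + M - l i).+1)%N; last by lia.
  rewrite qfactS mulrA; congr (_ * q _); rewrite (l_support (leq_addr M m)); lia.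
rewrite lhs rhs addnS eprodS /bprod big_nat_recr //= -/(bprod (m + M)) -/(bprod m).
rewrite (split_row (fun i j => (tc + (i + j).+1 - l i - l j)%N)).
rewrite (split_row (fun i j => (tc + (i + j).+1)%N)).
rewrite (_ : \prod_(m <= i < (m + M).+1) q (tc + (i + (m + M)).+1 - l i - l (m + M)) =
  \prod_(m <= i < (m + M).+1) q (tc + (i + (m + M)).+1)); last first.
  by apply: eq_big_nat => i /andP[mi _]; rewrite !l_support ?leq_addr // !subn0.
move: IH; move: (bprod _) (eprod _ _) (eprod _ _) (bprod _) => a b c d.
set x := \prod_(0 <= i < m) _; set y := \prod_(0 <= i < m) _ => IH.
set z := \prod_(m <= i < _) _; set s := \prod_(0 <= i < m) _; set t := \prod_(0 <= i < m) _.
transitivity ((d * c * x) * (s * t * z)); first by ring.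
by rewrite IH; ring.
Qed.
End SignedPart.

Definition aprod (l : nat -> nat) (N : nat) : R :=
  \prod_(0 <= j < N) \prod_(0 <= i < j) q (l i - l j + (j - i)).

(** Differences between the first n entries do not change; for i < n <= j the argument grows by 1,
    and the quotients telescope in j. *)
Lemma aprod_add_column (n : nat) (l : nat -> nat) M : (forall i, (n <= i)%N -> l i = 0%N) ->
  aprod (fun i => (i < n) + l i)%N (n + M) * \prod_(0 <= i < n) q (l i + n - i) =
  aprod l (n + M) * \prod_(0 <= i < n) q (l i + (n + M) - i).
Proof.
move=> l0; elim: M => [|M IH].
  rewrite addn0; congr (_ * _); apply: eq_big_nat => j /andP[_ jn].
  by apply: eq_big_nat => i /andP[_ ij]; rewrite jn (ltn_trans ij jn); congr (q _); lia.
have split_row (h : nat -> nat) : \prod_(0 <= i < n + M) q (h i) =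
    (\prod_(0 <= i < n) q (h i)) * \prod_(n <= i < n + M) q (h i).
  by rewrite (@big_cat_nat _ _ _ n) //= leq_addr.
rewrite addnS /aprod !big_nat_recr //= -/(aprod _ _) -/(aprod _ _) !split_row.
have -> : \prod_(n <= i < n + M) q ((i < n) + l i - ((n + M < n) + l (n + M)) + (n + M - i)) =
  \prod_(n <= i < n + M) q (l i - l (n + M) + (n + M - i)).
  by apply: eq_big_nat => i /andP[ni _]; congr (q _); lia.
have -> : \prod_(0 <= i < n) q ((i < n) + l i - ((n + M < n) + l (n + M)) + (n + M - i)) =
  \prod_(0 <= i < n) q (l i + (n + M).+1 - i).
  apply: eq_big_nat => i /andP[_ iN]; have := l0 (n + M)%N (leq_addr _ _).
  by move=> ->; congr (q _); lia.
have -> : \prod_(0 <= i < n) q (l i - l (n + M) + (n + M - i)) =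
  \prod_(0 <= i < n) q (l i + (n + M) - i).
  apply: eq_big_nat => i /andP[_ iN]; have := l0 (n + M)%N (leq_addr _ _).
  by move=> ->; congr (q _); lia.
move: IH; move: (aprod _ _) (aprod _ _) => a b.
move: (\prod_(n <= i < _) _) => z.
set x := \prod_(0 <= i < n) q (l i + n - i); set y := \prod_(0 <= i < n) _ => IH.
set t := \prod_(0 <= i < n) _.
by rewrite mulrAC IH; ring.
Qed.

Lemma geq_trans : transitive geq.
Proof. by move=> y x z yx zy; apply: leq_trans zy yx. Qed.

Lemma prod_down c n : \prod_(0 <= i < n) q (c + n - i) = \prod_(0 <= i < n) q (c + i).+1.
Proof.
rewrite big_nat_rev; apply: eq_big_nat => i /andP[_ iN]; congr (q _); lia.
Qed.

(* The hook lengths of the first row of the Young diagram of [n :: ns] and their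
   complement in 1, ..., n + size ns. *)
Lemma hook_complement (n : nat) (ns : seq nat) : sorted geq ns -> all (leq^~ n) ns ->
  \prod_(0 <= i < n) q (conj_part ns i.+1 + n - i) *
  \prod_(0 <= j < size ns) q (n - nth 0%N ns j + j.+1) = qfact (n + size ns).
Proof.
elim/last_ind: ns => [|ns m IH].
  rewrite [X in _ * X]big_geq // mulr1 addn0 /conj_part /= prod_down /qfact big_add1.
  by move=> _ _; apply: eq_bigr.
rewrite all_rcons => sns /andP[mn nsn].
have [sns' ms] : sorted geq ns /\ all (leq m) ns.
  by move: sns; rewrite !(sorted_pairwise geq_trans) pairwise_rcons => /andP[].
have cE i : conj_part (rcons ns m) i.+1 = (conj_part ns i.+1 + (i < m))%N.
  by rewrite /conj_part -cats1 count_cat /= addn0.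
have cm i : (i < m)%N -> conj_part ns i.+1 = size ns.
  by move=> im; apply/eqP; rewrite -all_count; apply: sub_all ms => x; apply: leq_trans im.
rewrite size_rcons big_nat_recr //= nth_rcons ltnn eqxx (addnS n) qfactS -(IH sns' nsn) -mulrA mulrCA.
rewrite [RHS]mulrCA.
rewrite (_ : \prod_(0 <= i < size ns) q (n - nth 0%N (rcons ns m) i + i.+1) =
  \prod_(0 <= i < size ns) q (n - nth 0%N ns i + i.+1)); last first.
  by apply: eq_big_nat => i /andP[_ iN]; rewrite nth_rcons iN.
congr (_ * _).
rewrite !(@big_cat_nat _ _ _ m 0 n) //=.
rewrite (_ : \prod_(m <= i < n) q (conj_part (rcons ns m) i.+1 + n - i) =
  \prod_(m <= i < n) q (conj_part ns i.+1 + n - i)); last first.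
  by apply: eq_big_nat => i /andP[mi _]; rewrite cE ltnNge mi addn0.
rewrite [LHS]mulrAC [RHS]mulrAC; congr (_ * _).
rewrite (_ : \prod_(0 <= i < m) q (conj_part (rcons ns m) i.+1 + n - i) =
  \prod_(0 <= i < m) q ((size ns + n).+1 - i)); last first.
  by apply: eq_big_nat => i /andP[_ im]; rewrite cE cm // im; congr (q _); lia.
rewrite (_ : \prod_(0 <= i < m) q (conj_part ns i.+1 + n - i) =
  \prod_(0 <= i < m) q ((size ns + n).+1 - i.+1)); last first.
  by apply: eq_big_nat => i /andP[_ im]; rewrite cm.
transitivity (\prod_(0 <= i < m.+1) q ((size ns + n).+1 - i)).
  by rewrite big_nat_recr //=; congr (_ * q _); lia.
by rewrite big_nat_recl //= mulrC; congr (_ * q _); lia.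
Qed.

Definition anum (ns : seq nat) : R :=
  \prod_(1 <= i < (size ns).+1) \prod_(i.+1 <= j < (size ns).+1)
    q ((nth1 ns i - nth1 ns j) + (j - i)).

Definition aden (ns : seq nat) : R :=
  \prod_(1 <= i < (size ns).+1) qfact (nth1 ns i + (size ns - i)).

Lemma anum_cons n ns :
  anum (n :: ns) = (\prod_(0 <= j < size ns) q (n - nth 0%N ns j + j.+1)) * anum ns.
Proof.
rewrite /anum big_ltn //; congr (_ * _).
  rewrite big_add1 big_add1; apply: eq_bigr => j _ /=.
  by rewrite subn1.
rewrite big_add1; apply: eq_big_nat => -[|i] // _.
by rewrite big_add1; apply: eq_big_nat => -[|j].
Qed.

Lemma aden_cons n ns : aden (n :: ns) = qfact (n + size ns) * aden ns.
Proof.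
rewrite /aden big_ltn //; congr (_ * _); first by rewrite /= subn1.
by rewrite big_add1; apply: eq_big_nat => -[|i].
Qed.

(** Prepending the part n adds 1 to the first n entries of the conjugate partition; the hook lengths
    that appear are exchanged for their complement in 1, ..., n + [size ns]. *)
Lemma aprod_conj_cons n ns M : sorted geq (n :: ns) ->
  aprod (fun i => conj_part (n :: ns) i.+1) (n + M) * qfact (n + size ns) =
  aprod (fun i => conj_part ns i.+1) (n + M) *
    (\prod_(0 <= i < n) q (conj_part ns i.+1 + (n + M) - i)) *
    \prod_(0 <= j < size ns) q (n - nth 0%N ns j + j.+1).
Proof.
rewrite (sorted_pairwise geq_trans) /= => /andP[nsn]; rewrite -(sorted_pairwise geq_trans) => sns.
rewrite -(hook_complement sns nsn) mulrA -aprod_add_column // => i ni.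
apply/eqP; rewrite -leqn0 leqNgt -has_count; apply/hasPn => x /(allP nsn) xn.
by rewrite -leqNgt (leq_trans xn).
Qed.

End ProductIdentities.

(** * Passing to the character modulo q^(J+1) *)

Section Congruence.
Variable J : nat.
Local Notation S := (fps rat).
Implicit Types f g : S.

Definition eqm f g : Prop := forall j, (j <= J)%N -> fcoef f j = fcoef g j.

Lemma eqm_sym f g : eqm f g -> eqm g f.
Proof. by move=> fg j jJ; rewrite fg. Qed.

Lemma eqm_trans g f h : eqm f g -> eqm g h -> eqm f h.
Proof. by move=> fg gh j jJ; rewrite fg // gh. Qed.

Lemma eqmM f g f' g' : eqm f g -> eqm f' g' -> eqm (f * f') (g * g').
Proof.
move=> fg fg' j jJ; rewrite !fcoefM; apply: eq_bigr => i _.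
by rewrite fg ?fg' //; apply: leq_trans jJ; rewrite ?leq_subr // -ltnS.
Qed.

Lemma eqm_mulI u f g : u \is a GRing.unit -> eqm (f * u) (g * u) -> eqm f g.
Proof. by move=> uu fg; rewrite -(mulrK uu f) -(mulrK uu g); apply: eqmM. Qed.

Lemma eqm_div f g u : u \is a GRing.unit -> eqm (f * u) g -> eqm f (g / u).
Proof. by move=> uu fg; apply: (eqm_mulI uu); rewrite divrK. Qed.

Definition qf (m : nat) : S := 1 - qvar rat ^+ m.

Lemma qf_unit m : (0 < m)%N -> qf m \is a GRing.unit.
Proof.
move=> m0; rewrite fps_unitE fcoefD fcoefN qvarX /=.
by rewrite (ltn_eqF m0) subr0.
Qed.

Lemma eqm_qf1 m : (J < m)%N -> eqm (qf m) 1.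
Proof.
move=> Jm j jJ; rewrite fcoefD fcoefN qvarX (_ : (j == m) = false) ?subr0 //.
by rewrite ltn_eqF // (leq_ltn_trans jJ).
Qed.

Lemma eqm_prod1 (I : eqType) (r : seq I) (f : I -> S) :
  (forall i, i \in r -> eqm (f i) 1) -> eqm (\prod_(i <- r) f i) 1.
Proof.
move=> f1; rewrite big_seq; apply: (big_ind (eqm^~ 1)) => //.
by move=> x y hx hy; rewrite -[1]mulr1; apply: eqmM.
Qed.

Lemma eqm_prod (I : eqType) (r : seq I) (f g : I -> S) :
  (forall i, i \in r -> eqm (f i) (g i)) -> eqm (\prod_(i <- r) f i) (\prod_(i <- r) g i).
Proof.
move=> fg; rewrite big_seq [\prod_(i <- r) g i]big_seq.
by apply: (big_ind2 eqm) => // x y z t; apply: eqmM.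
Qed.

Lemma prod_unit (I : eqType) (r : seq I) (f : I -> S) :
  (forall i, i \in r -> f i \is a GRing.unit) -> \prod_(i <- r) f i \is a GRing.unit.
Proof. by move=> fu; rewrite big_seq; apply: rpred_prod. Qed.

Lemma prodr_div (I : eqType) (r : seq I) (f g : I -> S) :
  (forall i, i \in r -> g i \is a GRing.unit) ->
  \prod_(i <- r) (f i / g i) = (\prod_(i <- r) f i) / \prod_(i <- r) g i.
Proof.
move=> gu; apply: (mulIr (prod_unit gu)); rewrite divrK ?prod_unit // -big_split /=.
by rewrite big_seq [RHS]big_seq; apply: eq_bigr => i ir; rewrite divrK ?gu.
Qed.

Local Notation phi := (qfact qf).

Lemma phi_unit m : phi m \is a GRing.unit.
Proof. by apply: prod_unit => j; rewrite mem_index_iota => /andP[j0 _]; apply: qf_unit. Qed.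

Lemma eqm_phi m n : (J <= m)%N -> (J <= n)%N -> eqm (phi m) (phi n).
Proof.
have H a b : (J <= a)%N -> eqm (phi (a + b)) (phi a).
  move=> Ja; rewrite qfactD -[X in eqm _ X]mulr1; apply: eqmM => //.
  by apply: eqm_prod1 => i _; apply: eqm_qf1; rewrite ltnS; apply: leq_trans Ja (leq_addr _ _).
by move=> Jm Jn; apply: (@eqm_trans (phi (m + n))); [apply/eqm_sym/H | rewrite addnC; apply: H].
Qed.

End Congruence.

Lemma eqm_euler_phi J m n : (0 < m)%N -> (J <= n)%N ->
  eqm J (euler_phi rat m) (\prod_(1 <= j < n.+1) qf (m * j)).
Proof.
move=> m0 Jn j jJ; rewrite /euler_phi /fps_prod_inf /=.
have jn : (j.+1 <= n.+1)%N by apply: leq_trans Jn.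
rewrite (@big_cat_nat _ _ _ j.+1 1 n.+1) //=.
set P := \prod_(1 <= i < j.+1) _; have -> : P = \prod_(1 <= i < j.+1) qf (m * i) by [].
rewrite -[LHS]/(fcoef _ j) -[X in fcoef X j = _]mulr1.
apply: (@eqmM j _ _ 1) => //; apply/eqm_sym/eqm_prod1 => i.
rewrite mem_index_iota => /andP[ji _]; apply: eqm_qf1.
by apply: leq_trans ji (leq_pmull _ m0).
Qed.

Lemma eqm_euler_phi1 J n : (J <= n)%N -> eqm J (euler_phi rat 1) (qfact qf n).
Proof.
move=> Jn; rewrite (_ : qfact qf n = \prod_(1 <= j < n.+1) qf (1 * j)); first exact: eqm_euler_phi.
by apply: eq_bigr => j _; rewrite mul1n.
Qed.

Lemma euler_phi_unit m : (0 < m)%N -> euler_phi rat m \is a GRing.unit.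
Proof. by move=> m0; rewrite fps_unitE /= big_geq. Qed.

Lemma eprod_unit tc N : eprod qf tc N \is a GRing.unit.
Proof. by apply: prod_unit => j _; apply: prod_unit => i _; apply: qf_unit; rewrite addnS. Qed.

(** The limit of [eprod tc N / eprod 0 N] for large N, the factor of the formula that depends on the
    level alone. *)
Definition level_factor (tc : nat) : fps rat :=
  (euler_phi rat 2 ^+ (~~ odd tc.+1) * \prod_(1 <= j < tc.+1) qfact qf (tc - 2 * j)%N)
    / euler_phi rat 1 ^+ (tc.+1 %/ 2).

Lemma level_factorSS tc : level_factor tc.+2 * euler_phi rat 1 = level_factor tc * qfact qf tc.
Proof.
rewrite /level_factor /= !negbK (_ : tc.+3 %/ 2 = (tc.+1 %/ 2).+1)%N; last by lia.
rewrite big_ltn // big_add1 /= (eq_bigr (fun j => qfact qf (tc - 2 * j))); last first.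
  by move=> j _; rewrite mulnS.
rewrite big_nat_recr //= (_ : (tc - 2 * tc.+1)%N = 0%N); last by lia.
rewrite (_ : (tc.+2 - 2 * 1)%N = tc); last by lia.
have u1 := euler_phi_unit (isT : (0 < 1)%N); have ux := unitrX (tc.+1 %/ 2)%N u1.
rewrite qfact0 mulr1 exprS; move: (_ ^+ _ : fps rat) (\prod_(1 <= j < tc.+1) _) (qfact _ _) => a b c.
move: (euler_phi rat 1) u1 (_ ^+ _) ux => p up r ur.
have -> : (p * r)^-1 = r^-1 / p by rewrite invrM.
by rewrite mulrA divrK // [c * b]mulrC mulrA mulrAC.
Qed.

(** Induction on [tc] in steps of 2: [eprod_shift2] leaves the product of all q(m) with m > tc,
    which is phi(q) / phi_tc(q) up to high order. *)
Lemma eqm_eprod J tc N : (J <= N)%N -> eqm J (eprod qf tc N) (eprod qf 0 N * level_factor tc).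
Proof.
move=> JN; have u1 := euler_phi_unit (isT : (0 < 1)%N).
have large (f : nat -> nat) : (forall i, (J < f i)%N) -> eqm J (\prod_(0 <= i < N.+1) qf (f i)) 1.
  by move=> fJ; apply: eqm_prod1 => i _; apply: eqm_qf1.
elim/ltn_ind: tc => -[|[|tc]] IH.
- by rewrite /level_factor /= big_geq // expr0 expr0 !mulr1 divr1 mulr1.
- rewrite /level_factor /= big_nat1 qfact0 mulr1 !expr1 mulrA; apply: eqm_div => //.
  (* For [tc = 1] the odd factors are missing; phi(q) divided by them is phi(q^2), which explains
     the parity exponent. *)
  have oe : eqm J (euler_phi rat 1)
      ((\prod_(0 <= i < N.+1) qf (2 * i).+1) * \prod_(1 <= i < N.+2) qf (2 * i)).
    by rewrite odd_even_qfact; apply: eqm_euler_phi1; lia.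
  apply: (eqm_trans (eqmM _ oe)) => //; rewrite mulrA eprod1_odd eprodS.
  apply: eqmM; last by apply/eqm_sym/eqm_euler_phi; lia.
  by rewrite -[X in eqm _ _ X]mulr1; apply: eqmM => //; apply: large => i; lia.
apply: (eqm_mulI u1); rewrite -mulrA level_factorSS mulrA.
apply: (@eqm_trans _ (eprod qf tc.+2 N * qfact qf (tc + N.+1))).
  by apply: eqmM => //; apply: eqm_euler_phi1; lia.
rewrite qfactD [qfact qf tc * _]mulrC mulrA eprod_shift2; apply: eqmM => //.
rewrite eprodS; apply: (@eqm_trans _ (eprod qf tc N * 1)); first by apply: eqmM => //; apply: large => i; lia.
by rewrite mulr1; apply: IH.
Qed.

Section SignedPartLimit.
Variables (J tc m : nat) (l : nat -> nat).
Hypothesis l_support : forall i, (m <= i)%N -> l i = 0%N.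
Hypothesis l_level : forall i, (2 * l i <= tc)%N.

(** In [bprod_eprod] the products that depend on the number M of additional columns become congruent
    and cancel. *)
Lemma eqm_bprod N : (m + J <= N)%N ->
  eqm J (bprod qf tc l N) (eprod qf tc N *
    ((\prod_(0 <= i < m) (qfact qf (tc + i + m) / qfact qf (tc + m + i - l i))) *
     \prod_(0 <= i < m.+1) \prod_(i.+1 <= j < m.+1)
       (qf (tc + j + i - l i - l j.-1) / qf (tc + j + i)))).
Proof.
move=> mJN; have /subnKC NE : (m <= N)%N by lia.
set M := (N - m)%N in NE; rewrite -NE.
have ME : (J <= M)%N by rewrite /M; lia.
rewrite prod_triangle.
have -> : \prod_(0 <= j < m) \prod_(0 <= i < j.+1)
    (qf (tc + j.+1 + i - l i - l j.+1.-1) / qf (tc + j.+1 + i)) = bprod qf tc l m / eprod qf tc m.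
  have u i j : qf (tc + (i + j).+1) \is a GRing.unit by apply: qf_unit; lia.
  rewrite -prodr_div => [|j _]; last by apply: prod_unit.
  apply: eq_bigr => j _; rewrite -prodr_div //.
  by apply: eq_bigr => i _; congr (qf _ / qf _); rewrite /=; lia.
rewrite prodr_div => [|i _]; last exact: phi_unit.
have ue := eprod_unit tc m.
have up f : \prod_(0 <= i < m) qfact qf (f i) \is a GRing.unit.
  by apply: prod_unit => i _; apply: phi_unit.
(* Both indices are at least J, so both sides are products of truncations of phi(q). *)
have lim : eqm J (\prod_(0 <= i < m) qfact qf (tc + i + m + M))
    (\prod_(0 <= i < m) qfact qf (tc + i + m + M - l i)).
  by apply: eqm_prod => i _; have := l_level i; move=> li; apply: eqm_phi; lia.
apply: (eqm_mulI ue); apply: (eqm_mulI (up (fun i => tc + i + m - l i)%N)).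
apply: (eqm_mulI (up (fun i => tc + i + m + M)%N)).
have := bprod_eprod qf l_support l_level M; rewrite !big_split /= => E.
rewrite -[bprod _ _ _ _ * _ * _ * _]mulrA E.
apply: (@eqm_trans _ (eprod qf tc (m + M) * bprod qf tc l m *
  ((\prod_(0 <= i < m) qfact qf (tc + i + m)) * (\prod_(0 <= i < m) qfact qf (tc + i + m + M))))).
  by do 2! apply: eqmM => //; apply: eqm_sym.
have -> : \prod_(0 <= i < m) qfact qf (tc + m + i - l i) = \prod_(0 <= i < m) qfact qf (tc + i + m - l i).
  by apply: eq_bigr => i _; congr (qfact _ _); lia.
move: (up (fun i => tc + i + m - l i)%N) ue.
move: (\prod_(0 <= i < m) qfact qf (tc + i + m - l i)) => x ux.
move: (eprod qf tc m) => e ue.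
move: (eprod qf _ _) (bprod _ _ _ _) (\prod_(0 <= i < m) _) (\prod_(0 <= i < m) _) => a b c d.
have := mulVr ux; have := mulVr ue; move: x^-1 e^-1 => y f fe yx.
have -> : a * (d * y * (b * f)) * e * x * c = (a * b * (d * c)) * (f * e) * (y * x) by ring.
by rewrite fe yx !mulr1.
Qed.

End SignedPartLimit.

(** Remove the largest part: of the factors in [aprod_conj_cons], those containing N have exponents
    above J and are congruent to 1; the others build up [anum] and [aden]. *)
Lemma eqm_aprod J (ns : seq nat) N : sorted geq ns -> (nth1 ns 1 + J <= N)%N ->
  eqm J (aprod qf (fun i => conj_part ns i.+1) N * aden qf ns) (aprod qf (fun=> 0%N) N * anum qf ns).
Proof.
elim: ns => [|n ns IH] sns nN; first by rewrite /aden /anum !big_geq.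
have nsn : (nth1 ns 1 <= n)%N by case: (ns) sns => //= m s /andP[].
have snt : sorted geq ns by apply: path_sorted sns.
have IH' := IH snt (leq_trans (_ : (_ <= nth1 (n :: ns) 1 + J)%N) nN).
have /subnKC NE : (n <= N)%N by apply: leq_trans nN; rewrite /nth1 /= leq_addr.
rewrite -NE aden_cons mulrA aprod_conj_cons // NE anum_cons.
apply: (@eqm_trans _ (aprod qf (fun i => conj_part ns i.+1) N * 1 *
    \prod_(0 <= j < size ns) qf (n - nth 0%N ns j + j.+1) * aden qf ns)).
  do 3! apply: eqmM => //; apply: eqm_prod1 => i; rewrite mem_index_iota => /andP[_ iN].
  by apply: eqm_qf1; move: nN; rewrite /nth1 /=; lia.
rewrite mulr1 mulrAC [X in eqm _ _ (_ * X)]mulrC mulrA; apply: eqmM => //; apply: IH'.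
by rewrite leq_add2r.
Qed.

Lemma character_formulaE (ns : seq nat) (h : nat) :
  let tc := (2 * size ns + h)%N in let m := nth1 ns 1 in let lam := conj_part ns in
  character_formula ns h = anum qf ns / aden qf ns * level_factor tc *
    (\prod_(0 <= i < m) (qfact qf (tc + i + m) / qfact qf (tc + m + i - lam i.+1))) *
    \prod_(0 <= i < m.+1) \prod_(i.+1 <= j < m.+1)
      (qf (tc + j + i - lam i.+1 - lam j) / qf (tc + j + i)).
Proof. exact: erefl. Qed.

Lemma prod_upper_pairs (R : comNzRingType) N (f : nat -> nat -> R) :
  \prod_(i < N) \prod_(j < N | (i < j)%N) f i j = \prod_(0 <= j < N) \prod_(0 <= i < j) f i j.
Proof.
rewrite (exchange_big_dep xpredT) //= big_mkord; apply: eq_bigr => j _.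
by rewrite big_mkord (big_ord_widen N (fun i => f i j)) // ltnW.
Qed.

(** [bprod] also takes in the diagonal i = j, which stands for the short coroots. *)
Lemma weyl_productE (tc N : nat) (l : nat -> nat) :
  (forall i, 2 * l i <= tc)%N -> (forall i j, (i <= j)%N -> (l j <= l i)%N) ->
  weyl_product (tc%:Z + 1) [ffun k : 'I_N => k%:Z - (l k)%:Z] rat =
  bprod qf tc l N * aprod qf l N.
Proof.
move=> ltc lmono; rewrite /weyl_product.
have -> : \prod_(i < N) \prod_(j < N | (i < j)%N)
    ((1 - qvar rat ^+ `|([ffun k : 'I_N => k%:Z - (l k)%:Z] j - [ffun k : 'I_N => k%:Z - (l k)%:Z] i)%R|%N) *
     (1 - qvar rat ^+ `|(tc%:Z + 1 + [ffun k : 'I_N => k%:Z - (l k)%:Z] i +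
                         [ffun k : 'I_N => k%:Z - (l k)%:Z] j)%R|%N)) =
    \prod_(i < N) \prod_(j < N | (i < j)%N)
      (qf (l i - l j + (j - i)) * qf (tc + (i + j).+1 - l i - l j)).
  apply: eq_bigr => i _; apply: eq_bigr => j ij; rewrite !ffunE.
  have := lmono _ _ (ltnW ij); have := ltc i; have := ltc j => lj li ll.
  by congr ((1 - _ ^+ _) * (1 - _ ^+ _)); lia.
rewrite (prod_upper_pairs N (fun i j => qf (l i - l j + (j - i)) * qf (tc + (i + j).+1 - l i - l j))).
rewrite (eq_bigr (fun j : 'I_N => qf (tc + (j + j).+1 - l j - l j))); last first.
  move=> j _; rewrite !ffunE; have := ltc j => lj.
  by congr (1 - _ ^+ _); lia.
rewrite -(big_mkord xpredT (fun j => qf (tc + (j + j).+1 - l j - l j))).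
rewrite /bprod /aprod -!big_split; apply: eq_bigr => j _ /=.
by rewrite big_split big_nat_recr //= mulrC -mulrA mulrC.
Qed.

(** The roots [dlt j - dlt i] with i <= 0, short ones included, have heights j + |i| and give
    [eprod 0 N]; those with i > 0 give [aprod] of the zero sequence. *)
Lemma prod_pos_roots N : \prod_(b <- pos_roots N) (1 - qvar rat ^+ `|deg b|%N) =
  eprod qf 0 N * aprod qf (fun=> 0%N) N.
Proof.
rewrite /pos_roots big_map /pos_pairs big_allpairs_dep /eprod /aprod -big_split.
have -> : iota 0 N = index_iota 0 N by rewrite /index_iota subn0.
apply: eq_big_nat => m /andP[_ mN] /=.
rewrite big_seq (eq_bigr (fun i => qf `|(m.+1%:Z - i)%R|%N)); last first.
  move=> i; rewrite mem_sseq => im; congr (1 - _ ^+ _).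
  by rewrite /pair_root /= degD degN !deg_dlt //; lia.
rewrite -big_seq.
have P k : \prod_(i <- sseq k) qf `|(m.+1%:Z - i)%R|%N =
   \prod_(0 <= i < k.+1) qf `|(m.+1%:Z + i%:Z)%R|%N * \prod_(0 <= i < k) qf `|(m%:Z - i%:Z)%R|%N.
  elim: k => [|k IH]; first by rewrite big_seq1 big_nat1 big_geq // mulr1; congr (qf _); lia.
  rewrite [LHS]big_cons [X in _ * X = _]big_cons IH (big_nat_recr k.+1) //= !(big_nat_recr k) //=.
  have -> : `|(m.+1%:Z - k.+1%:Z)%R|%N = `|(m%:Z - k%:Z)%R|%N by lia.
  by move: (\prod_(0 <= i < k) _) (\prod_(0 <= i < k) _) (qf _) (qf _) (qf _) => *; ring.
rewrite P; congr (_ * _); apply: eq_big_nat => i /andP[_ im]; congr (qf _); lia.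
Qed.

Lemma conj_part_eq0 (ns : seq nat) i : sorted geq ns -> (nth1 ns 1 < i)%N -> conj_part ns i = 0%N.
Proof.
move=> sns n1i; apply/eqP; rewrite -leqn0 leqNgt -has_count; apply/hasPn => x xns.
rewrite -ltnNge; apply: leq_ltn_trans n1i.
case: ns sns xns => // n s; rewrite /nth1 inE /= (path_sortedE geq_trans) => /andP[/allP ns_n _].
by case/orP => [/eqP->|/ns_n].
Qed.

(** The quotient of the pairs i <= j produces all the factors that contain 2c, the quotient of the
    pairs i < j produces [anum / aden]; all divisors are units. *)
Lemma limit_character (ns : seq nat) (h J N : nat) (S : fps rat) :
  let tc := (2 * size ns + h)%N in sorted geq ns -> (nth1 ns 1 + J <= N)%N ->
  S * \prod_(b <- pos_roots N) (1 - qvar rat ^+ `|deg b|%N) =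
    weyl_product (tc%:Z + 1) [ffun k : 'I_N => k%:Z - (conj_part ns k.+1)%:Z] rat ->
  eqm J S (character_formula ns h).
Proof.
move=> tc sns nN; rewrite prod_pos_roots.
pose l i := conj_part ns i.+1.
have lle i : (2 * l i <= tc)%N by have : (l i <= size ns)%N := count_size _ _; rewrite /tc; lia.
rewrite (weyl_productE _ (l := l)) // => [E|i j ij]; last first.
  by apply: sub_count => x /=; apply: leq_trans.
have ua : aprod qf (fun=> 0%N) N \is a GRing.unit.
  apply: prod_unit => j _; apply: prod_unit => i; rewrite mem_index_iota => /andP[_ ij].
  by apply: qf_unit; lia.
have ue : eprod qf 0 N \is a GRing.unit := eprod_unit 0 N.
have ud : aden qf ns \is a GRing.unit by apply: prod_unit => i _; apply: phi_unit.
have lsup i : (nth1 ns 1 <= i)%N -> l i = 0%N := @conj_part_eq0 ns i.+1 sns.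
apply: (eqm_mulI ue); apply: (eqm_mulI ua); rewrite -[S * _ * _]mulrA E mulrC.
apply: (eqm_mulI ud); rewrite mulrAC.
apply: (eqm_trans (eqmM (eqm_aprod sns nN) (eqm_bprod lsup lle nN))).
apply: (@eqm_trans _ (aprod qf (fun=> 0%N) N * anum qf ns * (eprod qf 0 N * level_factor tc *
    ((\prod_(0 <= i < nth1 ns 1) (qfact qf (tc + i + nth1 ns 1) / qfact qf (tc + nth1 ns 1 + i - l i))) *
     \prod_(0 <= i < (nth1 ns 1).+1) \prod_(i.+1 <= j < (nth1 ns 1).+1)
       (qf (tc + j + i - l i - l j.-1) / qf (tc + j + i)))))).
  by apply: eqmM => //; apply: eqmM => //; apply: eqm_eprod; apply: leq_trans nN; apply: leq_addl.
rewrite character_formulaE -/tc.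
rewrite (_ : \prod_(0 <= i < (nth1 ns 1).+1) \prod_(i.+1 <= j < (nth1 ns 1).+1)
       (qf (tc + j + i - l i - l j.-1) / qf (tc + j + i)) =
   \prod_(0 <= i < (nth1 ns 1).+1) \prod_(i.+1 <= j < (nth1 ns 1).+1)
       (qf (tc + j + i - conj_part ns i.+1 - conj_part ns j) / qf (tc + j + i))); last first.
  by apply: eq_bigr => i _; apply: eq_big_nat => -[|j].
move: (\prod_(0 <= i < _) _) (\prod_(0 <= i < _) _) => a b.
have := mulVr ud; move: (aden qf ns) => d; move: (d^-1) => d' dd.
move: (aprod _ _ _) (eprod _ _ _) (anum _ _) (level_factor _) => x y z t.
rewrite [X in eqm _ _ X](_ : _ = (d' * d) * (x * z * (y * t * (b * a)))); last by ring.
by rewrite dd mul1r.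
Qed.

(** * Fundamental and dominant weights *)

Section Weights.
Variable F : numFieldType.
Implicit Types (La : ghat F -> F) (x : ghat F) (i j n : nat).

Lemma fsum_pos (f : nat -> F) B : (forall i, (B < i)%N -> f i = 0) ->
  \sum_(i \in [set i : nat | (0 < i)%N]%classic) f i = \sum_(1 <= i < B.+1) f i.
Proof.
move=> f0; apply: esym; rewrite fsbig_seq ?iota_uniq //; apply: fsbig_widen => i /=.
  by rewrite mem_index_iota => /andP[].
move=> [i0 iB]; apply: f0; rewrite ltnNge; apply/negP => Bi; apply: iB.
by rewrite /= mem_index_iota i0.
Qed.

Lemma hdiagE j p q : (hdiag F j).1 p q =
  ((p == j%:Z) && (q == j%:Z))%:R - ((p == - j%:Z) && (q == - j%:Z))%:R.
Proof. exact: erefl. Qed.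

Lemma hdiag_cartan j : is_cartan (hdiag F j).
Proof.
split; first split=> // p q pq.
  rewrite hdiagE (_ : (_ == j%:Z) && _ = false); last by lia.
  by rewrite (_ : _ && _ = false) ?subrr //; lia.
by move=> p; rewrite !hdiagE !eqr_opp opprB (eqr_oppLR p).
Qed.

Lemma central_cartan : is_cartan (central F).
Proof. by split=> [|p]; [split | rewrite oppr0]. Qed.

Lemma cartan_lin a x y : is_cartan x -> is_cartan y -> is_cartan (a *: x + y).
Proof.
case=> [[hx _] sx] [[hy _] sy]; split; first split=> // p q pq.
  by rewrite add1E scale1E hx // hy // mulr0 addr0.
by move=> p; rewrite !add1E !scale1E sx sy mulrN -opprD.
Qed.

Lemma coroot0E : coroot F 0 = (- 2) *: hdiag F 1 + 2 *: central F.
Proof.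
by rewrite /coroot eqxx /hdiag scaleNr -scalerN; congr (2 *: _ + _);
  congr pair; rewrite /= ?oppr0 ?opprB.
Qed.

Lemma corootSE j : coroot F j.+1 = (- 1) *: hdiag F j.+2 + hdiag F j.+1.
Proof.
rewrite /coroot /= /hdiag scaleN1r; congr pair; last by rewrite /= oppr0 addr0.
by rewrite /= opprB addrA; congr (_ - _); rewrite addrC addrA addrAC.
Qed.

Lemma weight_finite La : is_weight La -> exists B, (forall i, (B < i)%N -> La (hdiag F i) = 0) /\
  forall x, is_cartan x ->
    La x = \sum_(1 <= i < B.+1) x.1 i%:Z i%:Z * La (hdiag F i) + x.2 * La (central F).
Proof.
case=> /finite_seqP [s sE] Lw.
(* The sum of the finite support bounds each of its elements. *)
have out i : (\sum_(n <- s) n < i)%N -> La (hdiag F i) = 0.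
  move=> si; have i0 : (0 < i)%N by apply: leq_ltn_trans si.
  apply: contraTeq si => nz; rewrite -leqNgt.
  have is_ : i \in s.
    have : [set i : nat | (0 < i)%N /\ La (hdiag F i) != 0]%classic i by split.
    by rewrite sE.
  by rewrite (big_rem i is_) /= leq_addr.
exists (\sum_(n <- s) n)%N; split=> // x cx.
by rewrite Lw //; congr (_ + _); apply: fsum_pos => i si; rewrite out // mulr0.
Qed.

Lemma weight_lin La a x y : is_weight La -> is_cartan x -> is_cartan y ->
  La (a *: x + y) = a * La x + La y.
Proof.
move=> /weight_finite [B [_ Lw]] cx cy.
rewrite (Lw _ (cartan_lin a cx cy)) (Lw _ cx) (Lw _ cy) add2E scale2E mulrDr mulrDl addrACA mulrA; congr (_ + _).
rewrite mulr_sumr -big_split; apply: eq_bigr => i _.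
by rewrite add1E scale1E mulrDl -mulrA.
Qed.

(** The coroots give the differences of consecutive values; since the values vanish far out,
    downward induction determines them. *)
Lemma fundamental_hdiag i La j : is_fundamental_weight i La -> (0 < j)%N ->
  La (hdiag F j) = (j <= i)%:R.
Proof.
case=> Lw Lc j0; have [B [L0 _]] := weight_finite Lw.
have step k : La (hdiag F k.+1) = La (hdiag F k.+2) + (i == k.+1)%:R.
  have := Lc k.+1; rewrite corootSE weight_lin //; try exact: hdiag_cartan.
  by move=> <-; rewrite mulN1r addrA subrr add0r.
have [d] : exists d, (maxn B i < j + d)%N by exists (maxn B i).+1; lia.
elim: d j j0 => [|d IH] j j0 jd.
  by rewrite L0; last lia; rewrite (_ : (j <= i)%N = false) //; lia.
case: j j0 jd => // j _ jd; rewrite step IH //; last by lia.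
by rewrite -natrD; congr (_%:R); case: (ltngtP i j.+1) => //=; lia.
Qed.

Lemma fundamental_central i La : is_fundamental_weight i La ->
  La (central F) = if i == 0%N then 2^-1 else 1.
Proof.
move=> fi; have [Lw Lc] := fi; have := Lc 0%N.
have c2 : is_cartan (2 *: central F).
  by rewrite -[_ *: _]addr0; apply: cartan_lin; [exact: central_cartan | split=> [|p]; [split | rewrite oppr0]].
have L2 : La (2 *: central F) = 2 * La (central F).
  have [B [_ LE]] := weight_finite Lw; rewrite (LE _ c2) [in RHS](LE _ central_cartan) scale2E -mulrA mulrDr; congr (_ + _); rewrite mulr_sumr; apply: eq_bigr => p _.
  by rewrite scale1E mulrA.
rewrite coroot0E weight_lin ?L2 //; last exact: hdiag_cartan.
rewrite (fundamental_hdiag fi) // => E.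
have -> : La (central F) = ((i == 0%N)%:R + 2 * (1 <= i)%:R) / 2.
  by rewrite -E; field.
by case: (i) => [|n] /=; field.
Qed.

Section DominantWeight.
Variables (ns : seq nat) (h : nat) (Lf : nat -> ghat F -> F) (La : ghat F -> F).
Hypothesis ns_pos : all (leq 1) ns.
Hypothesis Lf_fund : forall i, is_fundamental_weight i (Lf i).
Hypothesis LaE : forall x, La x = \sum_(n <- ns) Lf n x + h%:R * Lf 0%N x.

Lemma dominant_central : La (central F) = (size ns)%:R + h%:R / 2.
Proof.
rewrite LaE (fundamental_central (Lf_fund 0)); congr (_ + _).
rewrite big_seq (eq_bigr (fun=> 1)) => [|n /(allP ns_pos) n0].
  by rewrite -big_seq big_const_seq count_predT iter_addr addr0.
by rewrite (fundamental_central (Lf_fund n)) (gtn_eqF n0).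
Qed.

Lemma dominant_hdiag i : (0 < i)%N -> La (hdiag F i) = (conj_part ns i)%:R.
Proof.
move=> i0; rewrite LaE (fundamental_hdiag (Lf_fund 0)) // leqNgt i0 mulr0 addr0.
rewrite /conj_part -sum1_count [in RHS]big_mkcond natr_sum; apply: eq_bigr => n _.
by rewrite (fundamental_hdiag (Lf_fund n)) //; case: ifP.
Qed.

Lemma dominant_weight x : is_cartan x ->
  La x = \sum_(i \in [set i : nat | (0 < i)%N]%classic) x.1 i%:Z i%:Z * La (hdiag F i)
         + x.2 * La (central F).
Proof.
(* A common bound for all the parts, which turns the sums into finite ones over one range that can
   be exchanged. *)
move=> cx; pose B := (\sum_(n <- ns) n)%N.
have LfE n : (n <= B)%N -> Lf n x =
    \sum_(1 <= i < B.+1) x.1 i%:Z i%:Z * Lf n (hdiag F i) + x.2 * Lf n (central F).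
  move=> nB; have [[_ Lw] _] := Lf_fund n; rewrite Lw //; congr (_ + _).
  apply: fsum_pos => i Bi; rewrite (fundamental_hdiag (Lf_fund n)); last by apply: leq_ltn_trans Bi.
  by rewrite leqNgt (leq_ltn_trans nB Bi) mulr0.
have nsB n : n \in ns -> (n <= B)%N by move=> nns; rewrite /B (big_rem n nns) /= leq_addr.
rewrite (@fsum_pos _ B) => [|i Bi]; last first.
  have i0 : (0 < i)%N by apply: leq_ltn_trans Bi.
  rewrite dominant_hdiag // (_ : conj_part ns i = 0%N) ?mulr0 //; apply/eqP.
  rewrite -leqn0 leqNgt -has_count; apply/hasPn => n /nsB nB.
  by rewrite -ltnNge (leq_ltn_trans nB).
rewrite !LaE (LfE 0%N) // big_seq (eq_bigr _ (fun n nns => LfE n (nsB n nns))) -big_seq.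
rewrite big_split /= exchange_big /= mulrDr addrACA; congr (_ + _); last first.
  by rewrite -mulr_sumr mulrDr mulrCA.
rewrite mulr_sumr -big_split; apply: eq_bigr => i _ /=.
by rewrite LaE mulrDr mulr_sumr mulrCA.
Qed.

End DominantWeight.

End Weights.

Lemma conj_part_decr (ns : seq nat) i j : (i <= j)%N -> (conj_part ns j <= conj_part ns i)%N.
Proof. by move=> ij; apply: sub_count => x /=; apply: leq_trans. Qed.

Lemma tb_character (F : numFieldType) (ns : seq nat) (h : nat)
    (Lf : nat -> ghat F -> F) (La : ghat F -> F) (V : lmodType F) (rho : ghat F -> V -> V)
    (L : nat -> set V) (v : V) :
  sorted geq ns -> all (leq 1) ns -> (forall i, is_fundamental_weight i (Lf i)) ->
  (forall x, La x = \sum_(n <- ns) Lf n x + h%:R * Lf 0%N x) ->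
  irr_highest_weight_module (@tb_infty F) La rho L v ->
  is_q_character L (character_formula ns h).
Proof.
move=> sns pns fund LaE H; set tc := (2 * size ns + h)%N.
have Lac : La (central F) = tc%:R / 2.
  by rewrite (dominant_central pns fund LaE) /tc natrD natrM; field.
have lev : (2 * conj_part ns 1 <= tc)%N.
  by have : (conj_part ns 1 <= size ns)%N := count_size _ _; rewrite /tc; lia.
have dims J : exists d : nat, has_dim (L J) d /\ fcoef (character_formula ns h) J = d%:R.
  (* N = n_1 + 2J is the bound of [truncated_dim]; [limit_character] asks only for n_1 + J. *)
  have [//|d [dimd [S [SE SJ]]]] := @truncated_dim F V La rho L v H tc (nth1 ns 1) (conj_part ns)
    (dominant_weight fund LaE) Lac (dominant_hdiag fund LaE) (fun k => conj_part_eq0 sns)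
    (fun k _ => conj_part_decr ns (leqnSn k)) lev (nth1 ns 1 + 2 * J)%N J.
  exists d; split=> //; rewrite -SJ; apply/esym.
  by apply: (limit_character sns _ SE (leqnn J)); lia.
have [d dP] := choice dims.
by exists d; split=> [j|]; [case: (dP j) | apply: fpsP => j; case: (dP j)].
Qed.

Theorem proposition1p1 (R : realType) (ns : seq nat) (h : nat)
    (Lf : nat -> ghat R[i] -> R[i]) (La : ghat R[i] -> R[i])
    (ns_sorted : sorted geq ns) (ns_pos : all (leq 1) ns)
    (Lf_fund : forall i, is_fundamental_weight i (Lf i))
    (LaE : forall x, La x = \sum_(n <- ns) Lf n x + h%:R * Lf 0%N x) :
  [/\ La (central R[i]) = (size ns)%:R + h%:R / 2,
      forall i, (0 < i)%N -> La (hdiag R[i] i) = (conj_part ns i)%:R,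
      forall (V : lmodType R[i]) (rho : ghat R[i] -> V -> V)
          (L : nat -> set V) (v : V),
        irr_highest_weight_module (@b_infty R[i]) La rho L v ->
        is_q_character L (character_formula ns h)
    & forall (V : lmodType R[i]) (rho : ghat R[i] -> V -> V)
          (L : nat -> set V) (v : V),
        irr_highest_weight_module (@tb_infty R[i]) La rho L v ->
        is_q_character L (character_formula ns h)].
Proof.
split.
- exact: dominant_central ns_pos Lf_fund LaE.
- by move=> i; apply: dominant_hdiag Lf_fund LaE _.
- by move=> V rho L v /untwist_module; apply: tb_character ns_sorted ns_pos Lf_fund LaE.
- by move=> V rho L v; apply: tb_character ns_sorted ns_pos Lf_fund LaE.
Qed.
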